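(* Let $A, B, C$ be unital dual operator algebras such that $C\subset_\Delta B$ and $B\subset_\Delta A$. Then $C\subset_\Delta A$.
   Context: A dual operator algebra is an operator algebra which is also a dual operator space (i.e. completely isometrically isomorphic to the operator space dual of some operator space). $[S]^{-w^*}$ is the $w^*$-closure of the linear span of $S$. A TRO is a subspace $M\subseteq B(H,K)$ with $m_1m_2^*m_3\in M$ for all $m_i\in M$. $w^*$-closed algebras $A\subseteq B(H)$, $B\subseteq B(K)$ are weakly TRO-equivalent, $A\sim_{TRO}B$, if there is a TRO $M\subseteq B(H,K)$ with $A=[M^*BM]^{-w^*}$ and $B=[MAM^*]^{-w^*}$. For unital $w^*$-closed algebras $A\subseteq B(H)$, $B\subseteq B(K)$ (unital: containing the identity operator), $B\subset_{TRO}A$ means that there is a projection $p\in A$ with $B\sim_{TRO}pAp$, where $pAp$ is identified with $pA|_{p(H)}\subseteq B(p(H))$. For unital dual operator algebras, $B\subset_\Delta A$ means that there exist $w^*$-continuous completely isometric homomorphisms $\alpha:A\to\alpha(A)$, $\beta:B\to\beta(B)$ onto such concretely acting algebras with $\beta(B)\subset_{TRO}\alpha(A)$. *)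

(* Defs.v *)
From HB Require Import structures.
From mathcomp Require Import all_boot all_order all_algebra sesquilinear.
From mathcomp Require Import all_classical all_reals.
From mathcomp Require Import topology normedtype sequences complex.

Set Implicit Arguments.
Unset Strict Implicit.
Unset Printing Implicit Defensive.

Import Order.TTheory GRing.Theory Num.Theory.
Import numFieldNormedType.Exports.

Local Open Scope classical_set_scope.
Local Open Scope ring_scope.

HB.mixin Record isHilbert (R : realType) H of CompleteNormedModule R[i] H := {
  hdot : {dot H for Num.conj};
  hdotxx : forall x : H, hdot x x = `|x| ^+ 2
}.

#[short(type="hilbertType")]
HB.structure Definition Hilbert (R : realType) :=
  {H of isHilbert R H & CompleteNormedModule R[i] H}.

(* `|x| lives in R[i]; rnorm x is the same number in R. *)
Definition rnorm (R : realType) (V : normedModType R[i]) (x : V) : R :=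
  complex.Re `|x|.

Definition l2norm (R : realType) (V : normedModType R[i]) (I : finType)
    (x : I -> V) : R :=
  Num.sqrt (\sum_i rnorm (x i) ^+ 2).

(* The norm of the I x I matrix T of operators, acting from the l^2-sum of I
   copies of V to the l^2-sum of I copies of W. *)
Definition l2opnorm (R : realType) (V W : normedModType R[i]) (I : finType)
    (T : I -> I -> V -> W) : R :=
  sup [set l2norm (fun i => \sum_j T i j (x j)) | x in [set x | l2norm x <= 1]].

Section Bop.
Context {R : realType}.
Variables H K : hilbertType R.

Definition is_bop : pred (H -> K) := fun f => `[< linear f /\ continuous f >].

Record bop := Bop { bop_fun :> H -> K; bop_subproof : is_bop bop_fun }.

HB.instance Definition _ := [isSub of bop for bop_fun].
HB.instance Definition _ := [Choice of bop by <:].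

Lemma is_bop_submod_closed : submod_closed is_bop.
Proof.
split.
  apply/asboolP; split=> [a x y|]; last exact: cst_continuous.
  by rewrite /= scaler0 addr0.
move=> a f g /asboolP[fl fc] /asboolP[gl gc]; apply/asboolP; split.
  move=> b x y.
  change (a *: f (b *: x + y) + g (b *: x + y) =
          b *: (a *: f x + g x) + (a *: f y + g y)).
  by rewrite fl gl !scalerDr !scalerA [b * a]mulrC addrACA.
move=> x.
by apply: cvgD; [apply: cvgZl_tmp; exact: fc | exact: gc].
Qed.

HB.instance Definition _ :=
  GRing.isSubmodClosed.Build _ _ is_bop is_bop_submod_closed.
HB.instance Definition _ :=
  GRing.SubChoice_isSubLmodule.Build _ _ is_bop bop
    (GRing.submod_closed_semi is_bop_submod_closed).

Lemma bop_linear (T : bop) : linear T.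
Proof. by have /asboolP[] := bop_subproof T. Qed.

Lemma bop_continuous (T : bop) : continuous T.
Proof. by have /asboolP[] := bop_subproof T. Qed.

HB.instance Definition _ (T : bop) :=
  GRing.isLinear.Build R[i] H K _ T (bop_linear T).

End Bop.

Section Composition.
Context {R : realType}.

Lemma bcomp_subproof (H K L : hilbertType R) (S : bop K L) (T : bop H K) :
  is_bop (S \o T).
Proof.
apply/asboolP; split=> [a x y /=|x]; first by rewrite !linearP.
by apply: continuous_comp; exact: bop_continuous.
Qed.

Definition bcomp (H K L : hilbertType R) (S : bop K L) (T : bop H K) : bop H L :=
  Bop (bcomp_subproof S T).

Lemma bid_subproof (H : hilbertType R) :
  is_bop (@idfun H).
Proof. by apply/asboolP; split=> // x; exact: cvg_id. Qed.

Definition bid (H : hilbertType R) : bop H H := Bop (bid_subproof H).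

(* By Riesz representation the set below is always a singleton. *)
Definition adj (H K : hilbertType R) (T : bop H K) : bop K H :=
  xget 0 [set S : bop K H | forall x y, hdot (T x) y = hdot x (S y)].

End Composition.

(* The sequences xi in H with \sum_n `|xi n|^2 < oo. *)
Record sqsum (R : realType) (H : hilbertType R) := Sqsum {
  sqsum_seq :> nat -> H;
  sqsum_cvg : cvgn (series (fun n => rnorm (sqsum_seq n) ^+ 2) : R^nat)
}.

(* T |-> \sum_n <T (xi n), eta n>; these are the normal functionals on the
   bounded operators, and the w*-topology (of the predual of trace class
   operators) is the topology of pointwise convergence on them. *)
Definition normal_fun (R : realType) (H K : hilbertType R) (T : bop H K)
    (p : sqsum H * sqsum K) : R[i]^o :=
  limn (series (fun n => hdot (T (p.1 n)) (p.2 n) : R[i]^o)).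

Definition bop_wstar (R : realType) (H K : hilbertType R) : Type :=
  initial_topology
    (@normal_fun R H K : bop H K -> {ptws sqsum H * sqsum K -> R[i]^o}).

HB.instance Definition _ (R : realType) (H K : hilbertType R) :=
  Topological.copy (bop_wstar H K)
    (initial_topology
      (@normal_fun R H K : bop H K -> {ptws sqsum H * sqsum K -> R[i]^o})).

Definition wclosed (R : realType) (H K : hilbertType R) (S : set (bop H K)) :=
  closed (S : set (bop_wstar H K)).

Definition lspan (R : realType) (V : lmodType R[i]) (S : set V) : set V :=
  [set v | exists n (c : 'I_n -> R[i]) (s : 'I_n -> V),
    (forall i, S (s i)) /\ v = \sum_i c i *: s i].

Definition wspan (R : realType) (H K : hilbertType R) (S : set (bop H K)) :
    set (bop H K) :=
  closure (lspan S : set (bop_wstar H K)).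

Definition is_subspace (R : realType) (V : lmodType R[i]) (S : set V) :=
  S 0 /\ forall a x y, S x -> S y -> S (a *: x + y).

Definition unital_wclosed_algebra (R : realType) (H : hilbertType R)
    (A : set (bop H H)) :=
  [/\ is_subspace A, forall S T, A S -> A T -> A (bcomp S T),
      A (bid H) & wclosed A].

Definition is_TRO (R : realType) (H K : hilbertType R) (M : set (bop H K)) :=
  is_subspace M /\
  forall m1 m2 m3, M m1 -> M m2 -> M m3 -> M (bcomp m1 (bcomp (adj m2) m3)).

Definition TRO_equiv (R : realType) (H K : hilbertType R)
    (A : set (bop H H)) (B : set (bop K K)) :=
  exists M : set (bop H K), [/\ is_TRO M,
    A = wspan [set T | exists m1 b m2, [/\ M m1, B b, M m2 &
                         T = bcomp (adj m1) (bcomp b m2)]] &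
    B = wspan [set T | exists m1 a m2, [/\ M m1, A a, M m2 &
                         T = bcomp m1 (bcomp a (adj m2))]]].

Section Projection.
Context {R : realType}.

Record projection (H : hilbertType R) := Projection {
  proj_op :> bop H H;
  proj_idem : bcomp proj_op proj_op = proj_op;
  proj_adj : adj proj_op = proj_op
}.

Variables (H : hilbertType R) (p : projection H).

Definition in_prange : pred H := fun x => x \in range p.

Record prange := PRange {
  prange_val :> H;
  prange_subproof : in_prange prange_val
}.

HB.instance Definition _ := [isSub of prange for prange_val].
HB.instance Definition _ := [Choice of prange by <:].

Lemma projK x : p (p x) = p x.
Proof. by rewrite -[in RHS](proj_idem p). Qed.

Lemma in_prangeE x : in_prange x = (p x == x).
Proof.
apply/idP/eqP => [/set_mem[y _ <-]|<-]; first exact: projK.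
by apply/mem_set; exists x.
Qed.

Lemma in_prange_submod_closed : submod_closed in_prange.
Proof.
split=> [|a x y]; rewrite /in_mem/= !in_prangeE; first by rewrite linear0.
by move=> /eqP px /eqP py; rewrite linearP /= px py.
Qed.

HB.instance Definition _ :=
  GRing.isSubmodClosed.Build _ _ in_prange in_prange_submod_closed.
HB.instance Definition _ :=
  GRing.SubChoice_isSubLmodule.Build _ _ in_prange prange
    (GRing.submod_closed_semi in_prange_submod_closed).

Let prange_norm (x : prange) : R[i] := `|prange_val x|.

Lemma prange_normD x y : prange_norm (x + y) <= prange_norm x + prange_norm y.
Proof. exact: ler_normD. Qed.

Lemma prange_normZ (l : R[i]) x : prange_norm (l *: x) = `|l| * prange_norm x.
Proof. exact: normrZ. Qed.

Lemma prange_norm0_eq0 x : prange_norm x = 0 -> x = 0.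
Proof. by move=> /normr0_eq0 x0; exact: val_inj. Qed.

HB.instance Definition _ := Lmodule_isNormed.Build R[i] prange
  prange_normD prange_normZ prange_norm0_eq0.

Lemma prange_complete (F : set_system prange) :
  ProperFilter F -> cauchy F -> cvg F.
Proof.
move=> FF /cauchyP Fc.
have /cauchy_cvg Gcvg : cauchy (prange_val @ F).
  apply: (@cauchy_exP R[i] H) => e /Fc[x Fx]; exists (prange_val x).
  apply: (@filterS _ F _ (ball x e)) Fx => y.
  by rewrite /preimage/= -!ball_normE.
set L := lim (prange_val @ F) in Gcvg.
have pL : p L = L.
  have pvE : p \o prange_val = prange_val.
    apply/funext => x /=; apply/eqP; rewrite -in_prangeE.
    exact: prange_subproof.
  have pcvg : (p \o prange_val) @ F --> p L.
    by apply: cvg_comp Gcvg _; exact: bop_continuous.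
  rewrite pvE in pcvg.
  have hH : hausdorff_space H := @norm_hausdorff _ H.
  rewrite -[RHS]/(lim (prange_val @ F)).
  exact: esym (cvg_lim hH pcvg).
have LP : in_prange L by rewrite in_prangeE pL.
apply/cvg_ex; exists (PRange LP); apply/cvg_ballP => e e0.
have /cvg_ballP/(_ e e0) := Gcvg.
apply: (@filterS _ F _ (prange_val @^-1` ball L e)) => y.
by rewrite /preimage/= -!ball_normE.
Qed.

HB.instance Definition _ := Uniform_isComplete.Build prange prange_complete.

Let prange_dot (x y : prange) : R[i] := hdot (prange_val x) (prange_val y).


Lemma prange_dot_bilinear :
  bilinear_for ( *%R : R[i] -> R[i] -> R[i]) (Num.conj \; *%R) prange_dot.
Proof.
split=> [y a x x'|x a y y'] /=; rewrite /prange_dot.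
  exact: (linearPl (@hdot R H)).
exact: (linearPr (@hdot R H)).
Qed.

HB.instance Definition _ :=
  bilinear_isBilinear.Build R[i] prange prange R[i] _ _ prange_dot
    prange_dot_bilinear.

Lemma prange_dot_herm (x y : prange) :
  prange_dot x y = (-1) ^+ false * Num.conj (prange_dot y x).
Proof. exact: (@hermitian_subproof _ _ _ _ (@hdot R H)). Qed.

HB.instance Definition _ :=
  isHermitianSesquilinear.Build R[i] prange false Num.conj prange_dot
    prange_dot_herm.

Lemma prange_dot_gt0 (x : prange) : x != 0 -> 0 < prange_dot x x.
Proof.
move=> x0; rewrite /prange_dot hdotxx exprn_gt0// normr_gt0.
by apply: contra x0 => /eqP x0; apply/eqP/val_inj.
Qed.

HB.instance Definition _ :=
  isDotProduct.Build R[i] prange prange_dot prange_dot_gt0.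

Lemma prange_dotxx (x : prange) : prange_dot x x = `|x| ^+ 2.
Proof. exact: hdotxx. Qed.

HB.instance Definition _ := isHilbert.Build R prange prange_dotxx.

Lemma prange_val_continuous : continuous (prange_val : prange -> H).
Proof.
pose f := HB.pack_for {linear prange -> H} prange_val
  (GRing.isLinear.Build R[i] prange H _ prange_val
     (fun a x y => erefl :
        prange_val (a *: x + y) = a *: prange_val x + prange_val y)).
apply: (@bounded_linear_continuous R[i] prange H f).
by apply/linear_boundedP; exists 1; split=> // r r1 x; rewrite ler_peMl// ltW.
Qed.

Lemma prange_cvg (F : set_system prange) (FF : Filter F) (f : prange -> prange)
    (l : prange) :
  prange_val \o f @ F --> prange_val l -> f @ F --> l.
Proof.
move=> /cvg_ballP fl; apply/cvg_ballP => e e0.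
apply: (@filterS _ F _ ((prange_val \o f) @^-1` ball (prange_val l) e)) (fl e e0).
by move=> y; rewrite /preimage/= -!ball_normE.
Qed.

Definition compress_fun (T : bop H H) (x : prange) : H :=
  p (T (p (prange_val x))).

Lemma compress_fun_in (T : bop H H) x : in_prange (compress_fun T x).
Proof. by apply/mem_set; exists (T (p (prange_val x))). Qed.

Lemma compress_subproof (T : bop H H) :
  is_bop (fun x : prange => PRange (compress_fun_in T x) : prange).
Proof.
apply/asboolP; split=> [a x y|x].
  by apply/val_inj; rewrite /= /compress_fun !linearP.
have cc : {for x, continuous (compress_fun T)}.
  apply: (@continuous_comp _ _ _ (T \o (p \o prange_val)) p); last first.
    exact: bop_continuous.
  apply: (@continuous_comp _ _ _ (p \o prange_val) T); last first.
    exact: bop_continuous.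
  apply: (@continuous_comp _ _ _ prange_val p); last exact: bop_continuous.
  exact: prange_val_continuous.
exact: (prange_cvg (nbhs_filter x)).
Qed.

Definition compress (T : bop H H) : bop prange prange :=
  Bop (compress_subproof T).

End Projection.

Definition TRO_sub (R : realType) (K H : hilbertType R)
    (B : set (bop K K)) (A : set (bop H H)) :=
  exists p : projection H, A p /\ TRO_equiv B (compress p @` A).

HB.mixin Record hasMatrixNorm (R : realType) V of GRing.Lmodule R[i] V := {
  mxnorm : forall n, 'M[V]_n -> R
}.

(* mxnorm is raw data; that it comes from operators on a Hilbert space is
   required in isOperatorSpace and isUnitalOperatorAlgebra below. *)
#[short(type="mxNormedType")]
HB.structure Definition MatrixNormed (R : realType) :=
  {V of hasMatrixNorm R V & GRing.Lmodule R[i] V}.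
Arguments mxnorm {R s n} : rename.

HB.instance Definition _ (R : realType) (H K : hilbertType R) :=
  hasMatrixNorm.Build R (bop H K)
    (fun n (T : 'M[bop H K]_n) => l2opnorm (fun i j => T i j : H -> K)).

Definition complete_isometry (R : realType) (V W : mxNormedType R) (f : V -> W) :=
  forall n (v : 'M[V]_n), mxnorm (map_mx f v) = mxnorm v.

Definition norm1 (R : realType) (V : mxNormedType R) (x : V) : R :=
  mxnorm (const_mx x : 'M[V]_1).

Definition norm_closed (R : realType) (V : mxNormedType R) (S : set V) :=
  forall x, (forall e : R, 0 < e -> exists2 y, S y & norm1 (x - y) < e) -> S x.

HB.mixin Record isOperatorSpace (R : realType) V of MatrixNormed R V := {
  opspace_rep : exists (H : hilbertType R) (f : {linear V -> bop H H}),
    complete_isometry f /\ norm_closed (range f)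
}.

#[short(type="opSpaceType")]
HB.structure Definition OperatorSpace (R : realType) :=
  {V of isOperatorSpace R V & MatrixNormed R V}.

Section Dual.
Context {R : realType} (X : opSpaceType R).

Definition is_dual : pred (X -> R[i]) := fun f =>
  `[< linear (f : X -> R[i]^o) /\
      exists M : R, forall x, `|f x| <= (M * norm1 x)%:C%C >].

Record dual := Dual { dual_fun :> X -> R[i]^o; dual_subproof : is_dual dual_fun }.

HB.instance Definition _ := [isSub of dual for dual_fun].
HB.instance Definition _ := [Choice of dual by <:].

Lemma is_dual_submod_closed :
  submod_closed (is_dual : pred (X -> R[i]^o)).
Proof.
split.
  apply/asboolP; split=> [a x y|]; first by rewrite /= scaler0 addr0.
  by exists 0 => x; rewrite mul0r normr0.
move=> a f g /asboolP[fl [M fM]] /asboolP[gl [N gN]]; apply/asboolP; split.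
  move=> b x y.
  have fE := fl b x y; have gE := gl b x y.
  change (a *: (f (b *: x + y) : R[i]^o) + (g (b *: x + y) : R[i]^o) =
          b *: (a *: (f x : R[i]^o) + (g x : R[i]^o)) +
          (a *: (f y : R[i]^o) + (g y : R[i]^o))).
  by rewrite fE gE !scalerDr !scalerA [b * a]mulrC addrACA.
exists (complex.Re `|a| * M + N) => x.
change (`|a * f x + g x| <= ((complex.Re `|a| * M + N) * norm1 x)%:C%C).
apply: (le_trans (ler_normD _ _)); rewrite mulrDl rmorphD /=.
apply: lerD => //; rewrite normrM -mulrA rmorphM /=.
have -> : (complex.Re `|a|)%:C%C = `|a| by rewrite RRe_real// normr_real.
by apply: ler_wpM2l.
Qed.


HB.instance Definition _ :=
  GRing.isSubmodClosed.Build _ _ _ is_dual_submod_closed.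
HB.instance Definition _ :=
  GRing.SubChoice_isSubLmodule.Build _ _ _ dual
    (GRing.submod_closed_semi is_dual_submod_closed).

(* M_n(X* ) = CB(X, M_n): the n x n matrix f of functionals has the completely
   bounded norm of the map x |-> (f_ij x)_ij. *)
HB.instance Definition _ :=
  hasMatrixNorm.Build R dual (fun n (f : 'M[dual]_n) =>
    sup [set r | exists m (x : 'M[X]_m), mxnorm x <= 1 /\
      r = l2opnorm (fun (k l : 'I_n * 'I_m) (z : R[i]^o) =>
            (f k.1 l.1 (x k.2 l.2) : R[i]^o) * z)]).

End Dual.

#[short(type="mxNormedAlgType")]
HB.structure Definition MatrixNormedAlgebra (R : realType) :=
  {A of GRing.Algebra R[i] A & MatrixNormed R A}.

HB.mixin Record isUnitalOperatorAlgebra (R : realType) A of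
    MatrixNormedAlgebra R A := {
  norm1_one : norm1 (1 : A) = 1;
  opalg_rep : exists (H : hilbertType R) (f : {linear A -> bop H H}),
    [/\ forall a b, f (a * b) = bcomp (f a) (f b),
        complete_isometry f & norm_closed (range f)]
}.

#[short(type="unitalOpAlgType")]
HB.structure Definition UnitalOperatorAlgebra (R : realType) :=
  {A of isUnitalOperatorAlgebra R A & MatrixNormedAlgebra R A}.

(* An operator space structure of A as the dual of an operator space; the
   predual is part of the data, as it determines the w*-topology of A. *)
HB.mixin Record hasPredual (R : realType) A of MatrixNormed R A := {
  predual : opSpaceType R;
  to_dual : {linear A -> dual predual};
  to_dual_bij : bijective to_dual;
  to_dual_isometry : complete_isometry to_dual
}.

#[short(type="dualOpAlgType")]
HB.structure Definition UnitalDualOperatorAlgebra (R : realType) :=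
  {A of hasPredual R A & UnitalOperatorAlgebra R A}.
Arguments predual {R} s.

Definition to_dual_fun (R : realType) (A : dualOpAlgType R) (a : A) :
    {ptws predual A -> R[i]^o} :=
  to_dual a.

Definition wstar (R : realType) (A : dualOpAlgType R) : Type :=
  initial_topology (@to_dual_fun R A).

HB.instance Definition _ (R : realType) (A : dualOpAlgType R) :=
  Topological.copy (wstar A) (initial_topology (@to_dual_fun R A)).

Definition normal_rep (R : realType) (A : dualOpAlgType R) (H : hilbertType R)
    (f : {linear A -> bop H H}) :=
  [/\ forall a b, f (a * b) = bcomp (f a) (f b),
      complete_isometry f,
      continuous (f : wstar A -> bop_wstar H H) &
      unital_wclosed_algebra (range f)].

Definition Delta_sub (R : realType) (B A : dualOpAlgType R) :=
  exists (H K : hilbertType R)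
         (alpha : {linear A -> bop H H}) (beta : {linear B -> bop K K}),
    [/\ normal_rep alpha, normal_rep beta & TRO_sub (range beta) (range alpha)].

(* Main.v *)
(* Let C act on L and B on K' so that C is TRO-equivalent to a corner of B via a
   TRO N, and let B act on K and A on H so that B is TRO-equivalent to a corner
   of A via a TRO M. The two actions of B need not agree, so C is represented
   anew: inducing the action of B on K along N gives a Hilbert space E, the
   completion of N^* (x) K, and a TRO between E and K which implements the first
   equivalence over the action of B on K. The inner product on E is positive
   because positivity of an operator matrix is detected by matrix norms, hence
   does not depend on the completely isometric unital representation; the same
   argument shows that the induced representation of C is completely isometric.
   Normal functionals of a w*-continuous completely isometric representation
   exhaust the predual by Hahn-Banach separation. So norm limits of w*-continuous
   functionals are w*-continuous, which gives w*-continuity of the induced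
   representation from that of its matrix coefficients; and an operator in the
   w*-closure of the range defines a functional on the predual, hence an element
   of the algebra, so the range is w*-closed.

   With both TROs over the same action of B, the span U of the products m d n,
   for d in the diagonal of B, is a TRO implementing the equivalence of C with
   the corner of A cut down by the projection r onto the closed span of the range
   of U. That r lies in A follows from r being in the w*-closed span of U U^*. *)
Require Import Defs.
From HB Require Import structures.
From mathcomp Require Import all_boot all_order all_algebra sesquilinear.
From mathcomp Require Import all_classical all_reals.
From mathcomp Require Import topology normedtype sequences complex ring lra.

Set Implicit Arguments.
Unset Strict Implicit.
Unset Printing Implicit Defensive.

Import Order.TTheory GRing.Theory Num.Theory.
Import numFieldNormedType.Exports.

Local Open Scope classical_set_scope.
Local Open Scope ring_scope.

(** * Pre-Hilbert spaces *)

(** Norms see real parts: [1 - s X] has norm at most [1 + O(s^2)] for small positive [s] exactly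
    when [X] is accretive, and accretivity of a matrix multiplied by 1, i and -i amounts to
    positivity. Norm bounds take the same form, since [c] is a contraction if and only if the block
    matrix with rows (1, 2 c) and (0, 1) is accretive.

    It is the action of [C] that is changed because [C] is the closed span of [N^* B N], so that an
    action of [B] determines one of [C]; in [A] the algebra [B] accounts for a corner only.

    For the projection [r], least squares takes the place of functional calculus: given finitely
    many normal functionals, an operator in the span of [U U^*] is chosen that almost minimises the
    distance to [r] in a Hilbert seminorm built from these functionals. Such approximants need not
    be bounded in operator norm. *)

Section ComplexAbs.
Context {R : realType}.
Implicit Types (x y z : R[i]) (a b e : R).

Definition cabs z : R := complex.Re `|z|.
Local Notation Re := (@complex.Re R).

Lemma cabsE z : (cabs z)%:C%C = `|z|.
Proof. by rewrite /cabs RRe_real// normr_real. Qed.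

Lemma cabs_ge0 z : 0 <= cabs z.
Proof. by rewrite -lecR cabsE normr_ge0. Qed.

Lemma cabsM x y : cabs (x * y) = cabs x * cabs y.
Proof. by apply: complexI; rewrite rmorphM /= !cabsE normrM. Qed.

Lemma cabsD x y : cabs (x + y) <= cabs x + cabs y.
Proof. by rewrite -lecR rmorphD /= !cabsE ler_normD. Qed.

Lemma cabs0 : cabs 0 = 0.
Proof. by rewrite /cabs normr0. Qed.

Lemma cabs1 : cabs 1 = 1.
Proof. by rewrite /cabs normr1. Qed.

Lemma cabsN x : cabs (- x) = cabs x.
Proof. by rewrite /cabs normrN. Qed.

Lemma cabsB x y : cabs (x - y) = cabs (y - x).
Proof. by rewrite /cabs distrC. Qed.

Lemma cabs_eq0 x : cabs x = 0 -> x = 0.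
Proof. by move=> x0; apply/normr0_eq0; rewrite -cabsE x0. Qed.

Lemma cabs_real a : cabs a%:C%C = `|a|.
Proof. by rewrite /cabs normc_def /= expr0n addr0 sqrtr_sqr. Qed.

Lemma cabs_conj z : cabs (z^*)%C = cabs z.
Proof. by rewrite /cabs normcJ. Qed.

Lemma cabs_sum I (r : seq I) (P : pred I) (F : I -> R[i]) :
  cabs (\sum_(i <- r | P i) F i) <= \sum_(i <- r | P i) cabs (F i).
Proof.
elim/big_rec2 : _ => [|i a x _ h]; first by rewrite cabs0.
by apply: (le_trans (cabsD _ _)); rewrite lerD2l.
Qed.

Lemma Re_le_cabs z : Re z <= cabs z.
Proof.
apply: (le_trans (ler_norm _)).
by rewrite -lecR cabsE; exact: normc_ge_Re.
Qed.

Lemma ReNle_cabs z : - Re z <= cabs z.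
Proof. by rewrite -cabsN -raddfN; exact: Re_le_cabs. Qed.

Lemma ReD x y : Re (x + y) = Re x + Re y. Proof. by case: x; case: y. Qed.
Lemma ReN x : Re (- x) = - Re x. Proof. by case: x. Qed.
Lemma ReB x y : Re (x - y) = Re x - Re y. Proof. by rewrite ReD ReN. Qed.
Lemma ReZ a x : Re (a%:C%C * x) = a * Re x.
Proof. by case: x => c d /=; rewrite mul0r subr0. Qed.
Lemma ReJ x : Re (x^*)%C = Re x. Proof. by case: x. Qed.
Lemma Re_sum I (r : seq I) (P : pred I) (F : I -> R[i]) :
  Re (\sum_(i <- r | P i) F i) = \sum_(i <- r | P i) Re (F i).
Proof. by apply: big_morph => //; exact: ReD. Qed.

Lemma ImD x y : complex.Im (x + y) = complex.Im x + complex.Im y.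
Proof. by case: x; case: y. Qed.
Lemma ImN x : complex.Im (- x) = - complex.Im x. Proof. by case: x. Qed.

Lemma cabs_sqr z : cabs z ^+ 2 = Re z ^+ 2 + complex.Im z ^+ 2.
Proof. by apply: complexI; rewrite rmorphXn /= cabsE -add_Re2_Im2. Qed.

Lemma mul_conj_cabs z : z * (z^*)%C = (cabs z ^+ 2)%:C%C.
Proof. by rewrite rmorphXn /= cabsE sqr_normc. Qed.

Lemma cabs_phase z : exists2 u : R[i], cabs u = 1 & u * z = (cabs z)%:C%C.
Proof.
have [->|z0] := eqVneq z 0.
  by exists 1; rewrite ?cabs0 ?mulr0// /cabs normr1.
have n0 : cabs z != 0 by apply: contra z0 => /eqP /cabs_eq0 ->.
exists ((cabs z)^-1%:C%C * (z^*)%C).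
  by rewrite cabsM cabs_conj cabs_real ger0_norm ?invr_ge0 ?cabs_ge0// mulVf.
rewrite -mulrA [_ * z]mulrC mul_conj_cabs -rmorphM /=.
by rewrite expr2 mulrA mulVf// mul1r.
Qed.

Lemma cabs_Re_le a z : (forall u, cabs u = 1 -> Re (u * z) <= a) -> cabs z <= a.
Proof. by have [u u1 uz] := cabs_phase z => /(_ u u1); rewrite uz. Qed.

Lemma ge0_ReE z : 0 <= z -> z = (Re z)%:C%C.
Proof. by move=> z0; rewrite RRe_real// ger0_real. Qed.

Lemma ge0_Re z : 0 <= z -> 0 <= Re z.
Proof. by move=> z0; rewrite -lecR -ge0_ReE. Qed.

Lemma real_le0_of_eps a b : (forall e, 0 < e -> a <= e * b) -> a <= 0.
Proof.
move=> h; rewrite leNgt; apply/negP => a0.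
have b1 : 0 < `|b| + 1 by rewrite ltr_wpDl.
have k0 : 0 < a / (2 * (`|b| + 1)) by rewrite divr_gt0 ?mulr_gt0.
have := h _ k0; apply/negP; rewrite -ltNge.
apply: (@le_lt_trans _ _ (a / (2 * (`|b| + 1)) * (`|b| + 1))).
  by rewrite ler_pM2l//; have := ler_norm b; lra.
have -> : a / (2 * (`|b| + 1)) * (`|b| + 1) = a / 2.
  by field; rewrite gt_eqF.
by lra.
Qed.

End ComplexAbs.

(** No vector space laws are asked of the operations and the form may be degenerate: the carrier of
    the induced space consists of lists of elementary tensors, added by concatenation. Everything
    needed is read off the form. *)
Record preHilbert (R : realType) := PreHilbert {
  pre_sort :> Type;
  pzero : pre_sort;
  padd : pre_sort -> pre_sort -> pre_sort;
  pscal : R[i] -> pre_sort -> pre_sort;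
  pdot : pre_sort -> pre_sort -> R[i];
  pdotDl : forall x y z, pdot (padd x y) z = pdot x z + pdot y z;
  pdotZl : forall a x z, pdot (pscal a x) z = a * pdot x z;
  pdotC : forall x y, pdot x y = ((pdot y x)^*)%C;
  pdot_ge0 : forall x, 0 <= pdot x x
}.

Section PreHilbertTheory.
Context {R : realType} (P : preHilbert R).
Implicit Types (x y z : P) (a b : R[i]).
Local Notation Re := (@complex.Re R).

Definition pnorm x : R := Num.sqrt (Re (pdot x x)).

Lemma pdotDr x y z : pdot x (padd y z) = pdot x y + pdot x z.
Proof. by rewrite pdotC pdotDl rmorphD /= -!pdotC. Qed.

Lemma pdotZr a x z : pdot x (pscal a z) = (a^*)%C * pdot x z.
Proof. by rewrite pdotC pdotZl rmorphM /= -!pdotC. Qed.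

Lemma pnorm_ge0 x : 0 <= pnorm x.
Proof. exact: sqrtr_ge0. Qed.

Lemma pnorm_sqr x : pnorm x ^+ 2 = Re (pdot x x).
Proof. by rewrite sqr_sqrtr// ge0_Re// pdot_ge0. Qed.

Lemma pdotxx x : pdot x x = (pnorm x ^+ 2)%:C%C.
Proof. by rewrite pnorm_sqr -ge0_ReE// pdot_ge0. Qed.

Lemma pnormD_sqr x y :
  pnorm (padd x y) ^+ 2 = pnorm x ^+ 2 + pnorm y ^+ 2 + 2 * Re (pdot x y).
Proof.
rewrite !pnorm_sqr pdotDl !pdotDr !ReD (pdotC y x) ReJ; lra.
Qed.

Lemma pnormZ a x : pnorm (pscal a x) = cabs a * pnorm x.
Proof.
apply/eqP; rewrite -(@eqrXn2 _ 2%N)// ?pnorm_ge0 ?mulr_ge0 ?cabs_ge0 ?pnorm_ge0//.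
rewrite exprMn !pnorm_sqr pdotZl pdotZr mulrA.
rewrite (mul_conj_cabs a).
by rewrite ReZ.
Qed.

(* Taking t real times the conjugate of g turns this into a discriminant bound. *)
Lemma quad_bound (d n : R) (g : R[i]) : 0 <= d -> 0 <= n ->
  (forall t : R[i], 0 <= d ^+ 2 + 2 * Re (t * g) + cabs t ^+ 2 * n ^+ 2) ->
  cabs g <= d * n.
Proof.
move=> d0 n0 h.
have h' (l : R) :
    0 <= d ^+ 2 - 2 * l * cabs g ^+ 2 + l ^+ 2 * cabs g ^+ 2 * n ^+ 2.
  have := h ((- l)%:C%C * (g^*)%C).
  have -> : (- l)%:C%C * (g^*)%C * g = (- l)%:C%C * (cabs g ^+ 2)%:C%C.
    by rewrite -mul_conj_cabs mulrAC mulrA.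
  rewrite ReZ /= cabsM cabs_conj cabs_real normrN exprMn real_normK ?num_real//.
  by move: (cabs g) => G {h}; lra.
move: (cabs g) (cabs_ge0 g) h' => {h} {g} G G0 h'.
have [n00|nn0] := eqVneq n 0.
  suff G2 : G ^+ 2 <= 0.
    rewrite n00 mulr0 -(@ler_pXn2r _ 2%N)// ?nnegrE//.
    by rewrite expr0n.
  apply: (@real_le0_of_eps _ _ (d ^+ 2)) => e e0.
  have := h' (e^-1 / 2); rewrite n00 expr0n /= mulr0 addr0 => h2.
  have : e * (e^-1 * G ^+ 2) <= e * d ^+ 2 by rewrite ler_pM2l//; lra.
  by rewrite mulrA mulfV ?mul1r// gt_eqF.
have n2 : 0 < n ^+ 2 by rewrite exprn_gt0// lt0r nn0.
have := h' (n ^+ 2)^-1; set m := (n ^+ 2)^-1 => h2.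
have mn : m * n ^+ 2 = 1 by rewrite mulVf// gt_eqF.
rewrite -(@ler_pXn2r _ 2%N)// ?nnegrE// ?mulr_ge0// exprMn.
have mG : m * G ^+ 2 <= d ^+ 2.
  have e : m ^+ 2 * G ^+ 2 * n ^+ 2 = m * G ^+ 2 * (m * n ^+ 2) by ring.
  by move: h2; rewrite e mn mulr1; lra.
have -> : G ^+ 2 = m * G ^+ 2 * n ^+ 2 by rewrite mulrAC mn mul1r.
by rewrite ler_wpM2r// ltW.
Qed.

Lemma pdot_CS x y : cabs (pdot x y) <= pnorm x * pnorm y.
Proof.
rewrite pdotC cabs_conj; apply: quad_bound; rewrite ?pnorm_ge0// => t.
rewrite [X in 0 <= X](_ : _ = pnorm (padd (pscal t y) x) ^+ 2) ?sqr_ge0//.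
by rewrite pnormD_sqr pnormZ exprMn pdotZl; lra.
Qed.

Lemma pnormD x y : pnorm (padd x y) <= pnorm x + pnorm y.
Proof.
rewrite -(@ler_pXn2r _ 2%N)// ?nnegrE// ?addr_ge0 ?pnorm_ge0//.
rewrite pnormD_sqr sqrrD.
have := le_trans (Re_le_cabs _) (pdot_CS x y); lra.
Qed.

Definition psub x y := padd x (pscal (-1) y).

Lemma pdotBl x y z : pdot (psub x y) z = pdot x z - pdot y z.
Proof. by rewrite pdotDl pdotZl mulN1r. Qed.

Lemma pdotBr x y z : pdot x (psub y z) = pdot x y - pdot x z.
Proof. by rewrite pdotDr pdotZr rmorphN rmorph1 mulN1r. Qed.

(* The witness w almost minimises [pnorm x ^+ 2 - 2 Re (f x)] over W; completeness
   is not available to find an exact minimiser. *)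
Lemma riesz_approx (W : set P) (f : P -> R[i]) (C e : R) :
  W !=set0 ->
  (forall x y, W x -> W y -> W (padd x y)) ->
  (forall a x, W x -> W (pscal a x)) ->
  (forall x y, W x -> W y -> f (padd x y) = f x + f y) ->
  (forall a x, W x -> f (pscal a x) = a * f x) ->
  (forall x, W x -> cabs (f x) <= C * pnorm x) -> 0 < e ->
  exists2 w, W w & forall x, W x -> cabs (f x - pdot x w) <= e * pnorm x.
Proof.
move=> [w0 Ww0] WD WZ fD fZ fC e0.
pose E x : R := pnorm x ^+ 2 - 2 * Re (f x).
have Einf : has_inf [set E x | x in W].
  split; first by exists (E w0), w0.
  exists (- C ^+ 2) => _ [x Wx <-]; rewrite /E.
  have := le_trans (Re_le_cabs _) (fC x Wx).
  have := sqr_ge0 (pnorm x - C); rewrite sqrrB; lra.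
(* The tolerance is a square because comparing [E] at [t x + w] with [E w] gives the hypothesis of
   [quad_bound], whose first term is [d ^+ 2], with [d := e]. *)
have e2 : 0 < e ^+ 2 by rewrite exprn_gt0.
have [_ [w Ww <-] Ew] := inf_adherent e2 Einf.
exists w => // x Wx; rewrite cabsB.
apply: quad_bound => [||t]; [exact: ltW|exact: pnorm_ge0|].
have : inf [set E x | x in W] <= E (padd (pscal t x) w).
  by apply: ge_inf; [case: Einf | exists (padd (pscal t x) w) => //; auto].
rewrite /E pnormD_sqr pnormZ exprMn pdotZl fD; [|by auto|by []].
rewrite fZ// ReD mulrBr ReB; move: Ew; rewrite /E; lra.
Qed.

End PreHilbertTheory.

(** * Hilbert spaces and adjoints *)

Section RealNorm.
Context {R : realType}.
Implicit Types V W : normedModType R[i].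

Lemma rnormE V (x : V) : (rnorm x)%:C%C = `|x|.
Proof. by rewrite /rnorm RRe_real// normr_real. Qed.

Lemma rnorm_ge0 V (x : V) : 0 <= rnorm x.
Proof. by rewrite -lecR rnormE normr_ge0. Qed.

Lemma rnormD V (x y : V) : rnorm (x + y) <= rnorm x + rnorm y.
Proof. by rewrite -lecR rmorphD /= !rnormE ler_normD. Qed.

Lemma rnormZ V a (x : V) : rnorm (a *: x) = cabs a * rnorm x.
Proof. by apply: complexI; rewrite rmorphM /= !rnormE cabsE normrZ. Qed.

Lemma rnormN V (x : V) : rnorm (- x) = rnorm x.
Proof. by rewrite /rnorm normrN. Qed.

Lemma rnormB V (x y : V) : rnorm (x - y) = rnorm (y - x).
Proof. by rewrite /rnorm distrC. Qed.

Lemma rnorm0 V : rnorm (0 : V) = 0.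
Proof. by rewrite /rnorm normr0. Qed.

Lemma rnorm_eq0 V (x : V) : rnorm x = 0 -> x = 0.
Proof. by move=> x0; apply/normr0_eq0; rewrite -rnormE x0. Qed.

Lemma rnorm_cabs (z : R[i]) : rnorm (z : R[i]^o) = cabs z.
Proof. by []. Qed.

Lemma gt0_complex (e : R[i]) : 0 < e -> exists2 d : R, 0 < d & e = d%:C%C.
Proof.
move=> e0; exists (complex.Re e); last by rewrite -ge0_ReE// ltW.
by rewrite -ltcR -ge0_ReE// ltW.
Qed.

Lemma invSn_lt (e : R) : 0 < e ->
  exists N, forall n, (N <= n)%N -> n.+1%:R^-1 < e.
Proof.
move=> e0; exists (Num.bound e^-1) => n Nn.
rewrite invf_plt ?posrE//; apply: lt_le_trans (archi_boundP _) _.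
  by rewrite invr_ge0 ltW.
by rewrite ler_nat ltnW.
Qed.

Lemma rnorm_cvgP V (u : nat -> V) x :
  (u @ \oo --> x) <->
  (forall e : R, 0 < e -> exists N, forall n, (N <= n)%N -> rnorm (u n - x) < e).
Proof.
split=> [/cvgrPdist_lt ux e e0|h].
  have [|N _ hN] := ux e%:C%C; first by rewrite ltcR.
  by exists N => n /hN /=; rewrite -rnormE ltcR rnormB.
apply/cvgrPdist_lt => e /gt0_complex [d d0 ->].
have [N hN] := h d d0; exists N => // n /= /hN.
by rewrite -rnormE ltcR rnormB.
Qed.

Lemma rnorm_cauchy_cvg (V : completeNormedModType R[i]) (u : nat -> V) :
  (forall e : R, 0 < e ->
    exists N, forall m n, (N <= m)%N -> (N <= n)%N -> rnorm (u m - u n) < e) ->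
  exists x : V, u @ \oo --> x.
Proof.
move=> h; suff /cauchy_cvgP /cvg_ex[x ux] : cauchy (u @ \oo) by exists x.
apply/cauchyP => e /gt0_complex [d d0 ->].
have [N hN] := h d d0; exists (u N); exists N => // n /= Nn.
rewrite -ball_normE /= -rnormE ltcR; exact: hN.
Qed.

Lemma rnorm_cvg_unique V (u : nat -> V) (x y : V) :
  u n @[n --> \oo] --> x -> u n @[n --> \oo] --> y -> x = y.
Proof. by move=> ux uy; apply: cvg_unique ux uy; exact: norm_hausdorff. Qed.

Lemma real_cauchy_cvg (u : nat -> R) :
  (forall e : R, 0 < e ->
    exists N, forall m n, (N <= m)%N -> (N <= n)%N -> `|u m - u n| < e) ->
  exists x : R, forall e : R, 0 < e ->
    exists N, forall n, (N <= n)%N -> `|u n - x| < e.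
Proof.
move=> h; have /cauchy_cvgP /cvg_ex[x ux] : cauchy (u @ \oo).
  apply/cauchyP => e e0.
  have [N hN] := h e e0; exists (u N); exists N => // n /= Nn.
  rewrite -ball_normE /=; exact: hN.
exists x => e e0; have /cvgrPdist_lt/(_ e e0)[N _ hN] := ux.
by exists N => n /hN; rewrite /= distrC.
Qed.

Lemma cabs_le_ReIm (z : R[i]) : cabs z <= `|complex.Re z| + `|complex.Im z|.
Proof.
rewrite -(@ler_pXn2r _ 2%N)// ?nnegrE ?cabs_ge0 ?addr_ge0//.
rewrite cabs_sqr sqrrD !real_normK ?num_real//.
have : 0 <= `|complex.Re z| * `|complex.Im z| by rewrite mulr_ge0. lra.
Qed.

Lemma Im_le_cabs (z : R[i]) : `|complex.Im z| <= cabs z.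
Proof.
rewrite -(@ler_pXn2r _ 2%N)// ?nnegrE ?cabs_ge0//.
by rewrite cabs_sqr real_normK ?num_real// lerDr sqr_ge0.
Qed.

Lemma normRe_le_cabs (z : R[i]) : `|complex.Re z| <= cabs z.
Proof. by rewrite ler_norml Re_le_cabs andbT lerNl ReNle_cabs. Qed.

Lemma cabs_cauchy_cvg (u : nat -> R[i]) :
  (forall e : R, 0 < e ->
    exists N, forall m n, (N <= m)%N -> (N <= n)%N -> cabs (u m - u n) < e) ->
  exists x : R[i], (u : nat -> R[i]^o) @ \oo --> (x : R[i]^o).
Proof.
move=> h.
have [|a ha] := @real_cauchy_cvg (fun n => complex.Re (u n)).
  move=> e /h[N hN]; exists N => m n Nm Nn; rewrite -ReB.
  exact: le_lt_trans (normRe_le_cabs _) (hN _ _ Nm Nn).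
have [|b hb] := @real_cauchy_cvg (fun n => complex.Im (u n)).
  move=> e /h[N hN]; exists N => m n Nm Nn; rewrite -ImN -ImD.
  exact: le_lt_trans (Im_le_cabs _) (hN _ _ Nm Nn).
exists (a +i* b)%C; apply/rnorm_cvgP => e e0.
have e20 : 0 < e / 2 by lra.
have [N hN] := ha _ e20; have [M hM] := hb _ e20.
exists (maxn N M) => n; rewrite geq_max => /andP[/hN an /hM bn].
rewrite rnorm_cabs; apply: le_lt_trans (cabs_le_ReIm _) _.
by rewrite ReB ImD ImN /=; lra.
Qed.

Lemma linear_bound V W (f : V -> W) : linear f -> continuous f ->
  exists2 C : R, 0 <= C & forall x, rnorm (f x) <= C * rnorm x.
Proof.
move=> fl fc.
pose g := HB.pack_for {linear V -> W} f (GRing.isLinear.Build R[i] V W _ f fl).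
have /linear_boundedP : bounded_near g (nbhs 0).
  exact: (@continuous_linear_bounded _ _ _ 0 g (fc 0)).
move=> [M [Mr hM]].
have M0 : 0 <= `|M| + 1 by rewrite addr_ge0.
exists (complex.Re (`|M| + 1)); first exact: ge0_Re.
move=> x; have M1 : M < `|M| + 1.
  by apply: le_lt_trans (real_ler_norm Mr) _; rewrite ltrDl ltr01.
have := hM _ M1 x.
by rewrite -!rnormE {1}(ge0_ReE M0) -rmorphM lecR.
Qed.

Lemma bound_continuous V W (f : V -> W) (C : R) : linear f ->
  (forall x, rnorm (f x) <= C * rnorm x) -> continuous f.
Proof.
move=> fl fC.
pose g := HB.pack_for {linear V -> W} f (GRing.isLinear.Build R[i] V W _ f fl).
apply: (@bounded_linear_continuous _ _ _ g); apply/linear_boundedP.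
exists C%:C%C; split; first by apply/complex_realP; exists C.
move=> r Cr x; apply: le_trans (_ : C%:C%C * `|x| <= _).
  by rewrite -!rnormE -rmorphM lecR; exact: fC.
by rewrite ler_wpM2r// ltW.
Qed.

End RealNorm.

Section HilbertBasics.
Context {R : realType}.
Implicit Types H K L : hilbertType R.
Local Notation Re := (@complex.Re R).

Section Dot.
Context {H : hilbertType R}.
Implicit Types x y z : H.
Lemma hdotDl x y z : hdot (x + y) z = hdot x z + hdot y z.
Proof. exact: (linearDl (@hdot R H)). Qed.
Lemma hdotDr x y z : hdot x (y + z) = hdot x y + hdot x z.
Proof. exact: (linearDr (@hdot R H)). Qed.
Lemma hdotBl x y z : hdot (x - y) z = hdot x z - hdot y z.
Proof. exact: (linearBl (@hdot R H)). Qed.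
Lemma hdotBr x y z : hdot x (y - z) = hdot x y - hdot x z.
Proof. exact: (linearBr (@hdot R H)). Qed.
Lemma hdotZl a x y : hdot (a *: x) y = a * hdot x y.
Proof. exact: (linearZl_LR (@hdot R H)). Qed.
Lemma hdotZr a x y : hdot x (a *: y) = (a^*)%C * hdot x y.
Proof. exact: (linearZr_LR (@hdot R H)). Qed.
Lemma hdot0l y : hdot (0 : H) y = 0.
Proof. exact: (linear0l (@hdot R H)). Qed.
Lemma hdot0r y : hdot y (0 : H) = 0.
Proof. exact: (linear0r (@hdot R H)). Qed.
Lemma hdotC x y : hdot x y = ((hdot y x)^*)%C.
Proof. by rewrite [LHS](@hermitian_subproof _ _ _ _ (@hdot R H) x y) expr0 mul1r. Qed.
Lemma hdot_sumr I (r : seq I) (P : pred I) (F : I -> H) x :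
  hdot x (\sum_(i <- r | P i) F i) = \sum_(i <- r | P i) hdot x (F i).
Proof. exact: (linear_sumr (@hdot R H)). Qed.
Lemma hdot_suml I (r : seq I) (P : pred I) (F : I -> H) x :
  hdot (\sum_(i <- r | P i) F i) x = \sum_(i <- r | P i) hdot (F i) x.
Proof. by elim/big_rec2 : _ => [|i a b _ <-]; rewrite ?hdot0l ?hdotDl. Qed.
Lemma hdotxxE x : hdot x x = (rnorm x ^+ 2)%:C%C.
Proof. by rewrite hdotxx -rnormE rmorphXn. Qed.
Lemma rnorm_sqr x : rnorm x ^+ 2 = Re (hdot x x).
Proof. by rewrite hdotxxE. Qed.
Lemma hdot_ge0 x : 0 <= hdot x x.
Proof. by rewrite hdotxxE lecR sqr_ge0. Qed.
Definition hilbert_pre : preHilbert R :=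
  @PreHilbert R H 0 +%R *:%R hdot hdotDl hdotZl hdotC hdot_ge0.
Lemma pnorm_hilbert x : pnorm (x : hilbert_pre) = rnorm x.
Proof. by rewrite /pnorm /= hdotxxE /= sqrtr_sqr ger0_norm// rnorm_ge0. Qed.
Lemma hdot_CS x y : cabs (hdot x y) <= rnorm x * rnorm y.
Proof. by have := @pdot_CS R hilbert_pre x y; rewrite !pnorm_hilbert. Qed.
Lemma hdot_eq0 x : (forall y, hdot x y = 0) -> x = 0.
Proof.
move=> /(_ x); rewrite hdotxxE => -[] /eqP; rewrite sqrf_eq0 => /eqP.
exact: rnorm_eq0.
Qed.

Lemma hdot_inj x y : (forall z, hdot x z = hdot y z) -> x = y.
Proof.
by move=> h; apply/subr0_eq/hdot_eq0 => z; rewrite hdotBl h subrr.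
Qed.

Lemma hdot_injr x y : (forall z, hdot z x = hdot z y) -> x = y.
Proof. by move=> h; apply: hdot_inj => z; rewrite hdotC h -hdotC. Qed.
End Dot.

Lemma hdot_cvgl H (u : nat -> H) x y : u @ \oo --> x ->
  ((fun n => hdot (u n) y : R[i]^o) @ \oo --> (hdot x y : R[i]^o)).
Proof.
move=> /rnorm_cvgP ux; apply/rnorm_cvgP => e e0.
have y0 : 0 < rnorm y + 1 by have := rnorm_ge0 y; lra.
have [|N hN] := ux (e / (rnorm y + 1)); first exact: divr_gt0.
exists N => n /hN un; rewrite rnorm_cabs -hdotBl.
apply: le_lt_trans (hdot_CS _ _) _.
apply: (@le_lt_trans _ _ (rnorm (u n - x) * (rnorm y + 1))).
  by rewrite ler_wpM2l ?rnorm_ge0// lerDl.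
by rewrite -ltr_pdivlMr.
Qed.

Lemma bopP H K (f : H -> K) (C : R) : linear f ->
  (forall x, rnorm (f x) <= C * rnorm x) -> exists T : bop H K, T = f :> (H -> K).
Proof.
move=> fl fC; have fb : is_bop f.
  by apply/asboolP; split => //; exact: bound_continuous fC.
by exists (Bop fb).
Qed.

Lemma bop_bound H K (T : bop H K) :
  exists2 C : R, 0 <= C & forall x, rnorm (T x) <= C * rnorm x.
Proof. by apply: linear_bound; [exact: bop_linear | exact: bop_continuous]. Qed.

Lemma bop_inj H K (S T : bop H K) : (forall x, S x = T x) -> S = T.
Proof. by move=> h; apply/val_inj/funext. Qed.

(** [W] need not be closed, so the representing vector is only a limit of vectors of [W]. The
    almost-representing vectors form a Cauchy sequence because the difference of two of them lies in
    [W], where both almost represent [f]. *)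
Lemma riesz_subspace H (W : set H) (f : H -> R[i]) (C : R) :
  is_subspace W -> (forall a x y, f (a *: x + y) = a * f x + f y) ->
  (forall x, W x -> cabs (f x) <= C * rnorm x) ->
  exists w : H, [/\ (exists2 u : nat -> H, (forall n, W (u n)) & u @ \oo --> w) &
    forall x, W x -> f x = hdot x w].
Proof.
move=> [W0 Wl] fl fC.
have fD x y : f (x + y) = f x + f y by have := fl 1 x y; rewrite scale1r mul1r.
have f0 : f 0 = 0 by have := fD 0 0; rewrite addr0 => /eqP; rewrite -subr_eq subrr => /eqP.
have fZ a x : f (a *: x) = a * f x by have := fl a x 0; rewrite f0 !addr0.
have WZ a x : W x -> W (a *: x) by move=> Wx; have := Wl a x 0 Wx W0; rewrite addr0.
have WD x y : W x -> W y -> W (x + y) by move=> Wx /(Wl 1 _ _ Wx); rewrite scale1r.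
have step n : exists w, W w /\
    forall x, W x -> cabs (f x - hdot x w) <= n.+1%:R^-1 * rnorm x.
  have [|||||||w Ww hw] := @riesz_approx R (@hilbert_pre H) W f C n.+1%:R^-1.
  - by exists 0.
  - exact: WD.
  - exact: WZ.
  - by move=> x y _ _; exact: fD.
  - by move=> a x _; exact: fZ.
  - by move=> x Wx; rewrite pnorm_hilbert; exact: fC.
  - by rewrite invr_gt0.
  by exists w; split=> // x /hw; rewrite pnorm_hilbert.
pose u n := sval (cid (step n)).
have Wu n : W (u n) by rewrite /u; case: cid => ? [].
have hu n x : W x -> cabs (f x - hdot x (u n)) <= n.+1%:R^-1 * rnorm x.
  by move: x; rewrite /u; case: cid => ? [].
have uu m n : rnorm (u m - u n) <= m.+1%:R^-1 + n.+1%:R^-1.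
  set x := u m - u n.
  have Wx : W x by rewrite /x addrC -scaleN1r; exact: Wl.
  have h : rnorm x ^+ 2 <= (m.+1%:R^-1 + n.+1%:R^-1) * rnorm x.
    have -> : rnorm x ^+ 2 = cabs (hdot x x).
      by rewrite hdotxxE cabs_real ger0_norm// sqr_ge0.
    rewrite {2}/x hdotBr.
    have -> : hdot x (u m) - hdot x (u n) =
      - (f x - hdot x (u m)) + (f x - hdot x (u n)) by ring.
    rewrite mulrDl; apply: le_trans (cabsD _ _) _.
    by rewrite cabsN lerD// hu.
  have [x0|x0] := eqVneq (rnorm x) 0.
    by rewrite x0 addr_ge0// invr_ge0.
  by move: h; rewrite expr2 ler_pM2r// lt0r x0 rnorm_ge0.
have [|w uw] := @rnorm_cauchy_cvg R H u.
  move=> e e0; have [|N hN] := @invSn_lt R (e / 2); first lra.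
  exists N => m n /hN hm /hN hn; apply: le_lt_trans (uu m n) _; rewrite [ltRHS]splitr ltrD//.
exists w; split; first by exists u.
move=> x Wx; rewrite hdotC; have := hdot_cvgl (y := x) uw.
move=> h; rewrite -[f x]conjcK; congr conjc.
apply: (rnorm_cvg_unique _ h); apply/rnorm_cvgP => e e0.
have x0 : 0 < rnorm x + 1 by have := rnorm_ge0 x; lra.
have [|N hN] := @invSn_lt R (e / (rnorm x + 1)); first exact: divr_gt0.
exists N => n /hN un; rewrite rnorm_cabs hdotC -rmorphB cabs_conj cabsB.
apply: le_lt_trans (hu n x Wx) _.
apply: (@le_lt_trans _ _ (n.+1%:R^-1 * (rnorm x + 1))).
  by rewrite ler_wpM2l// ?invr_ge0// lerDl.
by rewrite -ltr_pdivlMr.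
Qed.

Lemma adj_exists H K (T : bop H K) :
  exists S : bop K H, forall x y, hdot (T x) y = hdot x (S y).
Proof.
have [C C0 TC] := bop_bound T.
have h y : exists z, forall x, hdot (T x) y = hdot x z.
  have [|||z [_ hz]] := @riesz_subspace H setT (fun x => hdot (T x) y) (C * rnorm y).
  - by [].
  - by move=> a x x'; rewrite linearP hdotDl hdotZl.
  - move=> x _; apply: le_trans (hdot_CS _ _) _.
    by rewrite mulrAC ler_wpM2r// rnorm_ge0.
  by exists z => x; rewrite hz.
pose S y := sval (cid (h y)).
have hS x y : hdot (T x) y = hdot x (S y) by rewrite /S; case: cid.
have Sl : linear S.
  by move=> a x y; apply: hdot_injr => z; rewrite -hS !hdotDr !hdotZr -!hS.
have [|S' S'E] := @bopP K H S C Sl.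
  move=> y; have [->|y0] := eqVneq (rnorm (S y)) 0.
    by rewrite mulr_ge0// rnorm_ge0.
  have Sy0 : 0 < rnorm (S y) by rewrite lt0r y0 rnorm_ge0.
  rewrite -(ler_pM2l Sy0) -expr2 rnorm_sqr -hS.
  apply: le_trans (Re_le_cabs _) (le_trans (hdot_CS _ _) _).
  by rewrite mulrA ler_wpM2r ?rnorm_ge0// mulrC TC.
by exists S' => x y; rewrite S'E hS.
Qed.

Lemma adjP H K (T : bop H K) x y : hdot (T x) y = hdot x (adj T y).
Proof.
rewrite /adj; case: xgetP => [S _ ->//|].
by have [S hS] := adj_exists T => /(_ S).
Qed.

Lemma adjPl H K (T : bop H K) x y : hdot (adj T x) y = hdot x (T y).
Proof. by rewrite hdotC -adjP -hdotC. Qed.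

Lemma adj_unique H K (T : bop H K) (S : bop K H) :
  (forall x y, hdot (T x) y = hdot x (S y)) -> adj T = S.
Proof. by move=> h; apply: bop_inj => y; apply: hdot_injr => x; rewrite -adjP. Qed.

Lemma adjK H K (T : bop H K) : adj (adj T) = T.
Proof. by apply: adj_unique => x y; rewrite adjPl. Qed.

Lemma adj_comp H K L (S : bop K L) (T : bop H K) :
  adj (bcomp S T) = bcomp (adj T) (adj S).
Proof. by apply: adj_unique => x y; rewrite /= !adjP. Qed.

Lemma bopDE H K (S T : bop H K) x : (S + T) x = S x + T x. Proof. by []. Qed.
Lemma bopZE H K a (T : bop H K) x : (a *: T) x = a *: T x. Proof. by []. Qed.
Lemma bop0E H K x : (0 : bop H K) x = 0. Proof. by []. Qed.
Lemma bop_sumE H K I (r : seq I) (P : pred I) (F : I -> bop H K) x :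
  (\sum_(i <- r | P i) F i) x = \sum_(i <- r | P i) F i x.
Proof. by elim/big_rec2 : _ => // i y1 y2 _ <-. Qed.

Lemma adjD H K (S T : bop H K) : adj (S + T) = adj S + adj T.
Proof. by apply: adj_unique => x y; rewrite !bopDE hdotDl hdotDr !adjP. Qed.

Lemma adjZ H K a (T : bop H K) : adj (a *: T) = (a^*)%C *: adj T.
Proof.
by apply: adj_unique => x y; rewrite !bopZE hdotZl hdotZr conjcK adjP.
Qed.

Lemma adj0 H K : adj (0 : bop H K) = 0.
Proof. by apply: adj_unique => x y; rewrite !bop0E hdot0l hdot0r. Qed.

Lemma adj_bid H : adj (bid H) = bid H.
Proof. exact: adj_unique. Qed.

End HilbertBasics.

(** * Initial topologies of pointwise convergence *)

Section InitialPointwise.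
Context {R : realType} (X : choiceType) (I : Type) (f : X -> {ptws I -> R[i]^o}).
Local Notation W := (initial_topology f).

(** The sets that contain such a basic set form a filter [G] on [X]. Its image under [f] converges
    at every index, hence in the product topology, so every open set around [f x] pulls back to a
    member of [G]. *)
Lemma init_nbhsP (x : W) (B : set W) : nbhs x B ->
  exists n (i : 'I_n -> I) (e : R), 0 < e /\
    forall y : X, (forall k, cabs (f y (i k) - f x (i k)) < e) -> B y.
Proof.
pose G (B : set X) := exists n (i : 'I_n -> I) (e : R), 0 < e /\
    forall y : X, (forall k, cabs (f y (i k) - f x (i k)) < e) -> B y.
have GF : Filter G.
  split.
  - by exists 0%N, (fun k : 'I_0 => False_rect I (notF (ltn_ord k))), 1.
  - move=> P Q [n [i [e [e0 hP]]]] [m [j [d [d0 hQ]]]].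
    exists (n + m)%N, (fun k : 'I_(n + m) => match fintype.split k with inl a => i a | inr b => j b end).
    exists (Num.min e d); split; first by rewrite lt_min e0.
    move=> y hy; split.
      apply: hP => k; have := hy (lshift m k).
      by rewrite lt_min => /andP[+ _]; rewrite (unsplitK (inl k)).
    apply: hQ => k; have := hy (rshift n k).
    by rewrite lt_min => /andP[_]; rewrite (unsplitK (inr k)).
  - move=> P Q PQ [n [i [e [e0 hP]]]]; exists n, i, e; split=> // y /hP; exact: PQ.
suff h : fmap f G --> (f x : {ptws I -> R[i]^o}).
  rewrite nbhsE => -[A [Ao Ax] AB]; move: Ao Ax => [C Co CA] Ax.
  have [|n [i [e [e0 he]]]] := h C.
    by apply: open_nbhs_nbhs; split=> //; move: Ax; rewrite -CA.
  exists n, i, e; split=> // y hy; apply: AB; rewrite -CA; exact: he.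
apply/cvg_sup => i A; rewrite nbhsE => -[B' [[C Co CB] Bx] BA].
have Cx : C (f x i) by move: Bx; rewrite -CB.
have /nbhs_ballP[e /gt0_complex[d d0 ->] eC] : nbhs (f x i) C.
  exact: open_nbhs_nbhs.
exists 1%N, (fun=> i), d; split=> // y /(_ ord0) hy; apply: BA; rewrite -CB.
apply: eC; rewrite -ball_normE /= -rnormE ltcR rnormB; exact: hy.
Qed.

Lemma init_closureP (S : set W) (x : W) :
  (forall n (i : 'I_n -> I) (e : R), 0 < e ->
    exists2 y : X, S y & forall k, cabs (f y (i k) - f x (i k)) < e) ->
  closure S x.
Proof.
move=> h B /init_nbhsP[n [i [e [e0 he]]]].
by have [y Sy hy] := h n i e e0; exists y; split=> //; exact: he.
Qed.

Lemma init_eval_continuous (i : I) : continuous ((fun y => f y i) : W -> R[i]^o).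
Proof.
move=> x; apply: (@continuous_comp W {ptws I -> R[i]^o} R[i]^o f (fun g => g i)).
  exact: initial_continuous.
have /cvg_sup h : nbhs (f x) --> (f x : {ptws I -> R[i]^o}) by [].
move=> A Anb; apply: (h i).
exact: (@initial_continuous _ R[i]^o (fun g : {ptws I -> R[i]^o} => g i) (f x) A Anb).
Qed.

Lemma init_nbhs (x : W) n (i : 'I_n -> I) (e : R) : 0 < e ->
  nbhs x [set y : W | forall k, cabs (f y (i k) - f x (i k)) < e].
Proof.
move=> e0.
have h k : \forall y \near x, cabs (f y (i k) - f x (i k)) < e.
  have /cvgrPdist_lt/(_ e%:C%C) := @init_eval_continuous (i k) x.
  rewrite ltcR => /(_ e0); apply: filterS => y /=.
  by rewrite -rnormE ltcR rnormB.
exact: (@filter_forall W 'I_n _ _ (nbhs_filter x) h).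
Qed.

Lemma closure_init (S : set W) (x : W) n (i : 'I_n -> I) (e : R) :
  closure S x -> 0 < e ->
  exists2 y : X, S y & forall k, cabs (f y (i k) - f x (i k)) < e.
Proof. by move=> Sx e0; have [y [Sy hy]] := Sx _ (init_nbhs x i e0); exists y. Qed.

Lemma init_continuousP (Y : topologicalType) (g : Y -> W) :
  (forall i, continuous ((fun y => f (g y) i) : Y -> R[i]^o)) -> continuous g.
Proof.
move=> h y B /init_nbhsP[n [i [e [e0 he]]]].
have : nbhs y [set y' | forall k, cabs (f (g y') (i k) - f (g y) (i k)) < e].
  apply: (@filter_forall Y 'I_n
    (fun k y' => cabs (f (g y') (i k) - f (g y) (i k)) < e)) => k.
  have /cvgrPdist_lt/(_ e%:C%C) := h (i k) y.
  rewrite ltcR => /(_ e0); apply: filterS => y' /=.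
  by rewrite -rnormE ltcR rnormB.
by apply: filterS => y' /he.
Qed.

End InitialPointwise.

Lemma closure_image (S T : topologicalType) (g : S -> T) (A : set S) (B : set T) x :
  continuous g -> (forall a, A a -> closure B (g a)) -> closure A x ->
  closure B (g x).
Proof.
move=> gc AB Ax; have /closure_id -> := @closed_closure _ B.
move=> U /gc /Ax[a [Aa Ua]]; exists (g a); split=> //; exact: AB.
Qed.

(** Induction on the number of functionals. If the last one is nonzero at some [v0] in the common
    kernel of the others, a multiple of it is subtracted from [f] so that the difference vanishes at
    [v0], and vectors are moved along [v0] into its kernel; otherwise it is redundant. This is the
    algebra that identifies w*-continuous functionals with elements of a predual. *)
Lemma common_kernel (F : fieldType) (V : lmodType F) n (x : 'I_n -> V -> F)
    (f : V -> F) :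
  (forall i a u v, x i (a *: u + v) = a * x i u + x i v) ->
  (forall a u v, f (a *: u + v) = a * f u + f v) ->
  (forall v, (forall i, x i v = 0) -> f v = 0) ->
  exists c : 'I_n -> F, forall v, f v = \sum_i c i * x i v.
Proof.
elim: n x f => [|n IH] x f xl fl fx.
  by exists (fun=> 0) => v; rewrite big_ord0 fx// => -[].
pose x' (i : 'I_n) := x (widen_ord (leqnSn n) i).
have x'l i a u v : x' i (a *: u + v) = a * x' i u + x' i v by exact: xl.
have ordP (P : 'I_n.+1 -> Prop) : (forall i, P (widen_ord (leqnSn n) i)) ->
    P ord_max -> forall i, P i.
  move=> Pw Pm i; have [lin|] := ltnP i n.
    by have := Pw (Ordinal lin); congr P; exact/val_inj.
  by move=> ni; have -> : i = ord_max;
    [apply/val_inj/anti_leq; rewrite /= ni andbT -ltnS|].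
have [[v0 v0x' v0x]|h] := pselect (exists2 v, forall i, x' i v = 0 & x ord_max v != 0).
  pose f' v := f v - f v0 / x ord_max v0 * x ord_max v.
  have [|||c hc] := IH x' f' => //.
  - by move=> a u v; rewrite /f' xl fl; ring.
  - move=> v vx'; rewrite /f'.
    have : f (- (x ord_max v / x ord_max v0) *: v0 + v) = 0.
      apply: fx; apply: ordP => [i|]; rewrite xl.
        by have := v0x' i; have := vx' i; rewrite /x' => -> ->; rewrite mulr0 addr0.
      by rewrite mulNr mulfVK// addNr.
    by rewrite fl => /eqP; rewrite addrC addr_eq0 => /eqP ->; ring.
  exists (fun i => match unlift ord_max i with Some j => c j | None => f v0 / x ord_max v0 end).
  move=> v; rewrite big_ord_recr /= unlift_none.
  have := hc v; rewrite /f' => /eqP; rewrite subr_eq => /eqP ->; congr (_ + _).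
  apply: eq_bigr => i _.
  have -> : widen_ord (leqnSn n) i = lift ord_max i by apply/val_inj; rewrite /= /bump leqNgt ltn_ord.
  rewrite liftK; congr (_ * x _ _); apply/val_inj; by rewrite /= /bump leqNgt ltn_ord.
have [|c hc] := IH x' f x'l fl.
  move=> v vx'; apply: fx; apply: ordP => [i|]; first exact: vx'.
  by apply: contrapT => /eqP vx; apply: h; exists v.
exists (fun i => match unlift ord_max i with Some j => c j | None => 0 end).
move=> v; rewrite big_ord_recr /= unlift_none mul0r addr0 hc.
apply: eq_bigr => i _.
have -> : widen_ord (leqnSn n) i = lift ord_max i by apply/val_inj; rewrite /= /bump leqNgt ltn_ord.
rewrite liftK; congr (_ * x _ _); apply/val_inj; by rewrite /= /bump leqNgt ltn_ord.
Qed.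

(** * Normal functionals *)

Section NormalFunctionals.
Context {R : realType}.
Implicit Types H K : hilbertType R.

Definition lfun H K (l : seq (H * K)) (T : bop H K) : R[i] :=
  \sum_(t <- l) hdot (T t.1) t.2.

(** Squares are summed, rather than products of norms, because concatenated lists have to form two
    square-summable sequences. The weight still dominates the norm of [lfun l]. *)
Definition lweight H K (l : seq (H * K)) : R :=
  \sum_(t <- l) (rnorm t.1 ^+ 2 + rnorm t.2 ^+ 2).

Lemma lweight_ge0 H K (l : seq (H * K)) : 0 <= lweight l.
Proof. by apply: sumr_ge0 => t _; rewrite addr_ge0// sqr_ge0. Qed.

Lemma hdot_bop_le H K (T : bop H K) (C : R) x y : 0 <= C ->
  (forall x, rnorm (T x) <= C * rnorm x) ->
  cabs (hdot (T x) y) <= C * (rnorm x ^+ 2 + rnorm y ^+ 2).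
Proof.
move=> C0 TC; apply: le_trans (hdot_CS _ _) _.
apply: (@le_trans _ _ (C * rnorm x * rnorm y)).
  by rewrite ler_wpM2r ?rnorm_ge0.
rewrite -mulrA ler_wpM2l//.
have := sqr_ge0 (rnorm x - rnorm y); rewrite sqrrB.
have := sqr_ge0 (rnorm x); have := sqr_ge0 (rnorm y); lra.
Qed.

Lemma lfun_le H K (l : seq (H * K)) (T : bop H K) (C : R) : 0 <= C ->
  (forall x, rnorm (T x) <= C * rnorm x) -> cabs (lfun l T) <= C * lweight l.
Proof.
move=> C0 TC; apply: le_trans (cabs_sum _ _ _) _; rewrite /lweight mulr_sumr.
by apply: ler_sum => t _; exact: hdot_bop_le.
Qed.

Lemma sqsum_tail H (s : sqsum H) (e : R) : 0 < e ->
  exists N, forall m n, (N <= m)%N -> (m <= n)%N ->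
    \sum_(m <= k < n) rnorm (s k) ^+ 2 < e.
Proof.
move=> e0; have sc := @sqsum_cvg R H s.
set u := series _ in sc.
have /cvgrPdist_lt/(_ e e0)[N _ hN] : u @ \oo --> limn u by [].
exists N => m n Nm mn.
have un : u n <= limn u.
  apply: nondecreasing_cvgn_le => // a b ab.
  by rewrite -subr_ge0 sub_series_geq// sumr_ge0// => i _; rewrite sqr_ge0.
rewrite -(sub_series_geq (fun k => rnorm (s k) ^+ 2) mn).
apply: le_lt_trans (hN m Nm); apply: le_trans (ler_norm _).
by rewrite lerD2r.
Qed.

Definition nfun_part H K (p : sqsum H * sqsum K) n (T : bop H K) : R[i] :=
  \sum_(0 <= k < n) hdot (T (p.1 k)) (p.2 k).

(** The tails are controlled by the two square-summable sequences alone, so the partial sums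
    converge uniformly on bounded sets of operators. Hence a normal functional is a norm limit of
    finite ones. *)
Lemma normal_fun_unif H K (p : sqsum H * sqsum K) (e : R) : 0 < e ->
  exists N, forall n (T : bop H K) (C : R), (N <= n)%N -> 0 <= C ->
    (forall x, rnorm (T x) <= C * rnorm x) ->
    cabs (normal_fun T p - nfun_part p n T) <= C * e.
Proof.
move=> e0; have tail d : 0 < d -> exists N, forall m n (T : bop H K) (C : R),
    (N <= m)%N -> (m <= n)%N -> 0 <= C ->
    (forall x, rnorm (T x) <= C * rnorm x) ->
    cabs (nfun_part p n T - nfun_part p m T) <= C * d.
  move=> d0; have d20 : 0 < d / 2 by rewrite divr_gt0.
  have [N1 h1] := sqsum_tail p.1 d20; have [N2 h2] := sqsum_tail p.2 d20.
  exists (maxn N1 N2) => m n T C; rewrite geq_max => /andP[N1m N2m] mn C0 TC.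
  have -> : nfun_part p n T - nfun_part p m T =
      \sum_(m <= k < n) hdot (T (p.1 k)) (p.2 k).
    by rewrite /nfun_part (big_cat_nat (n := m))//= addrAC subrr add0r.
  apply: le_trans (cabs_sum _ _ _) _.
  apply: (@le_trans _ _ (\sum_(m <= k < n) C * (rnorm (p.1 k) ^+ 2 + rnorm (p.2 k) ^+ 2))).
    by apply: ler_sum => k _; exact: hdot_bop_le.
  rewrite -mulr_sumr ler_wpM2l// big_split /=.
  have := h1 m n N1m mn; have := h2 m n N2m mn; lra.
have [N hN] := tail e e0; exists N => n T C Nn C0 TC.
have [|l ul] := @cabs_cauchy_cvg R (fun n => nfun_part p n T).
  move=> d d0; have C1 : 0 < C + 1 by lra.
  have [|M hM] := tail (d / (C + 1)); first exact: divr_gt0.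
  have small m m' : (M <= m)%N -> (m <= m')%N ->
      cabs (nfun_part p m' T - nfun_part p m T) < d.
    move=> Mm mm'; apply: le_lt_trans (hM _ _ _ _ Mm mm' C0 TC) _.
    rewrite mulrCA gtr_pMr// ltr_pdivrMr ?mul1r//; lra.
  exists M => m m' Mm Mm'; have [mm'|/ltnW mm'] := leqP m m'.
    by rewrite cabsB small.
  by rewrite small.
have -> : normal_fun T p = l by apply: cvg_lim ul; exact: norm_hausdorff.
apply/ler_addgt0Pr => d d0; have /rnorm_cvgP/(_ d d0)[M hM] := ul.
have := hM (maxn M n) (leq_maxl _ _); rewrite rnorm_cabs cabsB => hl.
have := hN _ _ _ _ Nn (leq_maxr M n) C0 TC => hn.
rewrite (_ : l - _ = (l - nfun_part p (maxn M n) T) + (nfun_part p (maxn M n) T - nfun_part p n T)); last by ring.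
apply: le_trans (cabsD _ _) _; lra.
Qed.

Lemma normal_fun_lim H K (p : sqsum H * sqsum K) (T : bop H K) (e : R) : 0 < e ->
  exists N, forall n, (N <= n)%N -> cabs (normal_fun T p - nfun_part p n T) < e.
Proof.
move=> e0; have [C C0 TC] := bop_bound T; have C1 : 0 < C + 1 by lra.
have [|N hN] := normal_fun_unif p (e := e / (C + 1)); first exact: divr_gt0.
exists N => n Nn; apply: le_lt_trans (hN _ _ _ Nn C0 TC) _.
rewrite mulrCA gtr_pMr// ltr_pdivrMr ?mul1r//; lra.
Qed.

Lemma normal_fun_linear H K (p : sqsum H * sqsum K) a (S T : bop H K) :
  normal_fun (a *: S + T) p = a * normal_fun S p + normal_fun T p.
Proof.
apply/subr0_eq/cabs_eq0/eqP; rewrite eq_le cabs_ge0 andbT.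
have a1 : 0 < cabs a + 2 by have := cabs_ge0 a; lra.
apply/ler_addgt0Pr => e e0; rewrite add0r.
have e' : 0 < e / (cabs a + 2) by exact: divr_gt0.
have [N1 h1] := normal_fun_lim p (a *: S + T) e'.
have [N2 h2] := normal_fun_lim p S e'.
have [N3 h3] := normal_fun_lim p T e'.
pose n := (N1 + N2 + N3)%N.
have n1 : (N1 <= n)%N by rewrite /n -addnA leq_addr.
have n2 : (N2 <= n)%N by rewrite /n -addnA addnCA leq_addr.
have n3 : (N3 <= n)%N by rewrite /n leq_addl.
move: (h1 n n1) (h2 n n2) (h3 n n3); set d := e / _ => l1 l2 l3.
have pe : nfun_part p n (a *: S + T) = a * nfun_part p n S + nfun_part p n T.
  rewrite /nfun_part mulr_sumr -big_split /=; apply: eq_bigr => k _.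
  rewrite -[LHS]/(hdot (a *: S (p.1 k) + T (p.1 k)) (p.2 k)).
  by rewrite hdotDl hdotZl.
rewrite (_ : _ - _ = (normal_fun (a *: S + T) p - nfun_part p n (a *: S + T))
  + a * - (normal_fun S p - nfun_part p n S) + - (normal_fun T p - nfun_part p n T));
  last by rewrite pe; ring.
have -> : e = d + cabs a * d + d by rewrite /d; field; rewrite gt_eqF.
apply: le_trans (cabsD _ _) _; rewrite cabsN; apply: lerD; last exact: ltW.
apply: le_trans (cabsD _ _) _; apply: lerD; first exact: ltW.
by rewrite cabsM ler_wpM2l ?cabs_ge0// cabsN ltW.
Qed.

Lemma nseries_cvg (u : nat -> R) (M : R) : (forall n, 0 <= u n) ->
  (forall n, \sum_(0 <= k < n) u k <= M) -> cvgn (series u).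
Proof.
move=> u0 uM; apply: nondecreasing_is_cvgn.
  by move=> a b ab; rewrite -subr_ge0 sub_series_geq// sumr_ge0.
by exists M => _ [n _ <-]; exact: uM.
Qed.

(* p concatenates the lists [l 0], [l 1], ..., each padded with a zero pair so
   that the blocks are nonempty. *)
Lemma normal_of_blocks H K (l : nat -> seq (H * K)) (M : R) :
  (forall n, \sum_(0 <= k < n) lweight (l k) <= M) ->
  exists p : sqsum H * sqsum K, forall T (e : R), 0 < e ->
    exists N, forall n, (N <= n)%N ->
      cabs (normal_fun T p - \sum_(0 <= k < n) lfun (l k) T) < e.
Proof.
move=> lM; pose s n := flatten [seq (0, 0) :: l k | k <- iota 0 n] : seq (H * K).
have sS n : s n.+1 = s n ++ (0, 0) :: l n.
  by rewrite /s -addn1 iotaD map_cat flatten_cat /= cats0.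
have size_s n : (n <= size (s n))%N.
  by elim: n => // n IH; rewrite sS size_cat /= addnS ltnS (leq_trans IH)// leq_addr.
have s_prefix m n : (m <= n)%N -> exists t, s n = s m ++ t.
  move=> mn; exists (flatten [seq (0, 0) :: l k | k <- iota m (n - m)]).
  by rewrite /s -flatten_cat -map_cat -[X in iota X (n - m)]add0n -iotaD subnKC.
pose z n := nth (0, 0) (s n.+1) n.
have zE n k : (k < size (s n))%N -> z k = nth (0, 0) (s n) k.
  move=> kn; have [kn'|nk] := leqP k.+1 n.
    by have [t ->] := s_prefix _ _ kn'; rewrite nth_cat size_s.
  have [|t st] := s_prefix n k.+1; first exact: ltnW.
  by rewrite /z st nth_cat kn.
have sum_z (V : nmodType) (F : H * K -> V) n :
    \sum_(0 <= k < size (s n)) F (z k) = \sum_(t <- s n) F t.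
  rewrite (big_nth (0, 0)) !big_nat; apply: eq_bigr => k /andP[_ kn].
  by rewrite (zE n).
have sum_s (V : nmodType) (F : H * K -> V) n : F (0, 0) = 0 ->
    \sum_(t <- s n) F t = \sum_(0 <= k < n) \sum_(t <- l k) F t.
  move=> F0; elim: n => [|n IH]; first by rewrite big_nil big_geq.
  by rewrite sS big_cat big_cons /= F0 add0r big_nat_recr//= IH.
pose w k := rnorm (z k).1 ^+ 2 + rnorm (z k).2 ^+ 2.
have w0 k : 0 <= w k by rewrite addr_ge0// sqr_ge0.
have wM n : \sum_(0 <= k < n) w k <= M.
  apply: le_trans (lM n); rewrite /lweight -sum_s; last first.
    by rewrite !rnorm0 expr0n addr0.
  rewrite -(sum_z _ (fun t => rnorm t.1 ^+ 2 + rnorm t.2 ^+ 2)).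
  rewrite (big_cat_nat (leq0n _) (size_s n)) /= lerDl sumr_ge0// => k _.
  exact: w0.
have c1 : cvgn (series (fun n => rnorm (z n).1 ^+ 2) : R^nat).
  apply: (@nseries_cvg _ M) => n; first exact: sqr_ge0.
  by apply: le_trans (wM n); apply: ler_sum => k _; rewrite lerDl sqr_ge0.
have c2 : cvgn (series (fun n => rnorm (z n).2 ^+ 2) : R^nat).
  apply: (@nseries_cvg _ M) => n; first exact: sqr_ge0.
  by apply: le_trans (wM n); apply: ler_sum => k _; rewrite lerDr sqr_ge0.
exists (Sqsum c1, Sqsum c2) => T e e0.
have [N hN] := normal_fun_lim (Sqsum c1, Sqsum c2) T e0.
exists N => n Nn; have := hN (size (s n)) (leq_trans Nn (size_s n)).
rewrite /nfun_part /= (sum_z _ (fun t => hdot (T t.1) t.2)) sum_s//.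
by rewrite /= hdot0r.
Qed.

Lemma normal_of_list H K (l : seq (H * K)) :
  exists p : sqsum H * sqsum K, forall T, normal_fun T p = lfun l T.
Proof.
pose l' n := if n is 0%N then l else [::].
have sum_l' (V : nmodType) (F : seq (H * K) -> V) n : F [::] = 0 ->
    \sum_(0 <= k < n.+1) F (l' k) = F l.
  move=> F0; rewrite big_nat_recl//= big1 ?addr0// => k _.
have [|p hp] := @normal_of_blocks H K l' (lweight l).
  case=> [|n]; first by rewrite big_geq// lweight_ge0.
  by rewrite sum_l'// /lweight big_nil.
exists p => T; apply/subr0_eq/cabs_eq0/eqP; rewrite eq_le cabs_ge0 andbT.
apply/ler_addgt0Pr => e /(hp T)[N /(_ N.+1 (leqnSn _))].
by rewrite (sum_l' _ (fun l => lfun l T)) ?add0r; [exact: ltW | rewrite /lfun big_nil].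
Qed.

End NormalFunctionals.

(** * The w*-topology *)

Section HahnBanach.
Context {R : realType} (V : lmodType R[i]) (p : V -> R) (x0 : V).
Hypothesis pD : forall x y, p (x + y) <= p x + p y.
Hypothesis pZ : forall (a : R[i]) x, p (a *: x) = cabs a * p x.

Let p0 : p 0 = 0.
Proof. by rewrite -(scale0r 0) pZ cabs0 mul0r. Qed.

Let pZr (t : R) x : p (t%:C%C *: x) = `|t| * p x.
Proof. by rewrite pZ cabs_real. Qed.

(* Partial real-linear functionals are represented by their graphs. *)
Let graph (G : set (V * R)) :=
  (forall (t : R) z w, G z -> G w -> G (t%:C%C *: z.1 + w.1, t * z.2 + w.2)) /\
  (forall z, G z -> z.2 <= p z.1).

Let G0 : set (V * R) := [set z | exists t : R, z = (t%:C%C *: x0, t * p x0)].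

Let G0_graph : graph G0.
Proof.
split=> [t _ _ [s ->] [r ->]|_ [t ->]] /=.
  by exists (t * s + r); rewrite rmorphD rmorphM /= scalerDl scalerA mulrDl mulrA.
by rewrite pZr ler_wpM2r ?ler_norm//; have := pD x0 (- x0);
  rewrite subrr p0 -scaleN1r pZ cabsN -[X in cabs X]/(1%:C%C) cabs_real normr1; lra.
Qed.

Let max_graph : exists G, [/\ graph G, G0 `<=` G &
  forall G', graph G' -> G `<=` G' -> G' `<=` G].
Proof.
(* [G0] is adjoined inside the predicate because the union of the empty chain has to satisfy it as
   well. *)
have [|A [AP Amax]] := @Zorn_bigcup _ (fun G => graph (G `|` G0)).
  move=> F FP Ftot; split=> [t z w|z].
    move=> [[X FX Xz]|G0z] [[Y FY Yw]|G0w]; last first.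
    - by right; apply: G0_graph.1.
    - have [/(_ t z w) h _] := FP _ FY.
      by have [||h'|h'] := h _ _; [right|left|left; exists Y|right].
    - have [/(_ t z w) h _] := FP _ FX.
      by have [||h'|h'] := h _ _; [left|right|left; exists X|right].
    have [XY|YX] := Ftot _ _ FX FY.
      have [/(_ t z w) h _] := FP _ FY.
      by have [||h'|h'] := h _ _; [left; exact: XY|left|left; exists Y|right].
    have [/(_ t z w) h _] := FP _ FX.
    by have [||h'|h'] := h _ _; [left|left; exact: YX|left; exists X|right].
  move=> [[X FX Xz]|G0z]; last exact: G0_graph.2.
  by have [_ h] := FP _ FX; apply: h; left.
exists (A `|` G0); split=> // G' G'g AG' z G'z.
apply: contrapT => Az.
have AG'p : A `<` G'.
  split; first by move=> w Aw; apply: AG'; left.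
  by move=> G'A; apply: Az; left; exact: G'A.
apply: (Amax _ AG'p); suff -> : G' `|` G0 = G' by [].
by apply/seteqP; split=> w; [case=> // G0w; apply: AG'; right | left].
Qed.

Lemma hahn_banach : exists F : V -> R[i],
  [/\ forall a x y, F (a *: x + y) = a * F x + F y,
      forall x, cabs (F x) <= p x & complex.Re (F x0) = p x0].
Proof.
have [G [[Gl Gp] G0G Gmax]] := max_graph.
have Gzero : G (0, 0) by apply: G0G; exists 0; rewrite scale0r mul0r.
have GZ (t : R) z : G z -> G (t%:C%C *: z.1, t * z.2).
  by move=> Gz; have := Gl t _ _ Gz Gzero; rewrite /= !addr0.
have GD z w : G z -> G w -> G (z.1 + w.1, z.2 + w.2).
  by move=> Gz Gw; have := Gl 1 _ _ Gz Gw; rewrite scale1r mul1r.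
have Gtot v : exists a, G (v, a).
  (* A value at [v] must lie above all elements of [E] and below all [p (w.1 + v) - w.2].
     Subadditivity of [p] orders the two families, and the supremum of the lower one is taken;
     maximality then puts the extended graph inside [G]. *)
  pose E := [set z.2 - p (z.1 - v) | z in G].
  have ub z w : G z -> G w -> z.2 - p (z.1 - v) <= p (w.1 + v) - w.2.
    move=> Gz Gw; have := Gp _ (GD _ _ Gz Gw); rewrite /=.
    have := pD (z.1 - v) (w.1 + v); rewrite addrACA [- v + v]addNr addr0; lra.
  have Esup : has_sup E.
    split; first by exists (0 - p (0 - v)), (0, 0).
    by exists (p (0 + v) - 0) => _ [z Gz <-]; apply: (ub z (0, 0)).
  pose c := sup E.
  have cl z : G z -> z.2 - p (z.1 - v) <= c.
    by move=> Gz; apply: sup_upper_bound => //; exists z.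
  have cu w : G w -> c <= p (w.1 + v) - w.2.
    by move=> Gw; apply: ge_sup; [exact: Esup.1 | move=> _ [z Gz <-]; exact: ub].
  pose G' := [set z | exists w (t : R), G w /\ z = (w.1 + t%:C%C *: v, w.2 + t * c)].
  have G'G : G' `<=` G.
    apply: Gmax; last first.
      by move=> z Gz; exists z, 0; rewrite scale0r mul0r !addr0 -surjective_pairing.
    split=> [t _ _ [z [s [Gz ->]]] [w [r [Gw ->]]]|_ [w [t [Gw ->]]]] /=.
      exists (t%:C%C *: z.1 + w.1, t * z.2 + w.2), (t * s + r); split.
        exact: Gl.
      rewrite /= rmorphD rmorphM /= scalerDl -scalerA scalerDr addrACA.
      by congr (_, _); ring.
    have [t0|t0|->] := ltgtP t 0; last first.
    - by rewrite scale0r mul0r !addr0; exact: Gp.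
    - have := cu _ (GZ t^-1 _ Gw); rewrite /=.
      have -> : t^-1%:C%C *: w.1 + v = t^-1%:C%C *: (w.1 + t%:C%C *: v).
        by rewrite scalerDr scalerA -rmorphM mulVf ?gt_eqF// scale1r.
      rewrite pZr gtr0_norm ?invr_gt0// -mulrBr -(ler_pM2l t0) mulVKf ?gt_eqF//.
      lra.
    have s0 : 0 < - t by rewrite oppr_gt0.
    have := cl _ (GZ (- t)^-1 _ Gw); rewrite /=.
    have -> : (- t)^-1%:C%C *: w.1 - v = (- t)^-1%:C%C *: (w.1 + t%:C%C *: v).
      rewrite scalerDr scalerA -rmorphM invrN mulNr mulVf ?lt_eqF//.
      by rewrite rmorphN1 scaleN1r.
    rewrite pZr gtr0_norm ?invr_gt0// -mulrBr -(ler_pM2l s0) mulVKf ?gt_eqF//.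
    lra.
  by exists c; apply: G'G; exists (0, 0), 1; rewrite /= scale1r mul1r !add0r.
pose g v := sval (cid (Gtot v)).
have Gg v : G (v, g v) by rewrite /g; case: cid.
have Gfun v a b : G (v, a) -> G (v, b) -> a = b.
  have h a' b' : G (v, a') -> G (v, b') -> a' <= b'.
    move=> Ga Gb; have := Gp _ (GD _ _ Ga (GZ (-1) _ Gb)).
    by rewrite /= rmorphN scaleN1r subrr p0; lra.
  by move=> Ga Gb; apply/eqP; rewrite eq_le !h.
have gl (t : R) x y : g (t%:C%C *: x + y) = t * g x + g y.
  exact: Gfun (Gg _) (Gl t _ _ (Gg x) (Gg y)).
have gD x y : g (x + y) = g x + g y by have := gl 1 x y; rewrite scale1r mul1r.
have gz : g 0 = 0 by exact: Gfun (Gg 0) Gzero.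
have gZ (t : R) x : g (t%:C%C *: x) = t * g x.
  by have := gl t x 0; rewrite gz !addr0.
(* [g] is only real linear; this is the complex linear functional with real part [g]. The bound on
   its modulus comes from rotating [x] by unimodular scalars. *)
pose F x : R[i] := (g x -i* g ('i%C *: x))%C.
have FD x y : F (x + y) = F x + F y.
  by rewrite /F scalerDr !gD; apply/eqP; rewrite eq_complex /= opprD !eqxx.
have FZ a x : F (a *: x) = a * F x.
  case: a => s t; rewrite /F.
  have e : (s +i* t)%C = s%:C%C + t%:C%C * 'i%C :> R[i].
    by apply/eqP; rewrite eq_complex /=; apply/andP; split; apply/eqP; ring.
  have e2 : 'i%C * (s +i* t)%C = s%:C%C * 'i%C + (- t)%:C%C :> R[i].
    by apply/eqP; rewrite eq_complex /=; apply/andP; split; apply/eqP; ring.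
  rewrite scalerA e2 e !scalerDl -!scalerA !gD !gZ.
  by apply/eqP; rewrite eq_complex /=; apply/andP; split; apply/eqP; ring.
exists F; split=> [a x y|x|].
- by rewrite FD FZ.
- apply: cabs_Re_le => u u1; rewrite -FZ /=.
  by have := Gp _ (Gg (u *: x)); rewrite /= pZ u1 mul1r.
- rewrite /=; apply: Gfun (Gg x0) _; apply: G0G; exists 1.
  by rewrite scale1r mul1r.
Qed.

End HahnBanach.

(** * w*-closed spans and w*-continuous maps *)

Section WstarClosure.
Context {R : realType}.
Implicit Types H K L : hilbertType R.

Lemma wstar_closureP H K (S : set (bop H K)) (T : bop H K) :
  (forall n (p : 'I_n -> sqsum H * sqsum K) (e : R), 0 < e ->
    exists2 Q, S Q & forall k, cabs (normal_fun Q (p k) - normal_fun T (p k)) < e) ->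
  closure (S : set (bop_wstar H K)) T.
Proof. by move=> h; apply: init_closureP. Qed.

Lemma wstar_closure H K (S : set (bop H K)) (T : bop H K) n
    (p : 'I_n -> sqsum H * sqsum K) (e : R) :
  closure (S : set (bop_wstar H K)) T -> 0 < e ->
  exists2 Q, S Q & forall k, cabs (normal_fun Q (p k) - normal_fun T (p k)) < e.
Proof. exact: closure_init. Qed.

Lemma normal_funD H K (p : sqsum H * sqsum K) (S T : bop H K) :
  normal_fun (S + T) p = normal_fun S p + normal_fun T p.
Proof. by have := normal_fun_linear p 1 S T; rewrite scale1r mul1r. Qed.

Lemma normal_fun0 H K (p : sqsum H * sqsum K) : normal_fun (0 : bop H K) p = 0.
Proof.
by have /eqP := normal_funD p 0 0; rewrite addr0 -subr_eq subrr => /eqP.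
Qed.

Lemma normal_funZ H K (p : sqsum H * sqsum K) a (T : bop H K) :
  normal_fun (a *: T) p = a * normal_fun T p.
Proof. by have := normal_fun_linear p a T 0; rewrite normal_fun0 !addr0. Qed.

Lemma lspan_subspace (V : lmodType R[i]) (S : set V) : is_subspace (lspan S).
Proof.
split; first by exists 0%N, (fun=> 0), (fun=> 0); split=> [[]//|]; rewrite big_ord0.
move=> a x y [n [c [s [Ss ->]]]] [m [d [t [St ->]]]].
exists (n + m)%N, (fun k => match fintype.split k with inl i => a * c i | inr j => d j end).
exists (fun k => match fintype.split k with inl i => s i | inr j => t j end).
split=> [k|]; first by case: fintype.split.
rewrite big_split_ord /= scaler_sumr; congr (_ + _); apply: eq_bigr => i _.
  by rewrite (unsplitK (inl i)) scalerA.
by rewrite (unsplitK (inr i)).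
Qed.

Lemma sub_lspan (V : lmodType R[i]) (S : set V) : S `<=` lspan S.
Proof.
move=> v Sv; exists 1%N, (fun=> 1), (fun=> v); split=> //.
by rewrite big_ord1 scale1r.
Qed.

Lemma subspace_sum (V : lmodType R[i]) (S : set V) I (r : seq I) (F : I -> V) :
  is_subspace S -> (forall i, S (F i)) -> S (\sum_(i <- r) F i).
Proof.
move=> [S0 SD] SF; elim/big_ind : _ => // x y Sx Sy.
by rewrite -[x]scale1r; exact: SD.
Qed.

Lemma subspaceZ (V : lmodType R[i]) (S : set V) a v :
  is_subspace S -> S v -> S (a *: v).
Proof. by move=> [S0 SD] Sv; rewrite -[_ *: _]addr0; exact: SD. Qed.

Lemma subspaceD (V : lmodType R[i]) (S : set V) u v :
  is_subspace S -> S u -> S v -> S (u + v).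
Proof. by move=> [S0 SD] Su Sv; rewrite -[u]scale1r; exact: SD. Qed.

Lemma lspan_min (V : lmodType R[i]) (S T : set V) :
  is_subspace T -> S `<=` T -> lspan S `<=` T.
Proof.
move=> Tsub ST _ [n [c [s [Ss ->]]]]; apply: subspace_sum => // i.
by apply: subspaceZ => //; exact: ST.
Qed.

Lemma closure_subspace H K (S : set (bop H K)) : is_subspace S ->
  is_subspace (closure (S : set (bop_wstar H K)) : set (bop H K)).
Proof.
move=> [S0 SD]; split; first exact: subset_closure.
move=> a x y Sx Sy; apply: wstar_closureP => n p e e0.
have a1 : 0 < cabs a + 1 by have := cabs_ge0 a; lra.
have e' : 0 < e / (cabs a + 1) by rewrite divr_gt0.
have [x' Sx' hx] := wstar_closure p Sx e'.
have [y' Sy' hy] := wstar_closure p Sy e'.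
exists (a *: x' + y'); first exact: SD.
move=> k; rewrite !normal_fun_linear.
rewrite (_ : _ - _ = a * (normal_fun x' (p k) - normal_fun x (p k)) +
  (normal_fun y' (p k) - normal_fun y (p k))); last by ring.
apply: le_lt_trans (cabsD _ _) _; rewrite cabsM.
have -> : e = cabs a * (e / (cabs a + 1)) + e / (cabs a + 1).
  by field; rewrite gt_eqF.
by apply: ler_ltD => //; rewrite ler_wpM2l ?cabs_ge0// ltW.
Qed.

Lemma wspan_subspace H K (S : set (bop H K)) : is_subspace (wspan S).
Proof. exact/closure_subspace/lspan_subspace. Qed.

Lemma wspan_closed H K (S : set (bop H K)) : wclosed (wspan S).
Proof. exact: closed_closure. Qed.

Lemma sub_wspan H K (S : set (bop H K)) : S `<=` wspan S.
Proof. by move=> T ST; apply: subset_closure; exact: sub_lspan. Qed.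

Lemma wspan_min H K (S A : set (bop H K)) : is_subspace A -> wclosed A ->
  S `<=` A -> wspan S `<=` A.
Proof.
move=> Asub Acl SA T; have /closure_id -> := Acl.
by apply: closure_subset; exact: lspan_min.
Qed.

(** w*-continuity of a linear map, stated through normal functionals so that neighbourhoods need not
    be handled. *)
Definition normal_map H K (H' K' : hilbertType R) (f : bop H K -> bop H' K') :=
  forall q, exists p, forall T, normal_fun (f T) q = normal_fun T p.

Lemma normal_map_closure H K (H' K' : hilbertType R) (f : bop H K -> bop H' K')
    (S : set (bop H K)) (S' : set (bop H' K')) (T : bop H K) :
  normal_map f -> wclosed S' -> (forall s, S s -> S' (f s)) ->
  closure (S : set (bop_wstar H K)) T -> S' (f T).
Proof.
move=> fn S'cl SS' ST; have /closure_id -> := S'cl.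
apply: wstar_closureP => n q e e0.
pose p k := sval (cid (fn (q k))).
have hp k T' : normal_fun (f T') (q k) = normal_fun T' (p k).
  by rewrite /p; case: cid.
have [Q SQ hQ] := wstar_closure p ST e0.
by exists (f Q); [exact: SS' | move=> k; rewrite !hp].
Qed.

Lemma normal_map_wspan H K (H' K' : hilbertType R) (f : bop H K -> bop H' K')
    (S : set (bop H K)) (S' : set (bop H' K')) (T : bop H K) :
  (forall a x y, f (a *: x + y) = a *: f x + f y) ->
  normal_map f -> is_subspace S' -> wclosed S' -> (forall s, S s -> S' (f s)) ->
  wspan S T -> S' (f T).
Proof.
move=> fl fn S'sub S'cl SS'; apply: (@normal_map_closure _ _ _ _ f (lspan S) S' T) => // s.
apply: (@lspan_min _ _ (f @^-1` S')) => //; split.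
  rewrite /preimage/=; have := fl (-1) 0 0.
  by rewrite scaler0 addr0 scaleN1r addNr => ->; case: S'sub.
by move=> a x y; rewrite /preimage/= fl; exact: S'sub.2.
Qed.

Lemma bop_sqsum_subproof H K (T : bop H K) (s : sqsum H) :
  cvgn (series (fun n => rnorm (T (s n)) ^+ 2) : R^nat).
Proof.
have [C C0 TC] := bop_bound T.
apply: (@series_le_cvg _ _ (fun n => C ^+ 2 * rnorm (s n) ^+ 2)).
- by move=> n; rewrite sqr_ge0.
- by move=> n; rewrite mulr_ge0 ?sqr_ge0.
- move=> n; rewrite -exprMn ler_pXn2r ?nnegrE ?rnorm_ge0 ?mulr_ge0 ?rnorm_ge0//.
exact: is_cvg_seriesZ (@sqsum_cvg R H s).
Qed.

Definition bop_sqsum H K (T : bop H K) (s : sqsum H) : sqsum K :=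
  Sqsum (@bop_sqsum_subproof H K T s).

Lemma normal_map_sandwich H K (H' K' : hilbertType R) (X : bop K K') (Y : bop H' H) :
  normal_map (fun T : bop H K => bcomp X (bcomp T Y)).
Proof.
move=> q; exists (bop_sqsum Y q.1, bop_sqsum (adj X) q.2) => T.
rewrite /normal_fun; congr (limn (series _)); apply/funext => n /=.
by rewrite adjP.
Qed.

End WstarClosure.

(** * Matrix norms *)

Section L2Norms.
Context {R : realType}.
Local Notation Re := (@complex.Re R).

Lemma l2norm_ge0 (V : normedModType R[i]) (I : finType) (x : I -> V) : 0 <= l2norm x.
Proof. exact: sqrtr_ge0. Qed.

Lemma l2norm_sqr (V : normedModType R[i]) (I : finType) (x : I -> V) :
  l2norm x ^+ 2 = \sum_i rnorm (x i) ^+ 2.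
Proof. by rewrite sqr_sqrtr// sumr_ge0// => i _; rewrite sqr_ge0. Qed.

Lemma l2normZ (V : normedModType R[i]) (I : finType) a (x : I -> V) :
  l2norm (fun i => a *: x i) = cabs a * l2norm x.
Proof.
apply/eqP; rewrite -(@eqrXn2 _ 2%N)// ?l2norm_ge0 ?mulr_ge0 ?cabs_ge0 ?l2norm_ge0//.
rewrite exprMn !l2norm_sqr mulr_sumr; apply/eqP; apply: eq_bigr => i _.
by rewrite rnormZ exprMn.
Qed.

Lemma rnorm_le_l2norm (V : normedModType R[i]) (I : finType) (x : I -> V) i :
  rnorm (x i) <= l2norm x.
Proof.
rewrite -(@ler_pXn2r _ 2%N)// ?nnegrE ?rnorm_ge0 ?l2norm_ge0//.
rewrite l2norm_sqr (bigD1 i)//= lerDl sumr_ge0// => j _; exact: sqr_ge0.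
Qed.

Lemma l2norm_le_sum (V : normedModType R[i]) (I : finType) (x : I -> V) :
  l2norm x <= \sum_i rnorm (x i).
Proof.
have s0 : 0 <= \sum_i rnorm (x i) by apply: sumr_ge0 => i _; exact: rnorm_ge0.
rewrite -(@ler_pXn2r _ 2%N)// ?nnegrE ?l2norm_ge0// l2norm_sqr.
rewrite expr2 mulr_suml; apply: ler_sum => i _.
rewrite expr2 ler_wpM2l ?rnorm_ge0//.
rewrite (bigD1 i)//= lerDl sumr_ge0// => j _; exact: rnorm_ge0.
Qed.

Lemma rnorm_sum (V : normedModType R[i]) I (r : seq I) (P : pred I) (F : I -> V) :
  rnorm (\sum_(i <- r | P i) F i) <= \sum_(i <- r | P i) rnorm (F i).
Proof.
elim/big_rec2 : _ => [|i a x _ h]; first by rewrite rnorm0.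
by apply: (le_trans (rnormD _ _)); rewrite lerD2l.
Qed.

Section Bounded.
Variables (V W : normedModType R[i]) (I : finType) (T : I -> I -> V -> W).
Hypothesis TZ : forall i j a x, T i j (a *: x) = a *: T i j x.
Hypothesis Tbnd : forall i j, exists C : R, forall x, rnorm (T i j x) <= C * rnorm x.

Let Tx (x : I -> V) i := \sum_j T i j (x j).

Let TxZ a x : Tx (fun i => a *: x i) = (fun i => a *: Tx x i).
Proof.
by apply/funext => i; rewrite /Tx scaler_sumr; apply: eq_bigr => j _; rewrite TZ.
Qed.

Let T0 i j : T i j 0 = 0.
Proof. by rewrite -[X in T _ _ X](scale0r (0 : V)) TZ scale0r. Qed.

Let Tsup : has_sup [set l2norm (Tx x) | x in [set x | l2norm x <= 1]].
Proof.
split.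
  exists (l2norm (Tx (fun=> 0))), (fun=> 0) => //=.
  rewrite /l2norm big1 ?sqrtr0// => i _; by rewrite rnorm0 expr0n.
pose C i j := sval (cid (Tbnd i j)).
have hC i j x : rnorm (T i j x) <= C i j * rnorm x by rewrite /C; case: cid.
exists (\sum_i \sum_j `|C i j|) => _ [x /= x1 <-].
apply: le_trans (l2norm_le_sum _) _; apply: ler_sum => i _.
apply: le_trans (rnorm_sum _ _ _) _; apply: ler_sum => j _.
apply: le_trans (hC _ _ _) _; apply: le_trans (ler_norm _) _.
rewrite normrM (ger0_norm (rnorm_ge0 _)) ler_piMr//.
exact: le_trans (rnorm_le_l2norm _ _) x1.
Qed.

Lemma l2opnorm_ge0 : 0 <= l2opnorm T.
Proof.
have [[r Sr] _] := Tsup; apply: le_trans (sup_upper_bound Tsup Sr).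
by case: Sr => x _ <-; exact: l2norm_ge0.
Qed.

Lemma l2opnormP x : l2norm (fun i => \sum_j T i j (x j)) <= l2opnorm T * l2norm x.
Proof.
have [x0|x0] := eqVneq (l2norm x) 0.
  have {}x0 j : x j = 0.
    by apply: rnorm_eq0; apply/eqP; rewrite eq_le rnorm_ge0 andbT -x0 rnorm_le_l2norm.
  rewrite [leLHS](_ : _ = 0) ?mulr_ge0 ?l2opnorm_ge0 ?l2norm_ge0//.
  rewrite /l2norm big1 ?sqrtr0// => i _.
  by rewrite big1 ?rnorm0 ?expr0n// => j _; rewrite x0 T0.
have xp : 0 < l2norm x by rewrite lt0r x0 l2norm_ge0.
rewrite -ler_pdivrMr// mulrC.
have xV : cabs ((l2norm x)^-1%:C%C) = (l2norm x)^-1.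
  by rewrite cabs_real ger0_norm// invr_ge0 ltW.
rewrite -[X in X * _]xV -l2normZ -[X in l2norm X](TxZ _ x).
apply: (sup_upper_bound Tsup); exists (fun i => ((l2norm x)^-1)%:C%C *: x i) => //=.
by rewrite l2normZ xV mulVf.
Qed.

Lemma l2opnorm_le C : 0 <= C ->
  (forall x, l2norm (fun i => \sum_j T i j (x j)) <= C * l2norm x) -> l2opnorm T <= C.
Proof.
move=> C0 h; apply: ge_sup; first exact: Tsup.1.
by move=> _ [x /= x1 <-]; apply: le_trans (h x) _; rewrite ler_piMr.
Qed.

End Bounded.

Lemma l2_CS (I : finType) (a b : I -> R) : (forall i, 0 <= a i) -> (forall i, 0 <= b i) ->
  \sum_i a i * b i <= Num.sqrt (\sum_i a i ^+ 2) * Num.sqrt (\sum_i b i ^+ 2).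
Proof.
move=> a0 b0.
have A0 : 0 <= \sum_i a i ^+ 2 by apply: sumr_ge0 => i _; exact: sqr_ge0.
have B0 : 0 <= \sum_i b i ^+ 2 by apply: sumr_ge0 => i _; exact: sqr_ge0.
have AB0 : 0 <= \sum_i a i * b i by apply: sumr_ge0 => i _; rewrite mulr_ge0.
rewrite -[leLHS]ger0_norm// -[X in X <= _](cabs_real (\sum_i a i * b i)).
apply: quad_bound; rewrite ?sqrtr_ge0// => t; rewrite !sqr_sqrtr//.
rewrite [t * _]mulrC ReZ.
have : 0 <= \sum_i (a i + complex.Re t * b i) ^+ 2 by apply: sumr_ge0 => i _; exact: sqr_ge0.
have -> : \sum_i (a i + Re t * b i) ^+ 2 =
    \sum_i a i ^+ 2 + 2 * (\sum_i a i * b i * Re t) + Re t ^+ 2 * \sum_i b i ^+ 2.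
  rewrite !mulr_sumr -!big_split /=; apply: eq_bigr => i _; ring.
rewrite -mulr_suml cabs_sqr => h.
have : 0 <= complex.Im t ^+ 2 * \sum_i b i ^+ 2 by rewrite mulr_ge0// sqr_ge0.
lra.
Qed.

Lemma l2norm_dot (H : hilbertType R) (I : finType) (v w : I -> H) :
  cabs (\sum_i hdot (v i) (w i)) <= l2norm v * l2norm w.
Proof.
apply: le_trans (cabs_sum _ _ _) _.
apply: (@le_trans _ _ (\sum_i rnorm (v i) * rnorm (w i))).
  by apply: ler_sum => i _; exact: hdot_CS.
by apply: l2_CS => i; exact: rnorm_ge0.
Qed.

Lemma bop_scal (H K : hilbertType R) (T : bop H K) a x : T (a *: x) = a *: T x.
Proof. exact: linearZ. Qed.

Lemma bop_bound_ex (H K : hilbertType R) (T : bop H K) :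
  exists C : R, forall x, rnorm (T x) <= C * rnorm x.
Proof. by have [C _ h] := bop_bound T; exists C. Qed.

Lemma mxnormE (H K : hilbertType R) n (T : 'M[bop H K]_n) :
  mxnorm T = l2opnorm (fun i j => T i j : H -> K).
Proof. by []. Qed.

Lemma mxnorm_dot (H K : hilbertType R) n (T : 'M[bop H K]_n) v w :
  cabs (\sum_i \sum_j hdot (T i j (v j)) (w i)) <= mxnorm T * l2norm v * l2norm w.
Proof.
under eq_bigr do rewrite -hdot_suml.
apply: le_trans (l2norm_dot _ _) _; rewrite ler_wpM2r ?l2norm_ge0//.
rewrite mxnormE; exact: (@l2opnormP H K 'I_n (fun i j => T i j) (fun i j => bop_scal (T i j))
  (fun i j => bop_bound_ex (T i j)) v).
Qed.

Lemma mxnorm_bop_ge0 (H K : hilbertType R) n (T : 'M[bop H K]_n) : 0 <= mxnorm T.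
Proof.
rewrite mxnormE; exact: (@l2opnorm_ge0 H K 'I_n (fun i j => T i j)
  (fun i j => bop_bound_ex (T i j))).
Qed.

Lemma mxnorm_vec (H K : hilbertType R) n (T : 'M[bop H K]_n) v :
  l2norm (fun i => \sum_j T i j (v j)) <= mxnorm T * l2norm v.
Proof.
rewrite mxnormE; exact: (@l2opnormP H K 'I_n (fun i j => T i j) (fun i j => bop_scal (T i j))
  (fun i j => bop_bound_ex (T i j)) v).
Qed.

Lemma mxnorm_le (H K : hilbertType R) n (T : 'M[bop H K]_n) C : 0 <= C ->
  (forall v, l2norm (fun i => \sum_j T i j (v j)) <= C * l2norm v) -> mxnorm T <= C.
Proof.
rewrite mxnormE; exact: (@l2opnorm_le H K 'I_n (fun i j => T i j)
  (fun i j => bop_bound_ex (T i j)) C).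
Qed.

Lemma mxnorm_dot_le (H K : hilbertType R) n (T : 'M[bop H K]_n) C : 0 <= C ->
  (forall v w, cabs (\sum_i \sum_j hdot (T i j (v j)) (w i)) <= C * l2norm v * l2norm w) ->
  mxnorm T <= C.
Proof.
move=> C0 h; apply: mxnorm_le => // v.
set w := fun i => _; have [->|w0] := eqVneq (l2norm w) 0.
  by rewrite mulr_ge0// l2norm_ge0.
have wp : 0 < l2norm w by rewrite lt0r w0 l2norm_ge0.
rewrite -(ler_pM2r wp); apply: le_trans (h v w).
rewrite -expr2 l2norm_sqr; under [in leRHS]eq_bigr do rewrite -hdot_suml.
rewrite (eq_bigr (fun i => (rnorm (w i) ^+ 2)%:C%C)); last by move=> i _; rewrite hdotxxE.
by rewrite -rmorph_sum cabs_real ger0_norm// sumr_ge0// => i _; exact: sqr_ge0.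
Qed.

Lemma l2norm_ord1 (V : normedModType R[i]) (x : 'I_1 -> V) : l2norm x = rnorm (x ord0).
Proof. by rewrite /l2norm big_ord1 sqrtr_sqr ger0_norm// rnorm_ge0. Qed.

Lemma norm1_bopP (H K : hilbertType R) (T : bop H K) x :
  rnorm (T x) <= norm1 T * rnorm x.
Proof.
have := mxnorm_vec (const_mx T : 'M_1) (fun=> x).
by rewrite !l2norm_ord1 big_ord1 mxE.
Qed.

Lemma norm1_bop_le (H K : hilbertType R) (T : bop H K) C : 0 <= C ->
  (forall x, rnorm (T x) <= C * rnorm x) -> norm1 T <= C.
Proof.
move=> C0 TC; apply: mxnorm_le => // v.
by rewrite !l2norm_ord1 big_ord1 mxE.
Qed.

Lemma norm1_bop_ge0 (H K : hilbertType R) (T : bop H K) : 0 <= norm1 T.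
Proof. exact: mxnorm_bop_ge0. Qed.

Lemma norm1_bopZ (H K : hilbertType R) a (T : bop H K) : norm1 (a *: T) = cabs a * norm1 T.
Proof.
have h b (S : bop H K) : norm1 (b *: S) <= cabs b * norm1 S.
  apply: norm1_bop_le => [|x]; first by rewrite mulr_ge0 ?cabs_ge0 ?norm1_bop_ge0.
  by rewrite bopZE rnormZ -mulrA ler_wpM2l ?cabs_ge0// norm1_bopP.
apply/eqP; rewrite eq_le h /=; have [->|a0] := eqVneq a 0.
  by rewrite cabs0 mul0r norm1_bop_ge0.
have ap : 0 < cabs a.
  by rewrite lt0r cabs_ge0 andbT; apply: contra a0 => /eqP /cabs_eq0 ->.
rewrite -ler_pdivlMl//.
have := h a^-1 (a *: T); rewrite scalerA mulVf// scale1r.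
suff -> : cabs a^-1 = (cabs a)^-1 by [].
apply: (mulfI (lt0r_neq0 ap)); rewrite -cabsM mulfV// mulfV ?gt_eqF//.
by rewrite -[1]/(1%:C%C) cabs_real normr1.
Qed.

Lemma norm1_isometry (V W : mxNormedType R) (f : V -> W) x :
  complete_isometry f -> norm1 (f x) = norm1 x.
Proof.
move=> /(_ 1%N (const_mx x)); rewrite /norm1 => <-; congr mxnorm.
by apply/matrixP => i j; rewrite !mxE.
Qed.

End L2Norms.

Section ConcreteNorms.
Context {R : realType} (V : mxNormedType R) (H : hilbertType R)
  (f : {linear V -> bop H H}).
Hypothesis fci : complete_isometry f.
Implicit Types x y : V.

Lemma rep_norm1_ge0 x : 0 <= norm1 x.
Proof. by rewrite -(norm1_isometry _ fci) norm1_bop_ge0. Qed.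

Lemma rep_norm1Z a x : norm1 (a *: x) = cabs a * norm1 x.
Proof. by rewrite -!(norm1_isometry _ fci) linearZ norm1_bopZ. Qed.

(** Compression of a matrix by a scalar row and a scalar column, one of the axioms of Ruan, read off
    from the operators. It is what makes bounded functionals completely bounded. *)
Lemma rep_norm1_mx m (y : 'M[V]_m) (w z : 'I_m -> R[i]^o) :
  norm1 (\sum_k \sum_l (w k * z l) *: y k l) <= mxnorm y * l2norm z * l2norm w.
Proof.
rewrite -(norm1_isometry _ fci) -(fci y).
have m0 := mxnorm_bop_ge0 (map_mx f y).
apply: mxnorm_dot_le; first by rewrite !mulr_ge0 ?l2norm_ge0.
move=> xi eta; rewrite !big_ord1 !l2norm_ord1 mxE linear_sum.
rewrite bop_sumE hdot_suml.
rewrite (eq_bigr (fun k => \sum_l hdot (map_mx f y k l (z l *: xi ord0))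
    ((w k)^*%C *: eta ord0))); last first.
  move=> k _; rewrite linear_sum bop_sumE hdot_suml; apply: eq_bigr => l _.
  by rewrite linearZ bopZE mxE bop_scal hdotZr !hdotZl conjcK mulrA.
apply: le_trans (mxnorm_dot _ _ _) _.
have e (u : 'I_m -> R[i]^o) (x : H) : l2norm (fun k => u k *: x : H) = l2norm u * rnorm x.
  apply/eqP; rewrite -(@eqrXn2 _ 2%N)// ?mulr_ge0 ?l2norm_ge0 ?rnorm_ge0//.
  rewrite exprMn !l2norm_sqr mulr_suml; apply/eqP; apply: eq_bigr => k _.
  by rewrite rnormZ exprMn.
have e' : l2norm (fun k => (w k)^*%C *: eta ord0) = l2norm w * rnorm (eta ord0).
  rewrite (e (fun k => (w k)^*%C)); congr (_ * _); rewrite /l2norm.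
  by congr Num.sqrt; apply: eq_bigr => k _; rewrite rnorm_cabs cabs_conj.
rewrite e e' le_eqVlt; apply/orP; left; apply/eqP; ring.
Qed.

End ConcreteNorms.

(** * Bounded functionals on an operator space *)

Section OperatorSpaceDual.
Context {R : realType} (X : opSpaceType R).
Implicit Types x y : X.

Lemma op_norm1_ge0 x : 0 <= norm1 x.
Proof. by have [H [f [fci _]]] := @opspace_rep R X; exact: rep_norm1_ge0 fci x. Qed.

Lemma op_norm1Z a x : norm1 (a *: x) = cabs a * norm1 x.
Proof. by have [H [f [fci _]]] := @opspace_rep R X; exact: rep_norm1Z fci a x. Qed.

Lemma op_norm1_mx m (y : 'M[X]_m) (w z : 'I_m -> R[i]^o) :
  norm1 (\sum_k \sum_l (w k * z l) *: y k l) <= mxnorm y * l2norm z * l2norm w.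
Proof. by have [H [f [fci _]]] := @opspace_rep R X; have h := rep_norm1_mx fci y w z; exact: h. Qed.

Lemma dual_linear (f : dual X) a x y : f (a *: x + y) = a * f x + f y.
Proof. by have /asboolP[fl _] := dual_subproof f; exact: fl. Qed.

Lemma dual_bound (f : dual X) :
  exists2 M : R, 0 <= M & forall x, cabs (f x) <= M * norm1 x.
Proof.
have /asboolP[_ [M hM]] := dual_subproof f.
exists `|M| => // x; rewrite -lecR cabsE.
apply: le_trans (hM x) _; rewrite lecR ler_wpM2r ?op_norm1_ge0//.
exact: ler_norm.
Qed.

Lemma dual_sum (f : dual X) I (r : seq I) (F : I -> X) :
  f (\sum_(i <- r) F i) = \sum_(i <- r) f (F i).
Proof.
have fD u v : f (u + v) = f u + f v.
  by have := dual_linear f 1 u v; rewrite scale1r mul1r.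
have f0 : f 0 = 0.
  by have /eqP := fD 0 0; rewrite addr0 -subr_eq subrr => /eqP.
exact: (big_morph f fD f0).
Qed.

Lemma dualZ (f : dual X) a x : f (a *: x) = a * f x.
Proof.
have f0 : f 0 = 0 by rewrite -[0](big_nil _ +%R predT (fun _ : 'I_0 => 0)) dual_sum big_nil.
by have := dual_linear f a x 0; rewrite f0 !addr0.
Qed.

Lemma sum_ord1_pair (V : nmodType) m (F : 'I_1 * 'I_m -> V) :
  \sum_k F k = \sum_k F (ord0, k).
Proof.
by rewrite (eq_bigr (fun k => F (k.1, k.2))) -?(pair_bigA _ (fun i j => F (i, j)))
  ?big_ord1//= => -[].
Qed.

Let dual_mat (f : dual X) m (x : 'M[X]_m) (k l : 'I_1 * 'I_m) (z : R[i]^o) : R[i]^o :=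
  ((const_mx f : 'M[dual X]_1) k.1 l.1 (x k.2 l.2) : R[i]^o) * z.

Let dual_set (f : dual X) :=
  [set r | exists m (x : 'M[X]_m), mxnorm x <= 1 /\ r = l2opnorm (dual_mat f x)].

(** A bounded functional is completely bounded with the same constant: the matrix of the values of
    [f], applied to [z], is paired with the conjugate of the result, and by linearity the scalars
    move inside [f], where [op_norm1_mx] applies. Without such a bound the supremum that defines the
    norm of the dual would carry no information. *)
Lemma dual_set_sup (f : dual X) : has_sup (dual_set f).
Proof.
have [M M0 fM] := dual_bound f; split.
  exists (l2opnorm (dual_mat f (const_mx 0 : 'M[X]_1))), 1%N, (const_mx 0).
  split=> //; rewrite -[X in X <= _]/(norm1 (0 : X)).
  by rewrite -(scale0r 0) op_norm1Z cabs0 mul0r.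
exists M => _ [m [x [x1 ->]]]; apply: l2opnorm_le => //.
  move=> k l; exists (cabs (f (x k.2 l.2))) => z.
  by rewrite /dual_mat mxE !rnorm_cabs cabsM.
move=> z; set u := fun k => _.
have [->|u0] := eqVneq (l2norm u) 0; first by rewrite mulr_ge0 ?l2norm_ge0.
have up : 0 < l2norm u by rewrite lt0r u0 l2norm_ge0.
rewrite -(ler_pM2r up) -expr2.
pose w k : R[i]^o := (u (ord0, k))^*%C.
pose z' k : R[i]^o := z (ord0, k).
have lw : l2norm w = l2norm u.
  rewrite /l2norm sum_ord1_pair; congr Num.sqrt; apply: eq_bigr => k _.
  by rewrite /w !rnorm_cabs cabs_conj.
have lz : l2norm z' = l2norm z by rewrite /l2norm [in RHS]sum_ord1_pair.
have -> : l2norm u ^+ 2 = cabs (f (\sum_k \sum_l (w k * z' l) *: x k l)).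
  rewrite -lw l2norm_sqr dual_sum.
  rewrite (eq_bigr (fun k => (rnorm (w k) ^+ 2)%:C%C)).
    by rewrite -rmorph_sum cabs_real ger0_norm// sumr_ge0// => i _; exact: sqr_ge0.
  move=> k _; rewrite dual_sum rnorm_cabs -mul_conj_cabs {2}/w conjcK /u mulr_sumr.
  rewrite sum_ord1_pair; apply: eq_bigr => l _.
  by rewrite dualZ /dual_mat mxE /= /z'; ring.
apply: le_trans (fM _) _; rewrite -mulrA ler_wpM2l//.
apply: le_trans (op_norm1_mx _ _ _) _; rewrite lw lz -mulrA.
by rewrite ler_piMl// mulr_ge0 ?l2norm_ge0.
Qed.

Lemma dual_norm1P (f : dual X) x : cabs (f x) <= norm1 f * norm1 x.
Proof.
have fsup := dual_set_sup f.
have small y : norm1 y <= 1 -> cabs (f y) <= norm1 f.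
  move=> y1; apply: (sup_upper_bound fsup).
  exists 1%N, (const_mx y); split=> //.
  have TZ (k l : 'I_1 * 'I_1) a z : dual_mat f (const_mx y) k l (a *: z) =
      a *: dual_mat f (const_mx y) k l z by exact: mulrCA.
  have Tb (k l : 'I_1 * 'I_1) : exists C : R, forall z,
      rnorm (dual_mat f (const_mx y) k l z) <= C * rnorm z.
    by exists (cabs (f y)) => z; rewrite /dual_mat !mxE !rnorm_cabs cabsM.
  apply/eqP; rewrite eq_le; apply/andP; split.
    have := l2opnormP TZ Tb (fun=> 1).
    rewrite /l2norm !sum_ord1_pair !big_ord1 !sum_ord1_pair !big_ord1.
    rewrite /dual_mat !mxE mulr1 !sqrtr_sqr !ger0_norm ?rnorm_ge0//.
    rewrite !rnorm_cabs => h; apply: le_trans h _.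
    by rewrite -[X in cabs X]/(1%:C%C) cabs_real normr1 mulr1.
  apply: l2opnorm_le; [exact: Tb | exact: cabs_ge0 | move=> z].
  rewrite /l2norm !sum_ord1_pair !big_ord1 !sum_ord1_pair !big_ord1.
  by rewrite /dual_mat !mxE !sqrtr_sqr !ger0_norm ?rnorm_ge0// !rnorm_cabs cabsM.
have [x0|x0] := eqVneq (norm1 x) 0.
  have [M M0 fM] := dual_bound f.
  by have := fM x; rewrite x0 !mulr0.
have xp : 0 < norm1 x by rewrite lt0r x0 op_norm1_ge0.
have xV : cabs ((norm1 x)^-1%:C%C) = (norm1 x)^-1.
  by rewrite cabs_real ger0_norm// invr_ge0 ltW.
rewrite -ler_pdivrMr// mulrC -xV -cabsM -dualZ; apply: small.
by rewrite op_norm1Z xV mulVf.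
Qed.

Lemma mk_dual (F : X -> R[i]) (c : R) :
  (forall a x y, F (a *: x + y) = a * F x + F y) ->
  (forall x, cabs (F x) <= c * norm1 x) -> exists f : dual X, forall x, f x = F x.
Proof.
move=> Fl Fc; have Fd : is_dual (F : X -> R[i]).
  apply/asboolP; split; first by move=> a x y; exact: Fl.
  by exists c => x; rewrite -cabsE lecR; exact: Fc.
by exists (Dual Fd).
Qed.

End OperatorSpaceDual.

(** * Normal representations *)

Section WstarFunctionals.
Context {R : realType} (A : dualOpAlgType R).
Implicit Types (a b : A) (x y : predual A).

Lemma to_dual_le a x : cabs (to_dual a x) <= norm1 a * norm1 x.
Proof.
rewrite -(norm1_isometry a (@to_dual_isometry R A)); exact: dual_norm1P.
Qed.

Lemma to_dual_linear (c : R[i]) a b x :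
  to_dual (c *: a + b) x = c * to_dual a x + to_dual b x.
Proof. by rewrite linearP. Qed.

Lemma to_dual0 x : to_dual (0 : A) x = 0.
Proof. by rewrite linear0. Qed.

Definition wfun (F : A -> R[i]) := exists x, forall a, F a = to_dual a x.

Lemma wfun_comb (F G : A -> R[i]) (c : R[i]) :
  wfun F -> wfun G -> wfun (fun a => c * F a + G a).
Proof.
move=> [x Fx] [y Gy]; exists (c *: x + y) => a.
by rewrite dual_linear Fx Gy.
Qed.

(** A w*-neighbourhood of 0 on which [F] stays below 1 constrains finitely many predual elements
    only. On their common kernel [F] vanishes, as otherwise a multiple of a vector there would have
    value 1; [common_kernel] then gives the element of the predual. *)
Lemma continuous_wfun (F : A -> R[i]) :
  (forall c a b, F (c *: a + b) = c * F a + F b) ->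
  continuous (F : wstar A -> R[i]^o) -> wfun F.
Proof.
move=> Fl Fc; have F0 : F 0 = 0.
  have := Fl 1 0 0; rewrite scale1r addr0 mul1r => /eqP.
  by rewrite -subr_eq subrr => /eqP.
have FZ c a : F (c *: a) = c * F a by have := Fl c a 0; rewrite F0 !addr0.
have : nbhs (0 : wstar A) [set a | cabs (F a) < 1].
  have /cvgrPdist_lt/(_ 1%:C%C) := Fc 0.
  rewrite ltcR ltr01 => /(_ isT); apply: filterS => a /=.
  by rewrite -rnormE ltcR rnormB F0 subr0.
move=> /init_nbhsP[n [x [e [e0 hx]]]].
have [||v xv|c hc] := @common_kernel R[i] A n (fun i a => to_dual a (x i)) F => //.
- by move=> i a u v; exact: to_dual_linear.
- apply/eqP; apply: contraT => Fv.
  have := hx ((F v)^-1 *: v); rewrite /= FZ mulVf//.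
  rewrite cabs1 ltxx; apply=> k.
  by rewrite /to_dual_fun -[_ *: v]addr0 to_dual_linear to_dual0 !addr0 xv mulr0 subr0 cabs0.
exists (\sum_i c i *: x i) => a; rewrite hc dual_sum.
by apply: eq_bigr => i _; rewrite dualZ.
Qed.

(** * Normal functionals of a representation exhaust the predual *)

Section Representation.
Variables (K : hilbertType R) (f : {linear A -> bop K K}).

Definition wnormal := forall p, wfun (fun a => normal_fun (f a) p).

Lemma continuous_wnormal : continuous (f : wstar A -> bop_wstar K K) -> wnormal.
Proof.
move=> fc p; apply: continuous_wfun.
  by move=> c a b; rewrite linearP normal_fun_linear.
move=> a; apply: (@continuous_comp (wstar A) (bop_wstar K K) R[i]^o f
  (fun T => normal_fun T p)); first exact: fc.
exact: (@init_eval_continuous R _ _ (@normal_fun R K K) p).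
Qed.

Lemma wnormal_continuous : wnormal -> continuous (f : wstar A -> bop_wstar K K).
Proof.
move=> fn; apply: (@init_continuousP R _ _ (@normal_fun R K K)) => p.
have [x hx] := fn p.
have -> : (fun b : wstar A => normal_fun (f b) p) = (fun b => to_dual_fun b x).
  exact/funext.
exact: (@init_eval_continuous R _ _ (@to_dual_fun R A) x).
Qed.

Hypothesis fci : complete_isometry f.
Hypothesis fn : wnormal.

Lemma alg_norm1_ge0 a : 0 <= norm1 a.
Proof. exact: rep_norm1_ge0 fci a. Qed.

Lemma wfun_list (l : seq (K * K)) : wfun (fun a => lfun l (f a)).
Proof.
have [p hp] := normal_of_list l; have [x hx] := fn p.
by exists x => a; rewrite -hp hx.
Qed.

(** Possible costs of [y]: a list is charged by its weight, the error it leaves by its norm over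
    [d]. The infimum [gauge d] is a seminorm on the predual, fit for Hahn-Banach, and a bound on it
    controls weight and error at once. *)
Let E (d : R) y := [set r | exists l M,
  [/\ 0 <= M, forall a, cabs (to_dual a y - lfun l (f a)) <= M * norm1 a &
      r = lweight l + M / d]].

(** The weight is quadratic in the vectors, so each side of a pair absorbs the square root of
    [cabs c], and the phase goes to the left vector. *)
Let scale_list (c : R[i]) (l : seq (K * K)) : exists l',
  (forall T, lfun l' T = c * lfun l T) /\ lweight l' = cabs c * lweight l.
Proof.
have [u u1 uc] := cabs_phase c.
pose s : R := Num.sqrt (cabs c).
have s0 : 0 <= s by exact: sqrtr_ge0.
have s2 : s ^+ 2 = cabs c by rewrite sqr_sqrtr// cabs_ge0.
have cs : c = (u^*)%C * (s ^+ 2)%:C%C.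
  by rewrite s2 -uc mulrA [_ * u]mulrC mul_conj_cabs u1 expr1n mul1r.
exists [seq (((u^*)%C * s%:C%C) *: t.1, s%:C%C *: t.2) | t <- l]; split=> [T|].
  rewrite /lfun big_map mulr_sumr; apply: eq_bigr => t _ /=.
  rewrite bop_scal hdotZl hdotZr conjc_real cs rmorphXn /=; ring.
rewrite /lweight big_map mulr_sumr; apply: eq_bigr => t _ /=.
rewrite !rnormZ cabsM cabs_conj u1 mul1r cabs_real ger0_norm//.
by rewrite !exprMn s2 mulrDr.
Qed.

Let E_inf d y : 0 < d -> has_inf (E d y).
Proof.
move=> d0; split.
  exists (lweight ([::] : seq (K * K)) + norm1 y / d), [::], (norm1 y); split=> //.
    exact: op_norm1_ge0.
  by move=> a; rewrite /lfun big_nil subr0 mulrC to_dual_le.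
exists 0 => _ [l [M [M0 _ ->]]].
by rewrite addr_ge0 ?lweight_ge0// divr_ge0// ltW.
Qed.

Let EZ d y c r : 0 < d -> E d y r -> E d (c *: y) (cabs c * r).
Proof.
move=> d0 [l [M [M0 hM ->]]]; have [l' [l'E l'w]] := scale_list c l.
exists l', (cabs c * M); split.
- by rewrite mulr_ge0 ?cabs_ge0.
- by move=> a; rewrite dualZ l'E -mulrBr cabsM -mulrA ler_wpM2l ?cabs_ge0.
- by rewrite l'w mulrDr mulrA.
Qed.

Let gauge d y := inf (E d y).

Let gauge_le d y r : 0 < d -> E d y r -> gauge d y <= r.
Proof. by move=> d0 Er; apply: ge_inf => //; case: (E_inf y d0). Qed.

Let gaugeZ_le d y c : 0 < d -> c != 0 -> gauge d (c *: y) <= cabs c * gauge d y.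
Proof.
move=> d0 c0; have cp : 0 < cabs c.
  by rewrite lt0r cabs_ge0 andbT; apply: contra c0 => /eqP /cabs_eq0 ->.
rewrite -ler_pdivrMl//; apply: lb_le_inf; first by case: (E_inf y d0).
move=> r Er; rewrite ler_pdivrMl//; apply: gauge_le => //; exact: EZ.
Qed.

Let gaugeZ d y c : 0 < d -> gauge d (c *: y) = cabs c * gauge d y.
Proof.
move=> d0; have [->|c0] := eqVneq c 0.
  rewrite cabs0 mul0r scale0r; apply/eqP; rewrite eq_le; apply/andP; split.
    apply: gauge_le => //; exists [::], 0; split=> //.
      by move=> a; rewrite /lfun big_nil subr0 mul0r -(scale0r 0) dualZ mul0r cabs0.
    by rewrite /lweight big_nil mul0r addr0.
  apply: lb_le_inf; first by case: (E_inf 0 d0).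
  by move=> _ [l [M [M0 _ ->]]]; rewrite addr_ge0 ?lweight_ge0// divr_ge0// ltW.
apply/eqP; rewrite eq_le gaugeZ_le//=.
have cV0 : c^-1 != 0 by rewrite invr_eq0.
have := gaugeZ_le (c *: y) d0 cV0; rewrite scalerA mulVf// scale1r.
have cp : 0 < cabs c.
  by rewrite lt0r cabs_ge0 andbT; apply: contra c0 => /eqP /cabs_eq0 ->.
rewrite -(ler_pM2l cp) mulrA -cabsM mulfV//.
by rewrite cabs1 mul1r.
Qed.

Let gaugeD d y z : 0 < d -> gauge d (y + z) <= gauge d y + gauge d z.
Proof.
move=> d0; rewrite -lerBlDr; apply: lb_le_inf; first by case: (E_inf y d0).
move=> _ [l [M [M0 hM ->]]]; rewrite lerBlDr -lerBlDl.
apply: lb_le_inf; first by case: (E_inf z d0).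
move=> _ [m [N [N0 hN ->]]]; rewrite lerBlDl; apply: gauge_le => //.
exists (l ++ m), (M + N); split; first exact: addr_ge0.
  move=> a; have := dual_linear (to_dual a) 1 y z; rewrite scale1r mul1r => ->.
  rewrite /lfun big_cat /= -!/(lfun _ _) opprD addrACA mulrDl.
  by apply: le_trans (cabsD _ _) _; rewrite lerD.
by rewrite /lweight big_cat /= mulrDl addrACA.
Qed.

(* If the gauge of x exceeded 2c, a Hahn-Banach functional, i.e. an element of
   A, would separate x from the functionals implemented by finite lists. *)
Lemma list_approx x (c d : R) : 0 <= c -> 0 < d ->
  (forall a, cabs (to_dual a x) <= c * norm1 a) ->
  exists l, lweight l <= 2 * c + d /\
    forall a, cabs (to_dual a x - lfun l (f a)) <= d * norm1 a.
Proof.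
move=> c0 d0 xc; have cd0 : 0 < 2 * c + d by lra.
(* With this [e], a total cost below [2 * c + d] leaves an error of at most [e * (2 * c + d)], which
   is [d]. *)
have e0 : 0 < d / (2 * c + d) by rewrite divr_gt0.
set e := d / _ in e0.
have [F [Fl Fle Fx]] := @hahn_banach R (predual A) (gauge e) x
  (fun y z => gaugeD y z e0) (fun c y => gaugeZ y c e0).
have gl y : gauge e y <= e^-1 * norm1 y.
  apply: gauge_le => //; exists [::], (norm1 y); split.
  - exact: op_norm1_ge0.
  - by move=> a; rewrite /lfun big_nil subr0 mulrC to_dual_le.
  - by rewrite /lweight big_nil add0r mulrC.
have [g gF] := mk_dual Fl (fun y => le_trans (Fle y) (gl y)).
have [h _ hK] := @to_dual_bij R A.
pose a0 := h g; have a0F y : to_dual a0 y = F y by rewrite /a0 hK gF.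
have la0 l : cabs (lfun l (f a0)) <= lweight l.
  have [y hy] := wfun_list l; rewrite hy a0F; apply: le_trans (Fle _) _.
  apply: gauge_le => //; exists l, 0; split=> // [a|]; last by rewrite mul0r addr0.
  by rewrite hy subrr cabs0 mul0r.
have a02 : norm1 a0 <= 2.
  rewrite -(norm1_isometry a0 fci); apply: norm1_bop_le => // xi.
  set eta := f a0 xi; set s := rnorm xi; set t := rnorm eta.
  have [t0|t0] := eqVneq t 0; first by rewrite t0 mulr_ge0// rnorm_ge0.
  have tp : 0 < t by rewrite lt0r t0 rnorm_ge0.
  have [s0|s0] := eqVneq s 0.
    move: t0; rewrite /t /eta (rnorm_eq0 s0) linear0 rnorm0 => /eqP.
    by [].
  have sp : 0 < s by rewrite lt0r s0 rnorm_ge0.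
  have st0 : 0 <= s / t by rewrite divr_ge0// rnorm_ge0.
  (* Rescaling [eta] to the norm of [xi] balances the two squares in the weight, which becomes
     [2 * s ^+ 2]; this is the source of the factor 2 in the conclusion. *)
  have := la0 [:: (xi, (s / t)%:C%C *: eta)].
  rewrite /lfun /lweight !big_cons !big_nil !addr0 /= hdotZr conjc_real.
  rewrite rnormZ cabsM hdotxxE !cabs_real -/s -/t !ger0_norm ?sqr_ge0 ?st0//.
  rewrite [s / t * t]mulfVK// [t ^+ 2]expr2 mulrA [s / t * t]mulfVK// => st.
  by rewrite -(ler_pM2l sp); apply: le_trans st _; rewrite expr2; lra.
have gx : gauge e x <= 2 * c.
  rewrite -Fx; apply: le_trans (Re_le_cabs _) _; rewrite -a0F.
  by apply: le_trans (xc a0) _; rewrite mulrC ler_wpM2r.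
have [r [l [M [M0 hM ->]]] hr] := inf_adherent d0 (E_inf x e0).
have {}hr : lweight l + M / e < 2 * c + d by apply: lt_le_trans hr _; rewrite lerD2r.
have lw0 := lweight_ge0 l.
have Me0 : 0 <= M / e by rewrite divr_ge0// ltW.
exists l; split; first lra.
move=> a; apply: le_trans (hM a) _; rewrite ler_wpM2r ?alg_norm1_ge0//.
have : M / e <= 2 * c + d by lra.
by rewrite ler_pdivrMr// /e mulrC mulfVK// gt_eqF.
Qed.

Definition wapprox (F : A -> R[i]) := forall e : R, 0 < e ->
  exists x, forall a, cabs (F a - to_dual a x) <= e * norm1 a.

Lemma wfun_wapprox F : wfun F -> wapprox F.
Proof.
by move=> [x hx] e e0; exists x => a; rewrite hx subrr cabs0 mulr_ge0 ?alg_norm1_ge0// ltW.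
Qed.

(** A predual element within [c / 8] of [F] is bounded by [9 / 8 * c], so [list_approx] gives it a
    list of weight at most [2 * (9 / 8 * c) + c / 8], below [3 * c]; the two errors of [c / 8] stay
    below [c / 2]. The remainder is again a norm limit of predual functionals, so the step can be
    iterated. *)
Let approx_step (F : A -> R[i]) (c : R) : 0 < c -> wapprox F ->
  (forall a, cabs (F a) <= c * norm1 a) -> exists l, [/\ lweight l <= 3 * c,
    wapprox (fun a => F a - lfun l (f a)) &
    forall a, cabs (F a - lfun l (f a)) <= c / 2 * norm1 a].
Proof.
move=> c0 Fw Fc; have c8 : 0 < c / 8 by lra.
have [x hx] := Fw _ c8.
have [|||l [lw hl]] := @list_approx x (9 / 8 * c) (c / 8); rewrite //.
- lra.
- move=> a; rewrite (_ : to_dual a x = F a + - (F a - to_dual a x)); last by ring.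
  apply: le_trans (cabsD _ _) _; rewrite cabsN.
  rewrite (_ : 9 / 8 * c = c + c / 8); last by field.
  by rewrite mulrDl lerD.
exists l; split; first by apply: le_trans lw _; lra.
  move=> e e0; have [y hy] := Fw _ e0; have [z hz] := wfun_list l.
  exists (- 1 *: z + y) => a; rewrite dual_linear -hz.
  by rewrite (_ : _ - _ = F a - to_dual a y) ?hy//; ring.
move=> a.
rewrite (_ : _ - _ = (F a - to_dual a x) + (to_dual a x - lfun l (f a))); last by ring.
apply: le_trans (cabsD _ _) _; apply: (@le_trans _ _ (c / 8 * norm1 a + c / 8 * norm1 a)).
  exact: lerD.
have := alg_norm1_ge0 a => n0; rewrite -mulrDl ler_wpM2r//; lra.
Qed.

(** Iterating [approx_step] halves the remainder each time, and the weights [3 * c / 2 ^+ n] add up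
    to [6 * c], so the lists concatenate to a normal functional. Its bound is stated for every
    operator [T] because [rep_range_closed] evaluates it at an operator not yet known to lie in the
    range. *)
Lemma normal_lift F (c : R) : 0 < c -> wapprox F ->
  (forall a, cabs (F a) <= c * norm1 a) ->
  exists p, (forall a, F a = normal_fun (f a) p) /\
    (forall (T : bop K K) (C : R), 0 <= C -> (forall z, rnorm (T z) <= C * rnorm z) ->
      cabs (normal_fun T p) <= 6 * c * C).
Proof.
move=> c0 Fw Fc.
pose good c (G : A -> R[i]) l := [/\ lweight l <= 3 * c,
    wapprox (fun a => G a - lfun l (f a)) &
    forall a, cabs (G a - lfun l (f a)) <= c / 2 * norm1 a].
pose pick c G := xget [::] (good c G).
pose cn n := c / 2 ^+ n.
pose fix G n := if n is n'.+1 then fun a => G n' a - lfun (pick (cn n') (G n')) (f a) else F.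
pose l n := pick (cn n) (G n).
have cn0 n : 0 < cn n by rewrite divr_gt0// exprn_gt0.
have cnS n : cn n.+1 = cn n / 2 by rewrite /cn exprSr invfM mulrA.
have goodP n : [/\ wapprox (G n) & forall a, cabs (G n a) <= cn n * norm1 a].
  elim: n => [|n [Gw Gc]]; first by rewrite /cn expr0 divr1.
  have ex := approx_step (cn0 n) Gw Gc.
  have : good (cn n) (G n) (pick (cn n) (G n)).
    by rewrite /pick; case: xgetP => // hn; case: ex => l' /hn.
  by move=> [_ h1 h2]; rewrite cnS; split.
have lw n : lweight (l n) <= 3 * cn n.
  have [Gw Gc] := goodP n; have ex := approx_step (cn0 n) Gw Gc.
  have : good (cn n) (G n) (pick (cn n) (G n)).
    by rewrite /pick; case: xgetP => // hn; case: ex => l' /hn.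
  by case.
have GE n a : F a = G n a + \sum_(0 <= k < n) lfun (l k) (f a).
  elim: n => [|n IH]; first by rewrite big_geq// addr0.
  by rewrite big_nat_recr//= IH /l; ring.
have lM n : \sum_(0 <= k < n) lweight (l k) <= 6 * c.
  suff : \sum_(0 <= k < n) lweight (l k) <= 6 * (c - cn n) by have := cn0 n; lra.
  elim: n => [|n IH]; first by rewrite big_geq// /cn expr0; lra.
  rewrite big_nat_recr//=; have := lw n; rewrite cnS; lra.
have [p hp] := normal_of_blocks lM; exists p; split=> [a|T C C0 TC].
  apply/subr0_eq/cabs_eq0/eqP; rewrite eq_le cabs_ge0 andbT.
  apply/ler_addgt0Pr => e e0; rewrite add0r.
  have e2 : 0 < e / 2 by lra.
  have [N hN] := hp (f a) _ e2.
  have [|M hM] := @invSn_lt R (e / 2 / (c * norm1 a + 1)).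
    rewrite divr_gt0//; have : 0 <= c * norm1 a by rewrite mulr_ge0 ?alg_norm1_ge0// ltW.
    lra.
  have := hN (maxn N M) (leq_maxl _ _); rewrite (GE (maxn N M) a).
  set S := \sum_(_ <= _ < _) _ => h1.
  rewrite (_ : _ - _ = G (maxn N M) a + - (normal_fun (f a) p - S)); last by ring.
  apply: le_trans (cabsD _ _) _; rewrite cabsN [e]splitr; apply: lerD; last exact: ltW.
  apply: le_trans ((goodP _).2 a) _; set m := maxn N M.
  have cna : 0 < c * norm1 a + 1.
    by rewrite ltr_pwDr// mulr_ge0 ?alg_norm1_ge0// ltW.
  have := hM m (leq_maxr _ _); rewrite ltr_pdivlMr// => h2.
  apply: le_trans (ltW h2).
  have -> : cn m * norm1 a = (2 ^+ m)^-1 * (c * norm1 a) by rewrite /cn; ring.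
  apply: (@le_trans _ _ (m.+1%:R^-1 * (c * norm1 a))); last first.
    by rewrite ler_wpM2l ?invr_ge0// lerDl.
  have n0 : 0 <= c * norm1 a by rewrite mulr_ge0 ?alg_norm1_ge0// ltW.
  rewrite ler_wpM2r// lef_pV2 ?posrE ?ltr0n ?exprn_gt0//.
  by rewrite -natrX ler_nat ltn_expl.
apply/ler_addgt0Pr => e e0; have [N hN] := hp T e e0.
have := hN N (leqnn _); set S := \sum_(_ <= _ < _) _ => h1.
have h2 : cabs S <= 6 * c * C.
  apply: le_trans (cabs_sum _ _ _) _.
  apply: (@le_trans _ _ (\sum_(0 <= k < N) C * lweight (l k))).
    by apply: ler_sum => k _; exact: lfun_le.
  by rewrite -mulr_sumr mulrC ler_wpM2r.
rewrite (_ : normal_fun T p = S + (normal_fun T p - S)); last by ring.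
apply: le_trans (cabsD _ _) _; lra.
Qed.

(** No completeness of the predual is invoked: the norm limit is rebuilt as a normal functional of
    [f a], and such functionals come from the predual because [f] is w*-continuous. *)
Lemma wapprox_wfun F (c : R) : 0 < c -> wapprox F ->
  (forall a, cabs (F a) <= c * norm1 a) -> wfun F.
Proof.
move=> c0 Fw Fc; have [p [hp _]] := normal_lift c0 Fw Fc.
by have [x hx] := fn p; exists x => a; rewrite hp hx.
Qed.

Lemma predual_lift x (e : R) : 0 < e -> exists p,
  (forall a, to_dual a x = normal_fun (f a) p) /\
    (forall (T : bop K K) (C : R), 0 <= C -> (forall z, rnorm (T z) <= C * rnorm z) ->
      cabs (normal_fun T p) <= 6 * (norm1 x + e) * C).
Proof.
move=> e0; have x0 := op_norm1_ge0 x.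
apply: normal_lift; first lra.
  by apply: wfun_wapprox; exists x.
move=> a; apply: le_trans (to_dual_le a x) _.
by rewrite mulrC ler_wpM2r ?alg_norm1_ge0//; lra.
Qed.

(** The inverse of [f] is w*-continuous on the range, because every predual element lifts to a
    normal functional. *)
Lemma rep_closure (S : set A) b :
  closure (f @` S : set (bop_wstar K K)) (f b) -> closure (S : set (wstar A)) b.
Proof.
move=> Sb; apply: init_closureP => n x e e0.
have hx k : exists p, forall a, to_dual a (x k) = normal_fun (f a) p.
  by have [p [hp _]] := predual_lift (x k) ltr01; exists p.
pose p k := sval (cid (hx k)).
have hp k a : to_dual a (x k) = normal_fun (f a) (p k) by rewrite /p; case: cid.
have [_ [a Sa <-] ha] := wstar_closure p Sb e0.
by exists a => // k; rewrite /to_dual_fun !hp.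
Qed.

Lemma rep_range_closed : wclosed (range f).
Proof.
suff h T : closure (range f : set (bop_wstar K K)) T -> range f T.
  rewrite /wclosed closure_id; apply/seteqP; split; first exact: subset_closure.
  by move=> T /h.
move=> fT.
(* [T] inherits every linear relation between normal functionals that holds on the range. Hence the
   value of [T] at a lift of [x] depends on [x] only ([Fany]) and is linear in it ([Fl]). *)
have vanish n (p : 'I_n -> sqsum K * sqsum K) (c : 'I_n -> R[i]) :
    (forall a, \sum_i c i * normal_fun (f a) (p i) = 0) ->
    \sum_i c i * normal_fun T (p i) = 0.
  move=> h; apply/cabs_eq0/eqP; rewrite eq_le cabs_ge0 andbT.
  apply/ler_addgt0Pr => e e0; rewrite add0r.
  have s0 : 0 < \sum_i cabs (c i) + 1.
    by rewrite ltr_wpDl// sumr_ge0// => i _; exact: cabs_ge0.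
  have e' : 0 < e / (\sum_i cabs (c i) + 1) by rewrite divr_gt0.
  have [_ [a _ <-] ha] := wstar_closure p fT e'.
  have -> : \sum_i c i * normal_fun T (p i) =
      \sum_i c i * (normal_fun T (p i) - normal_fun (f a) (p i)).
    by under [RHS]eq_bigr do rewrite mulrBr; rewrite sumrB h subr0.
  apply: le_trans (cabs_sum _ _ _) _; under eq_bigr do rewrite cabsM cabsB.
  apply: (@le_trans _ _ (\sum_i cabs (c i) * (e / (\sum_i cabs (c i) + 1)))).
    by apply: ler_sum => i _; rewrite ler_wpM2l ?cabs_ge0// ltW.
  rewrite -mulr_suml mulrCA ger_pMr// ler_pdivrMr// mul1r lerDl//.
have lift x : exists p, forall a, to_dual a x = normal_fun (f a) p.
  by have [p [hp _]] := predual_lift x ltr01; exists p.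
pose pr x := sval (cid (lift x)).
have prE x a : to_dual a x = normal_fun (f a) (pr x) by rewrite /pr; case: cid.
pose F x := normal_fun T (pr x).
have Fany x p : (forall a, to_dual a x = normal_fun (f a) p) -> F x = normal_fun T p.
  move=> hp; apply/subr0_eq.
  have := vanish 2%N (fun i => if i == ord0 then pr x else p) (fun i => if i == ord0 then 1 else -1).
  by rewrite !big_ord_recl !big_ord0 /= !mul1r !mulN1r !addr0; apply=> a;
    rewrite !big_ord_recl !big_ord0 /= !mul1r !mulN1r !addr0 -prE -hp subrr.
have Fl c x y : F (c *: x + y) = c * F x + F y.
  apply/subr0_eq.
  have := vanish 3%N (fun i => nth (pr y) [:: pr (c *: x + y); pr x] i) (fun i => nth (-1) [:: 1; - c] i).
  rewrite !big_ord_recl !big_ord0 /= !mul1r !mulN1r !addr0 mulNr -opprD; apply=> a.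
  rewrite !big_ord_recl !big_ord0 /= !mul1r !mulN1r !addr0 mulNr -opprD -!prE.
  by rewrite dual_linear subrr.
have [C C0 TC] := bop_bound T.
have Fb x : cabs (F x) <= 6 * C * norm1 x.
  apply/ler_addgt0Pr => e e0.
  have C1 : 0 < 6 * C + 1 by lra.
  have [|p [hp pC]] := @predual_lift x (e / (6 * C + 1)); first by rewrite divr_gt0.
  rewrite (Fany _ _ hp); apply: le_trans (pC _ _ C0 TC) _.
  rewrite mulrDr mulrDl mulrAC lerD2l mulrAC mulrCA ger_pMr// ler_pdivrMr//; lra.
have [g gF] := mk_dual Fl Fb.
have [h _ hK] := @to_dual_bij R A.
exists (h g) => //; apply: bop_inj => z; apply: hdot_inj => w.
have [p hp] := normal_of_list [:: (z, w)].
have [x hx] := fn p.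
have := hp (f (h g)); have := hp T.
rewrite /lfun !big_cons !big_nil !addr0 /= => <- <-.
by rewrite hx hK gF; apply: Fany => a; rewrite hx.
Qed.

End Representation.
End WstarFunctionals.

(** * Hilbert space completion *)

(* The completion of a pre-Hilbert space P is realised as the space of bounded
   conjugate-linear functionals on P; by [happrox] these are uniform limits of
   functionals [pdot w]. *)
Section Completion.
Context {R : realType} (P : preHilbert R).
Implicit Types (x y : P).
Local Notation Re := (@complex.Re R).

Definition is_pdual : pred (P -> R[i]) := fun f =>
  `[< [/\ forall x y, f (padd x y) = f x + f y,
          forall a x, f (pscal a x) = (a^*)%C * f x &
          exists2 M : R, 0 <= M & forall x, cabs (f x) <= M * pnorm x] >].

Record hcompl := HCompl { hc_fun :> P -> R[i]^o; hc_subproof : is_pdual hc_fun }.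

HB.instance Definition _ := [isSub of hcompl for hc_fun].
HB.instance Definition _ := [Choice of hcompl by <:].

Lemma is_pdual_submod_closed : submod_closed (is_pdual : pred (P -> R[i]^o)).
Proof.
split.
  apply/asboolP; split=> [x y|a x|] /=; rewrite ?addr0 ?mulr0//.
  by exists 0 => // x; rewrite cabs0 mul0r.
move=> a f g /asboolP[fD fZ [M M0 fM]] /asboolP[gD gZ [N N0 gN]].
apply/asboolP; split=> [x y|b x|].
- change (a * f (padd x y) + g (padd x y) = a * f x + g x + (a * f y + g y)).
  by rewrite fD gD mulrDr addrACA.
- change (a * f (pscal b x) + g (pscal b x) = (b^*)%C * (a * f x + g x)).
  by rewrite fZ gZ mulrDr mulrCA.
exists (cabs a * M + N) => [|x]; first by rewrite addr_ge0// mulr_ge0// cabs_ge0.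
change (cabs (a * f x + g x) <= (cabs a * M + N) * pnorm x).
apply: le_trans (cabsD _ _) _; rewrite mulrDl lerD// cabsM -mulrA.
by rewrite ler_wpM2l ?cabs_ge0.
Qed.

HB.instance Definition _ :=
  GRing.isSubmodClosed.Build _ _ _ is_pdual_submod_closed.
HB.instance Definition _ :=
  GRing.SubChoice_isSubLmodule.Build _ _ is_pdual hcompl
    (GRing.submod_closed_semi is_pdual_submod_closed).

Implicit Types f g h : hcompl.

Lemma hcD f x y : f (padd x y) = f x + f y.
Proof. by have /asboolP[] := hc_subproof f. Qed.

Lemma hcZ f a x : f (pscal a x) = (a^*)%C * f x.
Proof. by have /asboolP[] := hc_subproof f. Qed.

Lemma hcB f x y : f (psub x y) = f x - f y.
Proof. by rewrite hcD hcZ rmorphN1 mulN1r. Qed.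

Lemma hc_bound f : exists2 M : R, 0 <= M & forall x, cabs (f x) <= M * pnorm x.
Proof. by have /asboolP[] := hc_subproof f. Qed.

Lemma hcompl_linE a f g x : (a *: f + g) x = a * f x + g x.
Proof. by []. Qed.

Lemma hcompl_eq f g : (forall x, f x = g x) -> f = g.
Proof. by move=> h; apply/val_inj/funext. Qed.

Lemma happrox_ex f n : exists w, forall x,
  cabs (f x - pdot w x) <= n.+1%:R^-1 * pnorm x.
Proof.
have [M M0 fM] := hc_bound f.
have [|||||||w _ hw] := @riesz_approx R P setT (fun x => (f x)^*%C) M n.+1%:R^-1.
- by exists (pzero P).
- by [].
- by [].
- by move=> x y _ _; rewrite hcD rmorphD.
- by move=> a x _; rewrite hcZ rmorphM /= conjcK.
- by move=> x _; rewrite cabs_conj.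
- by rewrite invr_gt0.
exists w => x; have := hw x I.
by rewrite -cabs_conj rmorphB /= conjcK -pdotC.
Qed.

Definition happ f n : P := sval (cid (happrox_ex f n)).

Lemma happrox f n x : cabs (f x - pdot (happ f n) x) <= n.+1%:R^-1 * pnorm x.
Proof. by rewrite /happ; case: cid => w /=. Qed.

Lemma pnorm_le_of_dot x (c : R) : cabs (pdot x x) <= c * pnorm x -> 0 <= c ->
  pnorm x <= c.
Proof.
rewrite pdotxx cabs_real ger0_norm ?sqr_ge0// => h c0.
have [->//|x0] := eqVneq (pnorm x) 0.
have xp : 0 < pnorm x by rewrite lt0r x0 pnorm_ge0.
by move: h; rewrite expr2 ler_pM2r.
Qed.

Lemma happ_cauchy f m n :
  pnorm (psub (happ f m) (happ f n)) <= m.+1%:R^-1 + n.+1%:R^-1.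
Proof.
apply: pnorm_le_of_dot; last by rewrite addr_ge0// invr_ge0.
rewrite pdotBl; set d := psub _ _.
rewrite (_ : _ - _ = - (f d - pdot (happ f m) d) + (f d - pdot (happ f n) d)); last by ring.
apply: le_trans (cabsD _ _) _; rewrite cabsN mulrDl.
by apply: lerD; exact: happrox.
Qed.

Lemma happ_bounded f : exists2 B : R, 0 <= B & forall n, pnorm (happ f n) <= B.
Proof.
have [M M0 fM] := hc_bound f; exists (M + 1) => [|n]; first by rewrite addr_ge0.
apply: pnorm_le_of_dot; last by rewrite addr_ge0.
rewrite (_ : pdot _ _ = f (happ f n) + - (f (happ f n) - pdot (happ f n) (happ f n)));
  last by ring.
apply: le_trans (cabsD _ _) _; rewrite cabsN mulrDl lerD//.
apply: le_trans (happrox _ _ _) _; rewrite ler_wpM2r ?pnorm_ge0//.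
by rewrite invf_le1// ler1n.
Qed.

Lemma invSn_le (M e : R) : 0 <= M -> 0 < e ->
  exists N, forall n, (N <= n)%N -> M * n.+1%:R^-1 < e.
Proof.
move=> M0 e0; have M1 : 0 < M + 1 by lra.
have [|N hN] := @invSn_lt R (e / (M + 1)); first by rewrite divr_gt0.
exists N => n /hN; rewrite ltr_pdivlMr// mulrDr mulr1 mulrC => h.
apply: le_lt_trans h; rewrite lerDl invr_ge0//.
Qed.

Lemma hc_dot_cvg f g : exists l : R[i], (fun n => f (happ g n)) @ \oo --> (l : R[i]^o).
Proof.
have [M M0 fM] := hc_bound f; apply: cabs_cauchy_cvg => e e0.
have e2 : 0 < e / 2 by lra.
have [N hN] := invSn_le M0 e2; exists N => m n Nm Nn.
rewrite -hcB; apply: le_lt_trans (fM _) _.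
apply: le_lt_trans (ler_wpM2l M0 (happ_cauchy g m n)) _.
by rewrite mulrDr [ltRHS]splitr ltrD// hN.
Qed.

Definition hc_dot f g : R[i] := sval (cid (hc_dot_cvg f g)).

Lemma hc_dotP f g : (fun n => f (happ g n)) @ \oo --> (hc_dot f g : R[i]^o).
Proof. by rewrite /hc_dot; case: cid. Qed.

(** [hc_dot] is defined asymmetrically, by evaluating one functional along approximants of the
    other. In this symmetric form, Hermitian symmetry and positivity pass to the limit from
    [pdot]. *)
Lemma hc_dot_cvg2 f g :
  (fun n => pdot (happ f n) (happ g n) : R[i]^o) @ \oo --> (hc_dot f g : R[i]^o).
Proof.
have [B B0 gB] := happ_bounded g.
apply/rnorm_cvgP => e e0; have e2 : 0 < e / 2 by lra.
have /rnorm_cvgP/(_ _ e2)[N hN] := @hc_dotP f g.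
have [N' hN'] := invSn_le B0 e2.
exists (maxn N N') => n; rewrite geq_max => /andP[/hN + /hN'].
rewrite !rnorm_cabs => h1 h2.
rewrite (_ : _ - _ = (f (happ g n) - hc_dot f g) +
  - (f (happ g n) - pdot (happ f n) (happ g n))); last by ring.
apply: le_lt_trans (cabsD _ _) _; rewrite [ltRHS]splitr cabsN.
apply: ltr_leD => //; apply: le_trans (happrox _ _ _) _; apply: le_trans (ltW h2).
by rewrite mulrC ler_wpM2r ?invr_ge0.
Qed.

Lemma hc_dotC f g : hc_dot f g = ((hc_dot g f)^*)%C.
Proof.
apply: (rnorm_cvg_unique (@hc_dot_cvg2 f g)); apply/rnorm_cvgP => e e0.
have /rnorm_cvgP/(_ _ e0)[N hN] := @hc_dot_cvg2 g f.
by exists N => n /hN; rewrite !rnorm_cabs [pdot (happ f n) _]pdotC -rmorphB cabs_conj.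
Qed.

Lemma hc_dotPl a f f' g : hc_dot (a *: f + f') g = a * hc_dot f g + hc_dot f' g.
Proof.
apply: (rnorm_cvg_unique (@hc_dotP _ g)).
exact: cvgD (cvgZl_tmp (@hc_dotP f g)) (@hc_dotP f' g).
Qed.

Lemma hc_dotDl f f' g : hc_dot (f + f') g = hc_dot f g + hc_dot f' g.
Proof. by have := hc_dotPl 1 f f' g; rewrite scale1r mul1r. Qed.

Lemma hc_dot0l g : hc_dot 0 g = 0.
Proof. by have /eqP := hc_dotDl 0 0 g; rewrite addr0 -subr_eq subrr => /eqP. Qed.

Lemma hc_dotZl a f g : hc_dot (a *: f) g = a * hc_dot f g.
Proof. by have := hc_dotPl a f 0 g; rewrite hc_dot0l !addr0. Qed.

Lemma hc_dot_ge0 f : 0 <= hc_dot f f.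
Proof.
have /rnorm_cvgP fc := @hc_dot_cvg2 f f.
set l := hc_dot f f in fc *.
have h e : 0 < e -> `|complex.Im l| < e /\ - e < Re l.
  move=> /fc[N /(_ N (leqnn _))]; rewrite rnorm_cabs pdotxx => hl; split.
    apply: le_lt_trans hl; apply: le_trans (Im_le_cabs _).
    by rewrite ImD ImN /= add0r normrN.
  have := le_lt_trans (Re_le_cabs _) hl; rewrite ReB /=.
  have := sqr_ge0 (pnorm (happ f N)); lra.
rewrite lecE /=; apply/andP; split.
  rewrite -normr_le0; apply/ler_addgt0Pr => e /h[+ _]; rewrite add0r; exact: ltW.
rewrite -oppr_le0; apply/ler_addgt0Pr => e /h[_]; rewrite add0r; lra.
Qed.

Definition hcompl_pre : preHilbert R :=
  @PreHilbert R hcompl 0 +%R *:%R hc_dot hc_dotDl hc_dotZl hc_dotC hc_dot_ge0.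

Definition hc_norm f : R := pnorm (f : hcompl_pre).

Lemma happ_norm f (e : R) : 0 < e ->
  exists N, forall n, (N <= n)%N -> pnorm (happ f n) <= hc_norm f + e.
Proof.
move=> e0; have n0 : 0 <= hc_norm f := pnorm_ge0 _.
have e2 : 0 < e ^+ 2 by rewrite exprn_gt0.
have /rnorm_cvgP/(_ _ e2)[N hN] := @hc_dot_cvg2 f f.
exists N => n /hN; rewrite rnorm_cabs => h.
rewrite -(@ler_pXn2r _ 2%N)// ?nnegrE ?pnorm_ge0 ?addr_ge0// ?(ltW e0)//.
have := le_lt_trans (Re_le_cabs _) h.
rewrite ReB -pnorm_sqr.
have -> : Re (hc_dot f f) = hc_norm f ^+ 2 by rewrite /hc_norm pnorm_sqr.
have : 0 <= hc_norm f * e by rewrite mulr_ge0// ltW.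
rewrite sqrrD; lra.
Qed.

(** Together with [hc_norm_le] this identifies the norm coming from the inner product with the norm
    as a functional on [P]. *)
Lemma hc_le f x : cabs (f x) <= hc_norm f * pnorm x.
Proof.
apply/ler_addgt0Pr => e e0.
have x1 : 0 < pnorm x + 1 by have := pnorm_ge0 x; lra.
pose d := e / (2 * (pnorm x + 1)).
have d0 : 0 < d by rewrite divr_gt0// mulr_gt0.
have [N hN] := happ_norm f d0; have [M hM] := invSn_lt d0.
have := hN (maxn N M) (leq_maxl _ _); have := hM (maxn N M) (leq_maxr _ _).
set n := maxn N M => h1 h2.
rewrite (_ : f x = pdot (happ f n) x + (f x - pdot (happ f n) x)); last by ring.
apply: le_trans (cabsD _ _) _.
apply: (@le_trans _ _ ((hc_norm f + d) * pnorm x + d * pnorm x)).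
  apply: lerD.
    by apply: le_trans (pdot_CS _ _) _; rewrite ler_wpM2r// pnorm_ge0.
  by apply: le_trans (happrox _ _ _) _; rewrite ler_wpM2r ?pnorm_ge0// ltW.
rewrite mulrDl -addrA lerD2l -mulrDl -mulr2n -mulr_natl.
have -> : e = 2 * d * (pnorm x + 1) by rewrite /d; field; rewrite gt_eqF.
by apply: ler_wpM2l; [rewrite mulr_ge0// ltW | lra].
Qed.

Lemma hc_norm_le f (C : R) : 0 <= C -> (forall x, cabs (f x) <= C * pnorm x) ->
  hc_norm f <= C.
Proof.
move=> C0 fC; have n0 : 0 <= hc_norm f := pnorm_ge0 _.
suff h : hc_norm f ^+ 2 <= C * hc_norm f.
  have [->//|f0] := eqVneq (hc_norm f) 0.
  have fp : 0 < hc_norm f by rewrite lt0r f0.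
  by move: h; rewrite expr2 ler_pM2r.
apply/ler_addgt0Pr => e e0; have C1 : 0 < C + 1 by lra.
pose d := e / (C + 1).
have d0 : 0 < d by rewrite divr_gt0.
have [N hN] := happ_norm f d0.
have /rnorm_cvgP/(_ _ d0)[M hM] := @hc_dotP f f.
have := hN (maxn N M) (leq_maxl _ _); have := hM (maxn N M) (leq_maxr _ _).
set n := maxn N M; rewrite rnorm_cabs => h1 h2.
have -> : hc_norm f ^+ 2 = cabs (hc_dot f f).
  rewrite -[hc_dot f f]/(@pdot R hcompl_pre f f) pdotxx cabs_real.
  by rewrite ger0_norm ?sqr_ge0.
rewrite (_ : hc_dot f f = f (happ f n) + - (f (happ f n) - hc_dot f f)); last by ring.
apply: le_trans (cabsD _ _) _; rewrite cabsN.
have -> : e = C * d + d by rewrite /d; field; rewrite gt_eqF.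
rewrite addrA; apply: lerD; last exact: ltW.
by apply: le_trans (fC _) _; rewrite -mulrDr ler_wpM2l.
Qed.

Let norm_of f : R[i] := (hc_norm f)%:C%C.

Lemma hc_normD f g : norm_of (f + g) <= norm_of f + norm_of g.
Proof. by rewrite -rmorphD lecR; exact: (@pnormD R hcompl_pre). Qed.

Lemma hc_normZ (a : R[i]) f : norm_of (a *: f) = `|a| * norm_of f.
Proof. by rewrite -cabsE -rmorphM; congr _%:C%C; exact: (@pnormZ R hcompl_pre). Qed.

Lemma hc_norm0_eq0 f : norm_of f = 0 -> f = 0.
Proof.
move=> [f0]; apply: hcompl_eq => x; apply: cabs_eq0; apply/eqP.
by rewrite eq_le cabs_ge0 andbT; have := hc_le f x; rewrite f0 mul0r.
Qed.

HB.instance Definition _ := Lmodule_isNormed.Build R[i] hcompl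
  hc_normD hc_normZ hc_norm0_eq0.

Lemma rnorm_hcompl f : rnorm f = hc_norm f.
Proof. by []. Qed.

(** A Cauchy filter yields a sequence [g] of functionals converging uniformly on bounded sets of
    [P]. The pointwise limit is again bounded and conjugate linear, and the filter converges to
    it. *)
Lemma hcompl_complete (F : set_system hcompl) :
  ProperFilter F -> cauchy F -> cvg F.
Proof.
move=> FF /cauchyP Fc.
have Fn n : exists g : hcompl, F [set f | rnorm (g - f) < n.+1%:R^-1].
  have [|g Fg] := Fc (n.+1%:R^-1)%:C%C; first by rewrite ltcR invr_gt0.
  exists g; apply: filterS Fg => f; rewrite -ball_normE /= -rnormE ltcR.
  by [].
pose g n := sval (cid (Fn n)).
have hg n : F [set f | rnorm (g n - f) < n.+1%:R^-1] by rewrite /g; case: cid.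
have gg m n : rnorm (g m - g n) <= m.+1%:R^-1 + n.+1%:R^-1.
  have [f [/= h1 h2]] := filter_ex (filterI (hg m) (hg n)).
  rewrite (_ : g m - g n = (g m - f) + (f - g n)); last by rewrite addrA subrK.
  apply: le_trans (rnormD _ _) _; rewrite [X in _ + X]rnormB.
  by apply: lerD; exact: ltW.
have gx m n x : cabs (g m x - g n x) <= (m.+1%:R^-1 + n.+1%:R^-1) * pnorm x.
  have -> : g m x - g n x = (g m - g n) x by [].
  by apply: le_trans (hc_le _ _) _; rewrite ler_wpM2r ?pnorm_ge0// -rnorm_hcompl.
have Lx x : exists l : R[i], (fun n => g n x) @ \oo --> (l : R[i]^o).
  apply: cabs_cauchy_cvg => e e0; have e2 : 0 < e / 2 by lra.
  have [N hN] := invSn_le (pnorm_ge0 x) e2; exists N => m n Nm Nn.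
  apply: le_lt_trans (gx m n x) _.
  by rewrite mulrC mulrDr [ltRHS]splitr ltrD// hN.
pose L x : R[i]^o := sval (cid (Lx x)).
have LP x : (fun n => g n x) @ \oo --> L x by rewrite /L; case: cid.
have Lg n x : cabs (g n x - L x) <= n.+1%:R^-1 * pnorm x.
  apply/ler_addgt0Pr => e e0; have e2 : 0 < e / 2 by lra.
  have [N hN] := invSn_le (pnorm_ge0 x) e2.
  have /rnorm_cvgP/(_ _ e2)[M hM] := LP x.
  have := hM (maxn N M) (leq_maxr _ _); have := hN (maxn N M) (leq_maxl _ _).
  set m := maxn N M; rewrite rnorm_cabs => h1 h2.
  rewrite (_ : _ - _ = (g n x - g m x) + (g m x - L x)); last by ring.
  apply: le_trans (cabsD _ _) _.
  have := gx n m x; rewrite mulrDl => h3; rewrite [m.+1%:R^-1 * _]mulrC in h3.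
  rewrite [e]splitr addrA; apply: lerD; last exact: ltW.
  by apply: le_trans h3 _; rewrite lerD2l ltW.
have Ld : is_pdual L.
  apply/asboolP; split=> [x y|a x|].
  - apply: (rnorm_cvg_unique (LP _)).
    rewrite (_ : (fun n => _) = (fun n => g n x + g n y)); last by apply/funext => n; rewrite hcD.
    exact: cvgD (LP x) (LP y).
  - apply: (rnorm_cvg_unique (LP _)).
    rewrite (_ : (fun n => _) = (fun n => (a^*)%C *: g n x)); last by apply/funext => n; rewrite hcZ.
    exact: cvgZl_tmp (LP x).
  exists (hc_norm (g 0%N) + 1) => [|x]; first by rewrite addr_ge0//; exact: pnorm_ge0.
  rewrite (_ : L x = g 0%N x + - (g 0%N x - L x)); last by ring.
  apply: le_trans (cabsD _ _) _; rewrite cabsN mulrDl lerD//; first exact: hc_le.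
  by have := Lg 0%N x; rewrite invr1.
pose Lh : hcompl := HCompl Ld.
have gL n : rnorm (g n - Lh) <= n.+1%:R^-1.
  rewrite rnorm_hcompl; apply: hc_norm_le => [|x]; first by rewrite invr_ge0.
  exact: Lg.
apply/cvg_ex; exists Lh; apply/cvg_ballP => e /gt0_complex[d d0 ->].
have d2 : 0 < d / 2 by lra.
have [N /(_ N (leqnn _)) hN] := invSn_lt d2.
apply: (@filterS _ F _ [set f | rnorm (g N - f) < N.+1%:R^-1]) (hg N) => f /= gf.
rewrite -ball_normE /= -rnormE ltcR.
rewrite (_ : Lh - f = (Lh - g N) + (g N - f)); last by rewrite addrA subrK.
apply: le_lt_trans (rnormD _ _) _; rewrite rnormB.
by move: (gL N) gf hN; move: (N.+1%:R^-1) => z; lra.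
Qed.

HB.instance Definition _ := Uniform_isComplete.Build hcompl hcompl_complete.

Lemma hc_dot_bilinear :
  bilinear_for ( *%R : R[i] -> R[i] -> R[i]) (Num.conj \; *%R) hc_dot.
Proof.
split=> [g a f f'|f a g g'] /=; first exact: hc_dotPl.
by rewrite hc_dotC hc_dotPl rmorphD rmorphM /= -!hc_dotC.
Qed.

HB.instance Definition _ :=
  bilinear_isBilinear.Build R[i] hcompl hcompl R[i] _ _ hc_dot hc_dot_bilinear.

Lemma hc_dot_herm f g : hc_dot f g = (-1) ^+ false * Num.conj (hc_dot g f).
Proof. by rewrite expr0 mul1r; exact: hc_dotC. Qed.

HB.instance Definition _ :=
  isHermitianSesquilinear.Build R[i] hcompl false Num.conj hc_dot hc_dot_herm.

Lemma hc_dotxx f : hc_dot f f = `|f| ^+ 2.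
Proof.
by rewrite -rnormE rnorm_hcompl -rmorphXn; exact: (@pdotxx R hcompl_pre f).
Qed.

Lemma hc_dot_gt0 f : f != 0 -> 0 < hc_dot f f.
Proof. by move=> f0; rewrite hc_dotxx exprn_gt0// normr_gt0. Qed.

HB.instance Definition _ := isDotProduct.Build R[i] hcompl hc_dot hc_dot_gt0.

HB.instance Definition _ := isHilbert.Build R hcompl hc_dotxx.

Lemma hinj_subproof x : is_pdual (pdot x).
Proof.
apply/asboolP; split=> [y z|a y|]; first exact: pdotDr.
  exact: pdotZr.
by exists (pnorm x) => [|y]; [exact: pnorm_ge0 | exact: pdot_CS].
Qed.

Definition hinj x : hcompl := HCompl (hinj_subproof x).

Lemma hinjE x y : hinj x y = pdot x y. Proof. by []. Qed.

Lemma hdot_hinj f x : hdot f (hinj x) = f x.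
Proof.
rewrite -[LHS]/(hc_dot f (hinj x)).
apply: (rnorm_cvg_unique (@hc_dotP f (hinj x))); apply/rnorm_cvgP => e e0.
have [M M0 fM] := hc_bound f; have [N hN] := invSn_le M0 e0.
exists N => n /hN; apply: le_lt_trans.
rewrite rnorm_cabs -hcB; apply: le_trans (fM _) _; rewrite ler_wpM2l//.
apply: pnorm_le_of_dot; last by rewrite invr_ge0.
rewrite pdotBl; set d := psub _ _.
by rewrite -[X in _ - X]hinjE cabsB; exact: happrox.
Qed.

Lemma hinj_dot x y : hdot (hinj x) (hinj y) = pdot x y.
Proof. by rewrite hdot_hinj. Qed.

Lemma rnorm_hinj x : rnorm (hinj x) = pnorm x.
Proof.
apply/eqP; rewrite -(@eqrXn2 _ 2%N)// ?rnorm_ge0 ?pnorm_ge0//.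
by rewrite rnorm_sqr hinj_dot pnorm_sqr.
Qed.

Lemma hinj_dense f (e : R) : 0 < e -> exists x, rnorm (f - hinj x) < e.
Proof.
move=> /invSn_lt[N /(_ N (leqnn _)) hN]; exists (happ f N).
apply: le_lt_trans hN; rewrite rnorm_hcompl.
apply: hc_norm_le => [|x]; first by rewrite invr_ge0.
exact: happrox.
Qed.

Lemma hinjD x y : hinj (padd x y) = hinj x + hinj y.
Proof. by apply: hcompl_eq => z; rewrite hinjE pdotDl. Qed.

End Completion.

Lemma sum_exchange3 (V : nmodType) I J T (r : seq I) (s : seq J) (t : seq T)
    (F : I -> J -> T -> V) :
  \sum_(a <- r) \sum_(b <- s) \sum_(i <- t) F a b i =
  \sum_(i <- t) \sum_(a <- r) \sum_(b <- s) F a b i.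
Proof.
by rewrite exchange_big /=; under eq_bigr do rewrite exchange_big /=;
  rewrite exchange_big /=; apply: eq_bigr => i _; rewrite exchange_big.
Qed.

Lemma sum_exchange4 (V : nmodType) I J T U (r : seq I) (s : seq J) (t : seq T)
    (u : seq U) (F : I -> J -> T -> U -> V) :
  \sum_(a <- r) \sum_(b <- s) \sum_(i <- t) \sum_(j <- u) F a b i j =
  \sum_(i <- t) \sum_(j <- u) \sum_(a <- r) \sum_(b <- s) F a b i j.
Proof.
rewrite (sum_exchange3 r s t (fun a b i => \sum_(j <- u) F a b i j)).
by apply: eq_bigr => i _; exact: sum_exchange3.
Qed.

(** * Positivity of operator matrices *)

Section Accretive.
Context {R : realType}.
Local Notation Re := (@complex.Re R).

Lemma sum_hdot_self (H : hilbertType R) (I : finType) (v : I -> H) :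
  \sum_i hdot (v i) (v i) = (l2norm v ^+ 2)%:C%C.
Proof.
rewrite l2norm_sqr (rmorph_sum (real_complex R)).
by apply: eq_bigr => i _; rewrite hdotxxE.
Qed.

Lemma l2normB_sqr (H : hilbertType R) (I : finType) (v w : I -> H) :
  l2norm (fun i => v i - w i) ^+ 2 =
  l2norm v ^+ 2 + l2norm w ^+ 2 - 2 * Re (\sum_i hdot (w i) (v i)).
Proof.
rewrite !l2norm_sqr Re_sum mulr_sumr -big_split -sumrB /=; apply: eq_bigr => i _.
rewrite !rnorm_sqr hdotBl !hdotBr !ReB (hdotC (v i) (w i)) ReJ; lra.
Qed.

Context (B : mxNormedType R) (K0 K1 : hilbertType R).
Variables (phi : {linear B -> bop K0 K0}) (psi : {linear B -> bop K1 K1}) (e : B).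
Hypotheses (phi_ci : complete_isometry phi) (psi_ci : complete_isometry psi).
Hypotheses (phi_e : phi e = bid K0) (psi_e : psi e = bid K1).

(* The accretivity of X is detected by the norms of 1 - s X for small s > 0,
   hence preserved by unital completely contractive maps. *)
Lemma accretive_transfer n (X : 'M[B]_n) :
  (forall v, 0 <= Re (\sum_i \sum_j hdot (phi (X i j) (v j)) (v i))) ->
  forall x, 0 <= Re (\sum_i \sum_j hdot (psi (X i j) (x j)) (x i)).
Proof.
move=> Xacc x; set Q := Re _; rewrite -oppr_le0.
set M := mxnorm (map_mx phi X).
apply: (@real_le0_of_eps _ _ (M ^+ 2 * l2norm x ^+ 2)) => s s0.
pose Y : 'M[B]_n := \matrix_(i, j) ((i == j)%:R *: e - s%:C%C *: X i j).
have sumY (H : hilbertType R) (th : {linear B -> bop H H}) (v : 'I_n -> H) i :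
    th e = bid H -> \sum_j map_mx th Y i j (v j) =
      v i - s%:C%C *: \sum_j map_mx th X i j (v j).
  move=> the; rewrite scaler_sumr -{1}[v i]/(bid H (v i)) -the.
  rewrite [X in X - _](_ : _ = \sum_j ((i == j)%:R : R[i]) *: th e (v j)); last first.
    rewrite (bigD1 i)//= eqxx scale1r big1 ?addr0// => j ij.
    by rewrite eq_sym (negbTE ij) scale0r.
  rewrite -sumrB; apply: eq_bigr => j _.
  by rewrite !mxE linearB !linearZ.
have M0 : 0 <= M by exact: mxnorm_bop_ge0.
(* Accretivity removes the term linear in [s], so the norm exceeds 1 by [s ^+ 2 * M ^+ 2] at most.
   On the side of [psi] this excess is divided by [s], which still leaves a factor [s]. *)
have Yle : mxnorm (map_mx phi Y) <= 1 + s ^+ 2 * M ^+ 2.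
  have t0 : 0 <= s ^+ 2 * M ^+ 2 by rewrite mulr_ge0 ?sqr_ge0.
  apply: mxnorm_le => [|v]; first by rewrite addr_ge0.
  rewrite -(@ler_pXn2r _ 2%N)// ?nnegrE ?mulr_ge0 ?l2norm_ge0 ?addr_ge0//.
  under [X in l2norm X]eq_fun do rewrite sumY//.
  rewrite l2normB_sqr l2normZ cabs_real ger0_norm ?(ltW s0)//.
  have -> : \sum_i hdot (s%:C%C *: \sum_j map_mx phi X i j (v j)) (v i) =
      s%:C%C * \sum_i \sum_j hdot (phi (X i j) (v j)) (v i).
    rewrite mulr_sumr; apply: eq_bigr => i _; rewrite hdotZl hdot_suml.
    by congr (_ * _); apply: eq_bigr => j _; rewrite mxE.
  rewrite ReZ.
  have := mulr_ge0 (ltW s0) (Xacc v).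
  have : (s * l2norm (fun i => \sum_j map_mx phi X i j (v j))) ^+ 2 <=
      s ^+ 2 * M ^+ 2 * l2norm v ^+ 2.
    rewrite exprMn -mulrA ler_wpM2l ?sqr_ge0// -exprMn.
    rewrite ler_pXn2r ?nnegrE ?mulr_ge0 ?l2norm_ge0//; exact: mxnorm_vec.
  have : 0 <= (s ^+ 2 * M ^+ 2 + (s ^+ 2 * M ^+ 2) ^+ 2) * l2norm v ^+ 2.
    by rewrite mulr_ge0 ?sqr_ge0// addr_ge0// sqr_ge0.
  rewrite [((1 + _) * _) ^+ 2]exprMn sqrrD expr1n; lra.
have : Re (\sum_i \sum_j hdot (map_mx psi Y i j (x j)) (x i)) <=
    (1 + s ^+ 2 * M ^+ 2) * l2norm x * l2norm x.
  apply: le_trans (Re_le_cabs _) (le_trans (mxnorm_dot _ _ _) _).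
  by rewrite !ler_wpM2r ?l2norm_ge0// psi_ci -phi_ci.
have -> : \sum_i \sum_j hdot (map_mx psi Y i j (x j)) (x i) =
    (l2norm x ^+ 2)%:C%C - s%:C%C * \sum_i \sum_j hdot (psi (X i j) (x j)) (x i).
  rewrite -sum_hdot_self mulr_sumr -sumrB; apply: eq_bigr => i _.
  rewrite -hdot_suml sumY// hdotBl hdotZl hdot_suml.
  by congr (_ - _ * _); apply: eq_bigr => j _; rewrite mxE.
rewrite ReB ReZ /= -/Q => h.
rewrite -(ler_pM2l s0); move: h; rewrite -mulrA -expr2; lra.
Qed.

Lemma accretive_transfer_fin (I : finType) (X : I -> I -> B) :
  (forall v, 0 <= Re (\sum_i \sum_j hdot (phi (X i j) (v j)) (v i))) ->
  forall x, 0 <= Re (\sum_i \sum_j hdot (psi (X i j) (x j)) (x i)).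
Proof.
move=> Xacc x.
have reix (V : nmodType) (F : I -> I -> V) : \sum_i \sum_j F i j =
    \sum_(k < #|I|) \sum_(l < #|I|) F (enum_val k) (enum_val l).
  rewrite (reindex _ (onW_bij _ (enum_val_bij I))) /=; apply: eq_bigr => k _.
  by rewrite (reindex _ (onW_bij _ (enum_val_bij I))).
rewrite reix.
have := @accretive_transfer #|I| (\matrix_(k, l) X (enum_val k) (enum_val l)) _
  (fun k => x (enum_val k)).
under eq_bigr do under eq_bigr do rewrite mxE.
apply=> v; have := Xacc (fun i => v (enum_rank i)); rewrite reix.
under eq_bigr do under eq_bigr do rewrite !enum_valK.
by under [in X in _ -> X]eq_bigr do under eq_bigr do rewrite mxE.
Qed.

(** * Sesquilinear forms given by kernels with values in an algebra *)

Section Kernel.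
Variables (C : mxNormedType R) (one : C) (S : Type) (s0 : S) (kc : S -> C -> S -> B).
Hypothesis kc0l : forall c m, kc s0 c m = 0.
Hypothesis kc0r : forall n c, kc n c s0 = 0.
Variables (L : hilbertType R) (op : S -> bop L K0) (G : {linear C -> bop L L}).
Hypothesis G1 : G one = bid L.
Hypothesis kcE : forall n c m, phi (kc n c m) = bcomp (op n) (bcomp (G c) (adj (op m))).

(** If [psi] were [phi], this would be the inner product of [G c], applied to the sum of the
    [adj (op t.1) t.2] over [l], with the same sum over [l']. The kernel carries it to [K1], where
    the operators [op] do not act. Both representations stay arbitrary because the estimates are
    applied once in each direction. *)
Definition kform (c : C) (l l' : seq (S * K1)) : R[i] :=
  \sum_(t <- l) \sum_(t' <- l') hdot (psi (kc t'.1 c t.1) t.2) t'.2.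

Lemma kform_catl c l1 l2 l' : kform c (l1 ++ l2) l' = kform c l1 l' + kform c l2 l'.
Proof. by rewrite /kform big_cat. Qed.

Lemma kform_scall c (a : R[i]) l l' :
  kform c [seq (t.1, a *: t.2) | t <- l] l' = a * kform c l l'.
Proof.
rewrite /kform big_map mulr_sumr; apply: eq_bigr => t _.
rewrite mulr_sumr; apply: eq_bigr => t' _ /=.
by rewrite bop_scal hdotZl.
Qed.

(** One entry of a matrix over [B] obtained by sandwiching the block matrix with rows (1, 2 mu c)
    and (0, 1) between the operators of [r], [r'] and the adjoints of those of [p], [p']. The real
    part of the block matrix is positive once [mu] times the norm of [c] is at most 1. *)
Let quad m (mu : R) (c : 'M[C]_m) (r r' : 'I_m -> S) (p p' : 'I_m -> S) : B :=
  (\sum_i kc (r i) one (p i) + \sum_j kc (r' j) one (p' j)) +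
  (2 * mu)%:C%C *: \sum_i \sum_j kc (r i) (c i j) (p' j).

Let quad_accretive m (mu : R) (c : 'M[C]_m) (I : finType) (r r' : I -> 'I_m -> S) :
  0 <= mu -> mu * mxnorm (map_mx G c) <= 1 ->
  forall x, 0 <= Re (\sum_a \sum_b
    hdot (psi (quad mu c (r a) (r' a) (r b) (r' b)) (x b)) (x a)).
Proof.
move=> mu0 mu1; apply: accretive_transfer_fin => v.
pose u i := \sum_a adj (op (r a i)) (v a).
pose w j := \sum_a adj (op (r' a j)) (v a).
have term a b : hdot (phi (quad mu c (r a) (r' a) (r b) (r' b)) (v b)) (v a) =
    \sum_i hdot (adj (op (r b i)) (v b)) (adj (op (r a i)) (v a)) +
    \sum_j hdot (adj (op (r' b j)) (v b)) (adj (op (r' a j)) (v a)) +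
    (2 * mu)%:C%C * \sum_i \sum_j
      hdot (G (c i j) (adj (op (r' b j)) (v b))) (adj (op (r a i)) (v a)).
  rewrite /quad !linearD linearZ !linear_sum !bopDE bopZE !bop_sumE.
  rewrite !hdotDl hdotZl !hdot_suml; congr (_ + _ + _ * _).
  - by apply: eq_bigr => i _; rewrite kcE G1 /= adjP.
  - by apply: eq_bigr => i _; rewrite kcE G1 /= adjP.
  - apply: eq_bigr => i _; rewrite linear_sum bop_sumE hdot_suml.
    by apply: eq_bigr => j _; rewrite kcE /= adjP.
have sq (s : I -> 'I_m -> S) : \sum_a \sum_b
    \sum_i hdot (adj (op (s b i)) (v b)) (adj (op (s a i)) (v a)) =
    \sum_i hdot (\sum_a adj (op (s a i)) (v a)) (\sum_a adj (op (s a i)) (v a)).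
  rewrite sum_exchange3; apply: eq_bigr => i _.
  by rewrite hdot_sumr; apply: eq_bigr => a _; rewrite hdot_suml.
have -> : \sum_a \sum_b hdot (phi (quad mu c (r a) (r' a) (r b) (r' b)) (v b)) (v a) =
    (l2norm u ^+ 2)%:C%C + (l2norm w ^+ 2)%:C%C +
    (2 * mu)%:C%C * \sum_i \sum_j hdot (map_mx G c i j (w j)) (u i).
  under eq_bigr do under eq_bigr do rewrite term.
  under eq_bigr do rewrite !big_split /=.
  rewrite !big_split /= !sq -!sum_hdot_self; congr (_ + _).
  under eq_bigr do rewrite -mulr_sumr.
  rewrite -mulr_sumr; congr (_ * _); rewrite [LHS]sum_exchange4.
  apply: eq_bigr => i _; apply: eq_bigr => j _.
  rewrite mxE -[w j]/(\sum_a adj (op (r' a j)) (v a)).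
  rewrite -[u i]/(\sum_a adj (op (r a i)) (v a)) hdot_sumr.
  by apply: eq_bigr => a _; rewrite linear_sum hdot_suml.
rewrite !ReD ReZ /=.
have := mxnorm_dot (map_mx G c) w u.
set z := \sum_i _ => hz.
have h1 : mu * cabs z <= l2norm w * l2norm u.
  apply: le_trans (ler_wpM2l mu0 hz) _; rewrite !mulrA -[leRHS]mul1r -mulrA.
  by rewrite ler_wpM2r// mulr_ge0// l2norm_ge0.
have h2 : - (mu * cabs z) <= mu * Re z.
  by rewrite -mulrN ler_wpM2l// lerNl ReNle_cabs.
have := sqr_ge0 (l2norm u - l2norm w); rewrite sqrrB; lra.
Qed.

(** One index set has to serve all the lists [l i] and [l' i]: an entry fills the slot of the list
    it comes from and puts [s0] into all others. This is why the kernel must vanish at [s0]. The tag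
    [true] marks the lists [l']. *)
Let side (b : bool) m (i : 'I_m) (e : bool * ('I_m * (S * K1))) : S :=
  if (e.1 == b) && (e.2.1 == i) then e.2.2.1 else s0.

Let tagged_list m (l l' : 'I_m -> seq (S * K1)) :=
  [seq (true, t) | t <- flatten [seq [seq (i, t) | t <- l' i] | i <- enum 'I_m]] ++
  [seq (false, t) | t <- flatten [seq [seq (i, t) | t <- l i] | i <- enum 'I_m]].

Let sum_tagged (V : nmodType) m (l l' : 'I_m -> seq (S * K1)) (F : _ -> V) :
  \sum_(e <- tagged_list l l') F e =
  \sum_i \sum_(t <- l' i) F (true, (i, t)) + \sum_i \sum_(t <- l i) F (false, (i, t)).
Proof.
have flat (k : 'I_m -> seq (S * K1)) (F' : 'I_m * (S * K1) -> V) :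
    \sum_(e <- flatten [seq [seq (i, t) | t <- k i] | i <- enum 'I_m]) F' e =
    \sum_i \sum_(t <- k i) F' (i, t).
  by rewrite big_flatten big_map big_enum; apply: eq_bigr => i _; rewrite big_map.
by rewrite /tagged_list big_cat /= !big_map !flat.
Qed.

Let sum_side (V : nmodType) b m (i : 'I_m) (l l' : 'I_m -> seq (S * K1))
    (F : S -> K1 -> V) : (forall x, F s0 x = 0) ->
  \sum_(e <- tagged_list l l') F (side b i e) e.2.2.2 =
  \sum_(t <- (if b then l' i else l i)) F t.1 t.2.
Proof.
move=> F0; rewrite sum_tagged.
have off (k : 'I_m -> seq (S * K1)) : \sum_j \sum_(t <- k j)
    F (side b i (~~ b, (j, t))) t.2 = 0.
  by rewrite big1// => j _; rewrite big1// => t _; rewrite /side /=; case: b; rewrite F0.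
have on (k : 'I_m -> seq (S * K1)) : \sum_j \sum_(t <- k j)
    F (side b i (b, (j, t))) t.2 = \sum_(t <- k i) F t.1 t.2.
  rewrite (bigD1 i)//= [X in _ + X]big1 ?addr0 => [|j ji].
    by apply: eq_bigr => t _; rewrite /side /= !eqxx.
  by rewrite big1// => t _; rewrite /side /= (negbTE ji) andbF F0.
by case: b off on => off on /=; rewrite off on ?addr0 ?add0r.
Qed.

(** The matrix of [quad_accretive], with one row for each entry of each list, is evaluated at the
    vectors of these entries; by [sum_side] the double sums collapse to the forms of the single
    lists. *)
Let kform_quad m (mu : R) (c : 'M[C]_m) (l l' : 'I_m -> seq (S * K1)) :
  0 <= mu -> mu * mxnorm (map_mx G c) <= 1 ->
  0 <= Re (\sum_i kform one (l' i) (l' i) + \sum_j kform one (l j) (l j) +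
    (2 * mu)%:C%C * \sum_i \sum_j kform (c i j) (l j) (l' i)).
Proof.
move=> mu0 mu1; pose L0 := tagged_list l l'.
have := @quad_accretive m mu c 'I_(size L0)
  (fun a i => side true i (tnth (in_tuple L0) a))
  (fun a i => side false i (tnth (in_tuple L0) a)) mu0 mu1
  (fun a => (tnth (in_tuple L0) a).2.2.2).
set z := \sum_a _; set z' := _ + _ + _; suff -> : z = z' by [].
have zE : z = \sum_(e' <- L0) \sum_(e <- L0)
    hdot (psi (quad mu c (fun i => side true i e') (fun i => side false i e')
      (fun i => side true i e) (fun i => side false i e)) e.2.2.2) e'.2.2.2.
  by rewrite [RHS](big_tnth _ _ L0); apply: eq_bigr => a _; rewrite [RHS](big_tnth _ _ L0).
have psi0 x : (psi 0 : bop K1 K1) x = 0 by rewrite linear0.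
have term b b' i j (c0 : C) : \sum_(e' <- L0) \sum_(e <- L0)
    hdot (psi (kc (side b i e') c0 (side b' j e)) e.2.2.2) e'.2.2.2 =
    kform c0 (if b' then l' j else l j) (if b then l' i else l i).
  rewrite exchange_big /=.
  under eq_bigr => e1 _.
    rewrite (sum_side b i l l' (F := fun s x => hdot (psi (kc s c0 (side b' j e1)) e1.2.2.2) x)); last first.
      by move=> x; rewrite kc0l psi0 hdot0l.
    over.
  rewrite (sum_side b' j l l' (F := fun s x => \sum_(t <- (if b then l' i else l i))
    hdot (psi (kc t.1 c0 s) x) t.2))//.
  by move=> x; rewrite big1// => t _; rewrite kc0r psi0 hdot0l.
rewrite zE /z'.
under eq_bigr do under eq_bigr do
  rewrite /quad !linearD linearZ !linear_sum !bopDE bopZE !bop_sumE !hdotDl hdotZl !hdot_suml.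
under eq_bigr do rewrite !big_split /=.
rewrite !big_split /=; congr (_ + _ + _).
- by rewrite [LHS]sum_exchange3; apply: eq_bigr => i _; rewrite term.
- by rewrite [LHS]sum_exchange3; apply: eq_bigr => i _; rewrite term.
under eq_bigr do rewrite -mulr_sumr.
rewrite -mulr_sumr; congr (_ * _).
have inner e' e1 : \sum_i hdot (psi (\sum_j kc (side true i e') (c i j) (side false j e1))
      e1.2.2.2) e'.2.2.2 = \sum_i \sum_j
      hdot (psi (kc (side true i e') (c i j) (side false j e1)) e1.2.2.2) e'.2.2.2.
  by apply: eq_bigr => i _; rewrite linear_sum bop_sumE hdot_suml.
transitivity (\sum_(e' <- L0) \sum_(e1 <- L0) \sum_i \sum_j
    hdot (psi (kc (side true i e') (c i j) (side false j e1)) e1.2.2.2) e'.2.2.2).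
  by apply: eq_bigr => e' _; apply: eq_bigr => e1 _; exact: inner.
rewrite [LHS]sum_exchange4.
by apply: eq_bigr => i _; apply: eq_bigr => j _; rewrite term.
Qed.

Lemma kform_catr c l l1 l2 : kform c l (l1 ++ l2) = kform c l l1 + kform c l l2.
Proof. by rewrite /kform -big_split; apply: eq_bigr => t _; rewrite big_cat. Qed.

Lemma kform_scalr c (a : R[i]) l l' :
  kform c l [seq (t.1, a *: t.2) | t <- l'] = (a^*)%C * kform c l l'.
Proof.
rewrite /kform mulr_sumr; apply: eq_bigr => t _.
rewrite big_map mulr_sumr; apply: eq_bigr => t' _ /=.
by rewrite hdotZr.
Qed.

(** Accretivity speaks of real parts only. Multiplying the kernel by 1, i and -i in turn makes the
    real part of the form nonnegative and its imaginary part zero. *)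
Lemma kform_ge0 l : 0 <= kform one l l.
Proof.
have h (a : R[i]) : 0 <= Re a -> 0 <= Re (a * kform one l l).
  move=> a0; have := @accretive_transfer_fin 'I_(size l)
    (fun i j => a *: kc (tnth (in_tuple l) i).1 one (tnth (in_tuple l) j).1) _
    (fun i => (tnth (in_tuple l) i).2).
  set z := \sum_i _ => hz; suff <- : z = a * kform one l l.
    apply: hz => v; pose w i := adj (op (tnth (in_tuple l) i).1) (v i).
    rewrite [X in Re X](_ : _ = a * hdot (\sum_i w i) (\sum_i w i)).
      by rewrite hdotxxE mulrC ReZ mulr_ge0 ?sqr_ge0.
    rewrite hdot_sumr mulr_sumr; apply: eq_bigr => i _.
    rewrite hdot_suml mulr_sumr; apply: eq_bigr => j _.
    by rewrite linearZ bopZE hdotZl kcE G1 /= adjP.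
  rewrite /kform exchange_big mulr_sumr big_tnth; apply: eq_bigr => i _.
  rewrite mulr_sumr [RHS](big_tnth _ _ l); apply: eq_bigr => j _.
  by rewrite linearZ bopZE hdotZl.
have h1 := h 1 ler01; have h2 := h 'i%C (lexx _).
have h3 : 0 <= Re (- 'i%C * kform one l l) by apply: h; rewrite /= oppr0.
rewrite mul1r in h1; move: h1 h2 h3; case: (kform one l l) => x y /=.
rewrite lecE /= !mul0r !mul1r !oppr0 !mul0r !mulN1r !add0r opprK => x0 y0 y0'.
by rewrite x0 andbT; apply/eqP/le_anti; rewrite y0' andbT; lra.
Qed.

(** [psi] is not assumed to respect adjoints, so symmetry is obtained by polarisation: the form is
    real at [l + a l'] for [a] equal to 1 and to i. *)
Lemma kform_herm l l' : kform one l l' = ((kform one l' l)^*)%C.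
Proof.
have h (a : R[i]) := ger0_Im (kform_ge0 (l ++ [seq (t.1, a *: t.2) | t <- l'])).
have h0 := ger0_Im (kform_ge0 l); have h0' := ger0_Im (kform_ge0 l').
have := h 1; have := h 'i%C.
rewrite !kform_catl !kform_catr !kform_scall !kform_scalr.
move: h0 h0'; case: (kform one l l) => x1 y1; case: (kform one l' l') => x2 y2 /= -> ->.
case: (kform one l l') => x3 y3; case: (kform one l' l) => x4 y4 /= e1 e2.
apply/eqP; rewrite eq_complex /=; apply/andP; split; apply/eqP; lra.
Qed.

(** Multiplying the lists [l] by a complex [t] turns [kform_quad] into the quadratic inequality of
    [quad_bound]. The matrix norm [M] may be zero, so [mu] is the inverse of [M + eps], and [eps]
    tends to 0 at the end. Matrices of all sizes are covered, which will give complete contractivity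
    of the induced action. *)
Lemma kform_bound m (c : 'M[C]_m) (l l' : 'I_m -> seq (S * K1)) :
  cabs (\sum_i \sum_j kform (c i j) (l j) (l' i)) <= mxnorm (map_mx G c) *
    Num.sqrt (\sum_j Re (kform one (l j) (l j))) *
    Num.sqrt (\sum_i Re (kform one (l' i) (l' i))).
Proof.
set s := \sum_i _; set M := mxnorm _; set n := Num.sqrt _; set d := Num.sqrt _.
have M0 : 0 <= M by exact: mxnorm_bop_ge0.
have n0 : 0 <= n by exact: sqrtr_ge0.
have d0 : 0 <= d by exact: sqrtr_ge0.
have sq (k : 'I_m -> seq (S * K1)) :
    Num.sqrt (\sum_j Re (kform one (k j) (k j))) ^+ 2 =
    \sum_j Re (kform one (k j) (k j)).
  by rewrite sqr_sqrtr// sumr_ge0// => j _; exact: ge0_Re (kform_ge0 _).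
have bnd eps : 0 < eps -> cabs s <= (M + eps) * (d * n).
  move=> eps0; have Me : 0 < M + eps by rewrite ltr_wpDl.
  have : cabs ((M + eps)^-1%:C%C * s) <= d * n.
    apply: quad_bound => // t.
    have := @kform_quad m (M + eps)^-1 c (fun j => [seq (u.1, t *: u.2) | u <- l j]) l'.
    rewrite invr_ge0 (ltW Me) mulrC ler_pdivrMr// mul1r lerDl (ltW eps0).
    move=> /(_ isT isT).
    have -> : \sum_i \sum_j kform (c i j) [seq (u.1, t *: u.2) | u <- l j] (l' i) = t * s.
      rewrite mulr_sumr; apply: eq_bigr => i _; rewrite mulr_sumr.
      by apply: eq_bigr => j _; rewrite kform_scall.
    rewrite !ReD ReZ !Re_sum sq sq.
    have -> : \sum_j Re (kform one [seq (u.1, t *: u.2) | u <- l j] [seq (u.1, t *: u.2) | u <- l j]) =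
        cabs t ^+ 2 * \sum_j Re (kform one (l j) (l j)).
      rewrite mulr_sumr; apply: eq_bigr => j _.
      by rewrite kform_scall kform_scalr mulrA mul_conj_cabs ReZ.
    rewrite [t * (_ * s)]mulrCA ReZ; lra.
  rewrite cabsM cabs_real ger0_norm ?invr_ge0 ?(ltW Me)//.
  by rewrite ler_pdivrMl.
apply/ler_addgt0Pr => eps eps0.
have dn0 : 0 <= d * n by rewrite mulr_ge0.
have dn1 : 0 < d * n + 1 by lra.
apply: le_trans (bnd (eps / (d * n + 1)) _) _; first by rewrite divr_gt0.
rewrite mulrDl -mulrA [n * d]mulrC lerD2l mulrAC -mulrA ger_pMr//.
by rewrite ler_pdivrMr// mul1r lerDl.
Qed.

End Kernel.
End Accretive.

(** * Unital normal representations *)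

Section NormalReps.
Context {R : realType}.
Implicit Types A B C : dualOpAlgType R.
Implicit Types H K L : hilbertType R.

(** A form of [normal_rep] that is easier to verify: the range is automatically w*-closed, and
    continuity is tested on normal functionals. *)
Definition nrep A H (f : {linear A -> bop H H}) :=
  [/\ forall a b, f (a * b) = bcomp (f a) (f b), complete_isometry f,
      wnormal f & f 1 = bid H].

Lemma bcomp_idl H K (T : bop H K) : bcomp (bid K) T = T.
Proof. exact: bop_inj. Qed.

Lemma bcomp_idr H K (T : bop H K) : bcomp T (bid H) = T.
Proof. exact: bop_inj. Qed.

Lemma bcompA H K L (L' : hilbertType R) (S : bop L L') (T : bop K L) (U : bop H K) :
  bcomp S (bcomp T U) = bcomp (bcomp S T) U.
Proof. exact: bop_inj. Qed.

Lemma bcompPl H K L (a : R[i]) (S S' : bop K L) (T : bop H K) :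
  bcomp (a *: S + S') T = a *: bcomp S T + bcomp S' T.
Proof. exact: bop_inj. Qed.

Lemma bcompPr H K L (a : R[i]) (S : bop K L) (T T' : bop H K) :
  bcomp S (a *: T + T') = a *: bcomp S T + bcomp S T'.
Proof. by apply: bop_inj => x /=; rewrite linearP. Qed.

Lemma bcomp0l H K L (T : bop H K) : bcomp (0 : bop K L) T = 0.
Proof. exact: bop_inj. Qed.

Lemma bcomp0r H K L (S : bop K L) : bcomp S (0 : bop H K) = 0.
Proof. by apply: bop_inj => x /=; rewrite linear0. Qed.

Lemma adjPlin H K (a : R[i]) (S T : bop H K) :
  adj (a *: S + T) = (a^*)%C *: adj S + adj T.
Proof. by rewrite adjD adjZ. Qed.

Lemma normal_rep_nrep A H (f : {linear A -> bop H H}) : normal_rep f -> nrep f.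
Proof.
move=> [fM fci fc [_ _ [e _ fe] _]]; split=> //; first exact: continuous_wnormal.
by have := fM 1 e; rewrite mul1r fe bcomp_idr.
Qed.

Lemma range_subspace A H (f : {linear A -> bop H H}) : is_subspace (range f).
Proof.
split; first by exists 0 => //; rewrite linear0.
by move=> a _ _ [x _ <-] [y _ <-]; exists (a *: x + y) => //; rewrite linearP.
Qed.

Lemma nrep_normal_rep A H (f : {linear A -> bop H H}) : nrep f -> normal_rep f.
Proof.
move=> [fM fci fn f1]; split=> //; first exact: wnormal_continuous.
split.
- exact: range_subspace.
- by move=> _ _ [a _ <-] [b _ <-]; exists (a * b) => //; rewrite fM.
- by exists 1.
- exact: rep_range_closed.
Qed.

Section OneRep.
Variables (A : dualOpAlgType R) (H : hilbertType R) (f : {linear A -> bop H H}).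
Hypothesis fr : nrep f.

Let fM : forall a b, f (a * b) = bcomp (f a) (f b). Proof. by case: fr. Qed.
Let fci : complete_isometry f. Proof. by case: fr. Qed.
Let fn : wnormal f. Proof. by case: fr. Qed.

Lemma nrep_inj : injective f.
Proof.
move=> a b fab; apply/subr0_eq.
have n0 : norm1 (a - b) = 0.
  rewrite -(norm1_isometry _ fci) linearB fab subrr.
  apply/eqP; rewrite eq_le norm1_bop_ge0 andbT.
  by apply: norm1_bop_le => // x; rewrite bop0E rnorm0 mul0r.
apply: (bij_inj (@to_dual_bij R A)); rewrite linear0.
apply/val_inj/funext => x; apply: cabs_eq0; apply/eqP.
rewrite eq_le cabs_ge0 andbT; apply: le_trans (to_dual_le (a - b) x) _.
by rewrite n0 mul0r.
Qed.

Lemma nrep_range_closed : wclosed (range f).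
Proof. exact: rep_range_closed. Qed.

Lemma wfun_closure_eq (F G : A -> R[i]) (Q : set A) a : wfun F -> wfun G ->
  (forall b, Q b -> F b = G b) -> closure (Q : set (wstar A)) a -> F a = G a.
Proof.
move=> Fw Gw FG Qa; have [x hx] := wfun_comb (-1) Gw Fw.
have hx' b : to_dual b x = F b - G b by rewrite -hx mulN1r addrC.
apply/subr0_eq; rewrite -hx'; apply: cabs_eq0; apply/eqP.
rewrite eq_le cabs_ge0 andbT; apply/ler_addgt0Pr => e e0; rewrite add0r.
have [b Qb /(_ ord0)] := @closure_init R _ _ (@to_dual_fun R A) Q a 1%N (fun=> x) e Qa e0.
by rewrite /to_dual_fun hx' FG// subrr sub0r cabsN => /ltW.
Qed.

(** An induction principle for elements of [A] whose images are generated by [X]. Thanks to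
    [rep_closure], the property [Q] has to be closed in the w*-topology of [A] only, so it may speak
    of another representation. *)
Lemma nrep_wspan_ind (X : set (bop H H)) (Q : set A) a :
  is_subspace Q -> (forall b, closure (Q : set (wstar A)) b -> Q b) ->
  (forall T, X T -> exists2 b, f b = T & Q b) -> wspan X (f a) -> Q a.
Proof.
move=> Qs Qc XQ Xa; apply: Qc; apply: (rep_closure fci fn).
apply: closure_subset Xa; apply: lspan_min.
  split; first by exists 0; rewrite ?linear0//; case: Qs.
  move=> c _ _ [x Qx <-] [y Qy <-]; exists (c *: x + y); last by rewrite linearP.
  exact: Qs.2.
by move=> T /XQ[b <- Qb]; exists b.
Qed.

Lemma nrep_transport K (h : {linear A -> bop K K}) (X : set (bop H H))
    (Y : set (bop K K)) a : wnormal h ->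
  (forall T, X T -> exists2 b, f b = T & Y (h b)) -> wspan X (f a) -> wspan Y (h a).
Proof.
move=> hn XY; have Ys := wspan_subspace Y.
apply: (@nrep_wspan_ind X (h @^-1` (wspan Y))).
- split; first by rewrite /preimage/= linear0; case: Ys.
  by move=> c x y; rewrite /preimage/= linearP; exact: Ys.2.
- move=> b; apply: (@closure_image (wstar A) (bop_wstar K K) h) => //.
    exact: wnormal_continuous.
- by move=> T /XY[b fb Yb]; exists b => //; exact: sub_wspan.
Qed.

(** Continuity of the product is not among the axioms of a dual operator algebra. It comes from the
    representation, where composition with a fixed operator is w*-continuous. *)
Lemma wfun_mull (F : A -> R[i]) c : wfun F -> wfun (fun a => F (c * a)).
Proof.
move=> [x hx]; have [p [hp _]] := predual_lift fci fn x ltr01.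
have [q hq] := normal_map_sandwich (f c) (bid H) p.
have [y hy] := fn q; exists y => a.
by rewrite hx hp fM -hy -hq bcomp_idr.
Qed.

End OneRep.

(** The extension is the adjoint of the map sending [y] to the functional [hdot y (G x)] of [x], so
    no limit has to be taken. *)
Lemma hcompl_ext (P : preHilbert R) K (G : P -> K) (C : R) :
  (forall x y, G (padd x y) = G x + G y) -> (forall a x, G (pscal a x) = a *: G x) ->
  0 <= C -> (forall x, rnorm (G x) <= C * pnorm x) ->
  exists T : bop (hcompl P) K, forall x, T (hinj x) = G x.
Proof.
move=> GD GZ C0 GC.
have Sd y : is_pdual (fun x => hdot y (G x)).
  apply/asboolP; split=> [x x'|a x|]; rewrite ?GD ?GZ ?hdotDr ?hdotZr//.
  exists (rnorm y * C) => [|x]; first by rewrite mulr_ge0// rnorm_ge0.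
  by apply: le_trans (hdot_CS _ _) _; rewrite -mulrA ler_wpM2l// rnorm_ge0.
pose S y : hcompl P := HCompl (Sd y).
have Sl : linear S.
  by move=> a y y'; apply: hcompl_eq => x; rewrite hcompl_linE /= hdotDl hdotZl.
have [|S' S'E] := @bopP R K (hcompl P) S C Sl.
  move=> y; rewrite rnorm_hcompl; apply: hc_norm_le => [|x].
    by rewrite mulr_ge0// rnorm_ge0.
  apply: le_trans (hdot_CS _ _) _; rewrite mulrAC [leRHS]mulrC.
  by rewrite ler_wpM2l// rnorm_ge0.
exists (adj S') => x; apply: hdot_injr => z.
by rewrite -adjP S'E hdot_hinj.
Qed.

Lemma hcompl_bop_eq (P : preHilbert R) K (S T : bop (hcompl P) K) :
  (forall x, S (hinj x) = T (hinj x)) -> S = T.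
Proof.
move=> h; rewrite -[S]adjK -[T]adjK; congr adj; apply: bop_inj => y.
by apply: hcompl_eq => x; rewrite -!hdot_hinj !adjPl h.
Qed.

Lemma l2normD H (I : finType) (v w : I -> H) :
  l2norm (fun i => v i + w i) <= l2norm v + l2norm w.
Proof.
have v0 := l2norm_ge0 v; have w0 := l2norm_ge0 w.
rewrite -(@ler_pXn2r _ 2%N)// ?nnegrE ?l2norm_ge0 ?addr_ge0//.
have -> : l2norm (fun i => v i + w i) ^+ 2 =
    l2norm v ^+ 2 + l2norm w ^+ 2 + 2 * complex.Re (\sum_i hdot (w i) (v i)).
  rewrite !l2norm_sqr Re_sum mulr_sumr -!big_split /=; apply: eq_bigr => i _.
  rewrite !rnorm_sqr hdotDl !hdotDr !ReD (hdotC (v i) (w i)) ReJ; lra.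
have := le_trans (Re_le_cabs _) (l2norm_dot w v); rewrite sqrrD; lra.
Qed.

Lemma l2norm_approx H (D : set H) m (v : 'I_m -> H) (e : R) :
  (forall x (e : R), 0 < e -> exists2 y, D y & rnorm (x - y) < e) -> 0 < e ->
  exists v', (forall i, D (v' i)) /\ l2norm (fun i => v i - v' i) <= e.
Proof.
move=> Dd e0; have e' : 0 < e / m.+1%:R by rewrite divr_gt0// ltr0n.
have h i : exists y, D y /\ rnorm (v i - y) < e / m.+1%:R.
  by have [y] := Dd (v i) _ e'; exists y.
pose v' i := sval (cid (h i)).
have hv i : D (v' i) /\ rnorm (v i - v' i) < e / m.+1%:R by rewrite /v'; case: cid.
exists v'; split=> [i|]; first exact: (hv i).1.
apply: le_trans (l2norm_le_sum _) _.
apply: (@le_trans _ _ (\sum_(i < m) e / m.+1%:R)).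
  by apply: ler_sum => i _; rewrite ltW// (hv i).2.
rewrite sumr_const card_ord -[_ *+ m]mulr_natr -mulrA ger_pMr//.
by rewrite mulrC ler_pdivrMr ?ltr0n// mul1r ler_nat.
Qed.

Lemma mxnorm_dense H K m (T : 'M[bop H K]_m) (C : R) (D : set H) (D' : set K) :
  0 <= C ->
  (forall x (e : R), 0 < e -> exists2 y, D y & rnorm (x - y) < e) ->
  (forall x (e : R), 0 < e -> exists2 y, D' y & rnorm (x - y) < e) ->
  (forall v w, (forall i, D (v i)) -> (forall i, D' (w i)) ->
    cabs (\sum_i \sum_j hdot (T i j (v j)) (w i)) <= C * l2norm v * l2norm w) ->
  mxnorm T <= C.
Proof.
move=> C0 Dd D'd h; apply: mxnorm_dot_le => // v w.
set M := mxnorm T; have M0 : 0 <= M by exact: mxnorm_bop_ge0.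
have v0 := l2norm_ge0 v; have w0 := l2norm_ge0 w.
set V := l2norm v in v0 *; set W := l2norm w in w0 *.
(* [Z] collects the coefficients of [d] in the three error terms, once products [d * d] are bounded
   by [d]. *)
pose Z := C * (V + W + 1) + M * W + M * (V + 1).
have Z0 : 0 <= Z by rewrite !addr_ge0// mulr_ge0// !addr_ge0.
apply/ler_addgt0Pr => e e0.
pose d := Num.min 1 (e / (Z + 1)).
have Z1 : 0 < Z + 1 by lra.
have d0 : 0 < d by rewrite lt_min ltr01 divr_gt0.
have d1 : d <= 1 by rewrite ge_min lexx.
have dZ : d * Z <= e.
  apply: (@le_trans _ _ (d * (Z + 1))); first by rewrite ler_wpM2l ?(ltW d0)// lerDl.
  by rewrite -ler_pdivlMr// ge_min lexx orbT.
have [v' [Dv' hv]] := l2norm_approx v Dd d0.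
have [w' [Dw' hw]] := l2norm_approx w D'd d0.
have nv : l2norm v' <= V + d.
  have := l2normD v (fun i => v' i - v i).
  rewrite (_ : (fun i => v i + (v' i - v i)) = v'); last by apply/funext => i; rewrite addrC subrK.
  have -> : l2norm (fun i => v' i - v i) = l2norm (fun i => v i - v' i).
    by rewrite /l2norm; congr Num.sqrt; apply: eq_bigr => i _; rewrite rnormB.
  rewrite -/V; lra.
have nw : l2norm w' <= W + d.
  have := l2normD w (fun i => w' i - w i).
  rewrite (_ : (fun i => w i + (w' i - w i)) = w'); last by apply/funext => i; rewrite addrC subrK.
  have -> : l2norm (fun i => w' i - w i) = l2norm (fun i => w i - w' i).
    by rewrite /l2norm; congr Num.sqrt; apply: eq_bigr => i _; rewrite rnormB.
  rewrite -/W; lra.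
have -> : \sum_i \sum_j hdot (T i j (v j)) (w i) =
    \sum_i \sum_j hdot (T i j (v' j)) (w' i) +
    \sum_i \sum_j hdot (T i j (v j - v' j)) (w i) +
    \sum_i \sum_j hdot (T i j (v' j)) (w i - w' i).
  rewrite -!big_split /=; apply: eq_bigr => i _.
  rewrite -!big_split /=; apply: eq_bigr => j _.
  by rewrite linearB hdotBl hdotBr; ring.
have b1 := h v' w' Dv' Dw'.
have b2 := mxnorm_dot T (fun j => v j - v' j) w.
have b3 := mxnorm_dot T v' (fun i => w i - w' i).
have n1 := l2norm_ge0 v'; have n2 := l2norm_ge0 w'.
have n3 := l2norm_ge0 (fun i => v i - v' i); have n4 := l2norm_ge0 (fun i => w i - w' i).
rewrite -/M -/W in b2 b3.
apply: le_trans (cabsD _ _) _; apply: le_trans (lerD (cabsD _ _) (lexx _)) _.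
have c1 : C * l2norm v' * l2norm w' <= C * ((V + d) * (W + d)).
  by rewrite -mulrA ler_wpM2l// ler_pM.
have c2 : M * l2norm (fun j => v j - v' j) * W <= M * d * W.
  by rewrite ler_wpM2r// ler_wpM2l.
have c3 : M * l2norm v' * l2norm (fun i => w i - w' i) <= M * (V + d) * d.
  by rewrite ler_pM ?mulr_ge0// ler_wpM2l.
have c4 : C * ((V + d) * (W + d)) <= C * V * W + C * (d * (V + W + 1)).
  rewrite -mulrA -mulrDr ler_wpM2l//.
  have : d * d <= d * 1 by rewrite ler_wpM2l// ltW.
  by rewrite mulrDl !mulrDr; lra.
have c5 : M * (V + d) * d <= M * (V + 1) * d.
  by rewrite ler_wpM2r ?(ltW d0)// ler_wpM2l// lerD2l.
have : d * Z = C * (d * (V + W + 1)) + M * d * W + M * (V + 1) * d by rewrite /Z; ring.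
lra.
Qed.

End NormalReps.

(* [B] is TRO-equivalent to a corner of [A], without mention of the projection:
   for unital algebras it is recovered from [M] by [TRO_unit]. *)
Definition corner_equiv (R : realType) (K H : hilbertType R) (B : set (bop K K))
    (A : set (bop H H)) (M : set (bop K H)) :=
  [/\ is_TRO M,
      B = wspan [set T | exists m1 a m2, [/\ M m1, A a, M m2 &
                           T = bcomp (adj m1) (bcomp a m2)]] &
      forall m1 b m2, M m1 -> B b -> M m2 -> A (bcomp m1 (bcomp b (adj m2)))].

(* The representation of C induced along N from the representation f of B:
   it acts on the completion of N^* (x) K for the form
   <n^* (x) x, m^* (x) y> = <f(m n^* ) x, y>, where m n^* is read in B through f'. *)
Section Induced.
Context {R : realType} (B C : dualOpAlgType R) (K' K L : hilbertType R).
Variables (f' : {linear B -> bop K' K'}) (f : {linear B -> bop K K})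
  (g : {linear C -> bop L L}).
Hypotheses (f'r : nrep f') (fr : nrep f) (gr : nrep g).
Variable N : set (bop L K').
Hypothesis gN : corner_equiv (range g) (range f') N.
Local Notation Re := (@complex.Re R).

Let f'M a b : f' (a * b) = bcomp (f' a) (f' b). Proof. by case: f'r. Qed.
Let fM a b : f (a * b) = bcomp (f a) (f b). Proof. by case: fr. Qed.
Let gM a b : g (a * b) = bcomp (g a) (g b). Proof. by case: gr. Qed.
Let f'ci : complete_isometry f'. Proof. by case: f'r. Qed.
Let fci : complete_isometry f. Proof. by case: fr. Qed.
Let gci : complete_isometry g. Proof. by case: gr. Qed.
Let f'n : wnormal f'. Proof. by case: f'r. Qed.
Let fn : wnormal f. Proof. by case: fr. Qed.
Let gn : wnormal g. Proof. by case: gr. Qed.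
Let f'1 : f' 1 = bid K'. Proof. by case: f'r. Qed.
Let f1 : f 1 = bid K. Proof. by case: fr. Qed.
Let g1 : g 1 = bid L. Proof. by case: gr. Qed.

Let N_sub : is_subspace N. Proof. by case: gN => -[]. Qed.
Let N_TRO m1 m2 m3 : N m1 -> N m2 -> N m3 -> N (bcomp m1 (bcomp (adj m2) m3)).
Proof. by case: gN => -[_ h] _ _; exact: h. Qed.

Definition sN := sig N.
Implicit Types (s : sN) (c : C) (b : B).
Local Notation op s := (@sval _ N s).

Let s0 : sN := exist _ 0 N_sub.1.

Let kc s c t : B := xget 0 [set b | f' b = bcomp (op s) (bcomp (g c) (adj (op t)))].

Let kcE s c t : f' (kc s c t) = bcomp (op s) (bcomp (g c) (adj (op t))).
Proof.
rewrite /kc; case: xgetP => [b _ ->//|h].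
case: gN => _ _ hN.
have [|b _ /h//] := hN (op s) (g c) (op t) (svalP s) _ (svalP t).
by exists c.
Qed.

Let kc_eq s c t b : f' b = bcomp (op s) (bcomp (g c) (adj (op t))) -> kc s c t = b.
Proof. by move=> h; apply: (nrep_inj f'r); rewrite kcE h. Qed.

Let kc0l c t : kc s0 c t = 0.
Proof. by apply: kc_eq; rewrite linear0 bcomp0l. Qed.

Let kc0r s c : kc s c s0 = 0.
Proof. by apply: kc_eq; rewrite linear0 adj0 !bcomp0r. Qed.

Let kcP s (a : R[i]) c c' t : kc s (a *: c + c') t = a *: kc s c t + kc s c' t.
Proof.
by apply: kc_eq; rewrite !linearP /= !kcE bcompPl bcompPr.
Qed.

Let kf := kform f kc.

Let kf_ge0 l : 0 <= kf 1 l l.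
Proof. exact: (@kform_ge0 _ _ _ _ f' f 1 f'ci fci f'1 f1 _ 1 sN kc L (fun s => op s) g g1 kcE). Qed.

Let kf_herm l l' : kf 1 l l' = ((kf 1 l' l)^*)%C.
Proof. exact: (@kform_herm _ _ _ _ f' f 1 f'ci fci f'1 f1 _ 1 sN kc L (fun s => op s) g g1 kcE). Qed.

Definition indP : preHilbert R :=
  @PreHilbert R (seq (sN * K)) [::] cat (fun a l => [seq (t.1, a *: t.2) | t <- l])
    (kf 1) (kform_catl f kc 1) (kform_scall f kc 1) kf_herm kf_ge0.

Local Notation E := (hcompl indP).

Let kf_bound m (c : 'M[C]_m) (l l' : 'I_m -> indP) :
  cabs (\sum_i \sum_j kf (c i j) (l j) (l' i)) <=
    mxnorm c * l2norm (fun j => hinj (l j)) * l2norm (fun i => hinj (l' i)).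
Proof.
have := @kform_bound _ _ _ _ f' f 1 f'ci fci f'1 f1 _ 1 sN s0 kc kc0l kc0r L
  (fun s => op s) g g1 kcE m c l l'.
rewrite gci => h; apply: le_trans h _.
have e (k : 'I_m -> indP) : Num.sqrt (\sum_j Re (kform f kc 1 (k j) (k j))) =
    l2norm (fun j => hinj (k j)).
  by rewrite /l2norm; congr Num.sqrt; apply: eq_bigr => j _; rewrite rnorm_hinj pnorm_sqr.
by rewrite !e.
Qed.

Let kf_bound1 c (l l' : indP) : cabs (kf c l l') <= norm1 c * pnorm l * pnorm l'.
Proof.
have := @kf_bound 1 (const_mx c) (fun=> l) (fun=> l').
by rewrite !big_ord1 !l2norm_ord1 mxE !rnorm_hinj.
Qed.

Let Gf_subproof c (l : indP) : is_pdual (kf c l : indP -> R[i]).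
Proof.
apply/asboolP; split=> [x y|a x|].
- exact: kform_catr.
- exact: kform_scalr.
- exists (norm1 c * pnorm l) => [|x]; last exact: kf_bound1.
  by rewrite mulr_ge0 ?pnorm_ge0// (alg_norm1_ge0 gci).
Qed.

(** The product of [c] with the adjoint of an element of [N] need not be such an adjoint, so in
    general no list represents the image of [l] under [c]. The image is given by its inner products
    with all lists instead, which suffices because vectors of the completion are functionals. *)
Let Gf c (l : indP) : E := HCompl (Gf_subproof c l).

Let ghat_ex c : exists T : bop E E, forall l, T (hinj l) = Gf c l.
Proof.
apply: (@hcompl_ext _ indP E (Gf c) (norm1 c)).
- by move=> x y; apply: hcompl_eq => l'; exact: kform_catl.
- by move=> a x; apply: hcompl_eq => l'; exact: kform_scall.
- exact: (alg_norm1_ge0 gci).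
- move=> x; rewrite rnorm_hcompl; apply: hc_norm_le => [|y]; last exact: kf_bound1.
  by rewrite mulr_ge0 ?pnorm_ge0// (alg_norm1_ge0 gci).
Qed.

Definition ghat_fun c : bop E E := sval (cid (ghat_ex c)).

Let ghat_hinj c (l : indP) : ghat_fun c (hinj l) = Gf c l.
Proof. by rewrite /ghat_fun; case: cid. Qed.

Let ghat_dot c (l l' : indP) : hdot (ghat_fun c (hinj l)) (hinj l') = kf c l l'.
Proof. by rewrite hdot_hinj ghat_hinj. Qed.

Lemma ghat_linear : linear ghat_fun.
Proof.
move=> a c c'; apply: hcompl_bop_eq => l; rewrite bopDE bopZE !ghat_hinj.
apply: hcompl_eq => l'; rewrite hcompl_linE /= /kf /kform mulr_sumr -big_split.
apply: eq_bigr => t _; rewrite mulr_sumr -big_split; apply: eq_bigr => t' _ /=.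
by rewrite kcP linearP bopDE bopZE hdotDl hdotZl.
Qed.

HB.instance Definition _ := GRing.isLinear.Build R[i] C (bop E E) _ ghat_fun ghat_linear.

Local Notation ghat := (ghat_fun : {linear C -> bop E E}).

Let nst_ex s : exists T : bop K E, forall x, T x = hinj ([:: (s, x)] : indP).
Proof.
have lin : linear (fun x => hinj ([:: (s, x)] : indP)).
  move=> a x y; apply: hcompl_eq => l'; rewrite hcompl_linE !hinjE /= /kf /kform.
  rewrite !big_seq1 mulr_sumr -big_split; apply: eq_bigr => t' _ /=.
  by rewrite linearP hdotDl hdotZl.
have n0 := norm1_bop_ge0 (f (kc s 1 s)).
(* The sharp constant is the square root of [norm1 (f (kc s 1 s))]; adding 1 avoids the root. *)
have bnd x : rnorm (hinj ([:: (s, x)] : indP)) <= (norm1 (f (kc s 1 s)) + 1) * rnorm x.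
  rewrite rnorm_hinj -(@ler_pXn2r _ 2%N)// ?nnegrE ?pnorm_ge0 ?mulr_ge0 ?addr_ge0 ?rnorm_ge0//.
  rewrite pnorm_sqr /= /kf /kform !big_seq1 /=.
  apply: le_trans (Re_le_cabs _) (le_trans (hdot_CS _ _) _).
  rewrite exprMn expr2 [rnorm x ^+ 2]expr2 mulrA ler_wpM2r ?rnorm_ge0//.
  apply: le_trans (norm1_bopP _ _) _; rewrite ler_wpM2r ?rnorm_ge0//.
  have := sqr_ge0 (norm1 (f (kc s 1 s))); rewrite expr2; nra.
by have [T TE] := @bopP R K E _ _ lin bnd; exists T => x; rewrite TE.
Qed.

Let nst s : bop K E := sval (cid (nst_ex s)).
Let nstE s x : nst s x = hinj ([:: (s, x)] : indP).
Proof. by rewrite /nst; case: cid. Qed.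
Let nhat s : bop E K := adj (nst s).

(** Operators on [E] are compared after sandwiching them between [nhat] and [nst]: this lands in the
    range of [f], and the elements of [B] so obtained are compared through [f'], where they are
    honest products of operators. *)
Let core s c t : bcomp (nhat s) (bcomp (ghat c) (nst t)) = f (kc s c t).
Proof.
apply: bop_inj => x; apply: hdot_inj => y; rewrite /= /nhat adjPl !nstE ghat_dot.
by rewrite /kf /kform !big_seq1.
Qed.

Let core1 s t : bcomp (nhat s) (nst t) = f (kc s 1 t).
Proof.
apply: bop_inj => x; apply: hdot_inj => y; rewrite /= /nhat adjPl !nstE hinj_dot.
by rewrite /= /kf /kform !big_seq1.
Qed.

Let hinj_seq (l : indP) : hinj l = \sum_(t <- l) nst t.1 t.2.
Proof.
elim: l => [|[s x] l IH]; last by rewrite big_cons -IH nstE -hinjD.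
by rewrite big_nil; apply: hcompl_eq => l'; rewrite hinjE /= /kf /kform big_nil.
Qed.

Let eq_nstr (F : hilbertType R) (S T : bop E F) :
  (forall s, bcomp S (nst s) = bcomp T (nst s)) -> S = T.
Proof.
move=> h; apply: hcompl_bop_eq => l; rewrite hinj_seq !linear_sum.
by apply: eq_bigr => t _; have /(congr1 (fun U : bop K F => U t.2)) := h t.1.
Qed.

Let eq_nhatl (F : hilbertType R) (S T : bop F E) :
  (forall s, bcomp (nhat s) S = bcomp (nhat s) T) -> S = T.
Proof.
move=> h; rewrite -[S]adjK -[T]adjK; congr adj; apply: eq_nstr => s.
by have := congr1 (@adj _ _ _) (h s); rewrite !adj_comp adjK.
Qed.

Let eq_nst (S T : bop E E) :
  (forall s t, bcomp (nhat s) (bcomp S (nst t)) = bcomp (nhat s) (bcomp T (nst t))) ->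
  S = T.
Proof. by move=> h; apply: eq_nstr => t; apply: eq_nhatl => s; exact: h. Qed.

Let ghat1 : ghat 1 = bid E.
Proof. by apply: eq_nst => s t; rewrite core bcomp_idl core1. Qed.

(** Lists do not know the linear structure of [N]. It reappears in the completion because both sides
    have the same products with every [nhat u]. *)
Let nst_comb (a : R[i]) s t (h : N (a *: op s + op t)) :
  nst (exist _ _ h) = (a^*)%C *: nst s + nst t.
Proof.
apply: eq_nhatl => u; rewrite bcompPr !core1 -linearP; congr (f _).
apply: kc_eq; rewrite linearP !kcE g1 !bcomp_idl /= adjPlin bcompPr.
by [].
Qed.

Let nhat_comb (a : R[i]) s t (h : N (a *: op s + op t)) :
  nhat (exist _ _ h) = a *: nhat s + nhat t.
Proof. by rewrite /nhat nst_comb adjPlin conjcK. Qed.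

Definition Nhat : set (bop E K) := [set nhat s | s in setT].

Let Nhat_subspace : is_subspace Nhat.
Proof.
split.
  exists s0 => //; rewrite -[RHS]adj0; congr adj; apply: eq_nhatl => s.
  by rewrite core1 kc0r linear0 bcomp0r.
move=> a _ _ [s _ <-] [t _ <-].
by exists (exist _ _ (N_sub.2 a _ _ (svalP s) (svalP t))) => //; exact: nhat_comb.
Qed.

Let Nhat_TRO : is_TRO Nhat.
Proof.
split; first exact: Nhat_subspace.
move=> _ _ _ [s _ <-] [t _ <-] [u _ <-].
exists (exist _ _ (N_TRO (svalP s) (svalP t) (svalP u))) => //.
rewrite (_ : bcomp (nhat s) _ = adj (bcomp (nst u) (bcomp (nhat t) (nst s)))).
  rewrite {1}/nhat; congr (adj _); apply: eq_nhatl => v.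
  rewrite core1 [RHS]bcompA core1 core1 -fM; congr (f _); apply: kc_eq.
  by rewrite f'M !kcE g1 !bcomp_idl /= !adj_comp adjK; exact: bop_inj.
by rewrite !adj_comp bcompA.
Qed.

(** On the generators of [C] the induced action is explicit; its other values are reached from these
    by w*-limits. *)
Let ghat_gen s b t : exists2 c, g c = bcomp (adj (op s)) (bcomp (f' b) (op t)) &
  ghat c = bcomp (nst s) (bcomp (f b) (nhat t)).
Proof.
have [c gc] : exists c, g c = bcomp (adj (op s)) (bcomp (f' b) (op t)).
  suff [c _ gc] : range g (bcomp (adj (op s)) (bcomp (f' b) (op t))) by exists c.
  case: gN => _ -> _; apply: sub_wspan.
  rewrite /mkset; exists (op s), (f' b), (op t).
  by split; [exact: svalP|exists b|exact: svalP|].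
exists c => //; apply: eq_nst => v u; rewrite core.
rewrite [RHS](_ : _ = bcomp (bcomp (nhat v) (nst s)) (bcomp (f b) (bcomp (nhat t) (nst u))));
  last exact: bop_inj.
rewrite !core1 -!fM; congr (f _); apply: kc_eq.
by rewrite !f'M !kcE g1 gc; exact: bop_inj.
Qed.

(** The functional passes through all three algebras: a vector functional of [f] comes from the
    predual of [B], hence lifts to a normal functional of [f']; sandwiching by elements of [N] makes
    this a normal functional of [g], and so an element of the predual of [C]. *)
Let kf_wfun (l l' : indP) : wfun (fun c => kf c l l').
Proof.
have term s t x y : wfun (fun c => hdot (f (kc s c t) x) y).
  have [p hp] := normal_of_list [:: (x, y)].
  have {}hp T : normal_fun T p = hdot (T x) y by rewrite hp /lfun big_seq1.
  have [z hz] := fn p.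
  have [p' [hp' _]] := predual_lift f'ci f'n z ltr01.
  have [p'' hp''] := normal_map_sandwich (op s) (adj (op t)) p'.
  have [z' hz'] := gn p''; exists z' => c.
  by rewrite -hp hz hp' kcE hp'' hz'.
have sumw I (r : seq I) (F : I -> C -> R[i]) : (forall i, wfun (F i)) ->
    wfun (fun c => \sum_(i <- r) F i c).
  move=> Fw; elim: r => [|i r IH].
    by exists 0 => c; rewrite big_nil -(scale0r (0 : predual C)) dualZ mul0r.
  have [z hz] := wfun_comb 1 (Fw i) IH.
  by exists z => c; rewrite big_cons -hz mul1r.
by apply: (sumw) => t; apply: (sumw) => t'; exact: term.
Qed.

Let ghat_bound c x : rnorm (ghat c x) <= norm1 c * rnorm x.
Proof.
have n0 := alg_norm1_ge0 gci c.
have [M M0 gM0] := bop_bound (ghat c).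
apply/ler_addgt0Pr => e e0.
pose d := e / (norm1 c + M + 1); have Z1 : 0 < norm1 c + M + 1 by lra.
have d0 : 0 < d by rewrite divr_gt0.
have [l hl] := hinj_dense x d0.
rewrite (_ : ghat c x = ghat c (hinj l) + ghat c (x - hinj l)); last by rewrite linearB addrC subrK.
apply: le_trans (rnormD _ _) _.
have h1 : rnorm (ghat c (hinj l)) <= norm1 c * (rnorm x + d).
  rewrite ghat_hinj rnorm_hcompl; apply: hc_norm_le => [|y].
    by rewrite mulr_ge0// addr_ge0 ?rnorm_ge0// ltW.
  apply: le_trans (kf_bound1 _ _ _) _; rewrite ler_wpM2r ?pnorm_ge0// ler_wpM2l//.
  rewrite -rnorm_hinj (_ : hinj l = x + - (x - hinj l)); last by rewrite opprB addrC subrK.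
  by apply: le_trans (rnormD _ _) _; rewrite lerD2l rnormN ltW.
have h2 : rnorm (ghat c (x - hinj l)) <= M * d.
  by apply: le_trans (gM0 _) _; rewrite ler_wpM2l// ltW.
have -> : e = norm1 c * d + M * d + d by rewrite /d; field; rewrite gt_eqF.
lra.
Qed.

(** The bound on [ghat c] is linear in the norm of [c], so moving [x] and [y] to vectors given by
    lists changes the coefficient by a small multiple of [norm1 c], as [wapprox] asks. *)
Let dot_wfun (x y : E) : wfun (fun c => hdot (ghat c x) y).
Proof.
have bnd z w c : cabs (hdot (ghat c z) w) <= norm1 c * rnorm z * rnorm w.
  by apply: le_trans (hdot_CS _ _) _; rewrite ler_wpM2r ?rnorm_ge0// ghat_bound.
have c0 : 0 < rnorm x * rnorm y + 1 by rewrite ltr_wpDl// mulr_ge0// rnorm_ge0.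
apply: (wapprox_wfun gci gn c0); last first.
  move=> c; apply: le_trans (bnd _ _ _) _; rewrite -mulrA mulrC ler_wpM2r ?lerDl//.
  exact: alg_norm1_ge0 gci c.
move=> e e0.
pose d := Num.min 1 (e / (rnorm x + rnorm y + 1)).
have x0 := rnorm_ge0 x; have y0 := rnorm_ge0 y.
have Z1 : 0 < rnorm x + rnorm y + 1 by lra.
have d0 : 0 < d by rewrite lt_min ltr01 divr_gt0.
have d1 : d <= 1 by rewrite ge_min lexx.
have dZ : d * (rnorm x + rnorm y + 1) <= e.
  by rewrite -ler_pdivlMr// ge_min lexx orbT.
have [l hl] := hinj_dense x d0; have [l' hl'] := hinj_dense y d0.
have [z hz] := kf_wfun l l'; exists z => c; rewrite -hz -ghat_dot.
rewrite (_ : _ - _ = hdot (ghat c (x - hinj l)) y + hdot (ghat c (hinj l)) (y - hinj l')).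
  apply: le_trans (cabsD _ _) _; apply: le_trans (lerD (bnd _ _ _) (bnd _ _ _)) _.
  rewrite -!mulrA -mulrDr mulrC ler_wpM2r ?(alg_norm1_ge0 gci)//.
  have nl : rnorm (hinj l) <= rnorm x + 1.
    rewrite (_ : hinj l = x + - (x - hinj l)); last by rewrite opprB addrC subrK.
    apply: le_trans (rnormD _ _) _; rewrite rnormN; move: hl d1; lra.
  apply: le_trans dZ; have n1 := rnorm_ge0 (x - hinj l); have n2 := rnorm_ge0 (y - hinj l').
  have : rnorm (x - hinj l) * rnorm y <= d * rnorm y by rewrite ler_wpM2r// ltW.
  have : rnorm (hinj l) * rnorm (y - hinj l') <= (rnorm x + 1) * d.
    by rewrite ler_pM ?rnorm_ge0// ltW.
  lra.
by rewrite linearB hdotBl hdotBr; ring.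
Qed.

Let ghat_wnormal : wnormal ghat.
Proof.
move=> p; have [N1 hN1] := normal_fun_unif p ltr01.
have part n : wfun (fun c => nfun_part p n (ghat c)).
  elim: n => [|n [z hz]].
    by exists 0 => c; rewrite /nfun_part big_geq// -(scale0r (0 : predual C)) dualZ mul0r.
  have [z' hz'] := wfun_comb 1 (dot_wfun (p.1 n) (p.2 n)) (ex_intro _ z hz).
  by exists z' => c; rewrite -hz' /nfun_part big_nat_recr//= mul1r addrC.
have [z hz] := part N1.
have c0 : 0 < 1 + norm1 z + 1 by have := op_norm1_ge0 z; lra.
apply: (wapprox_wfun gci gn c0).
  move=> e e0; have [n hn] := normal_fun_unif p e0.
  have [z' hz'] := part n; exists z' => c; rewrite -hz' mulrC.
  by apply: hn => //; exact: (alg_norm1_ge0 gci c).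
move=> c; have n0 := alg_norm1_ge0 gci c.
rewrite (_ : normal_fun (ghat c) p = (normal_fun (ghat c) p - nfun_part p N1 (ghat c)) +
  nfun_part p N1 (ghat c)); last by ring.
apply: le_trans (cabsD _ _) _.
have h1 := hN1 N1 (ghat c) (norm1 c) (leqnn _) n0 (ghat_bound c).
have h2 : cabs (nfun_part p N1 (ghat c)) <= norm1 c * norm1 z by rewrite hz to_dual_le.
move: h1 h2; lra.
Qed.

(** For fixed [c] both sides are w*-continuous in [c'], so it is enough to test generators, for
    which [ghat_gen] and [core] reduce the identity to one in [B]. *)
Let ghatM c c' : ghat (c * c') = bcomp (ghat c) (ghat c').
Proof.
pose Q := [set c' | ghat (c * c') = bcomp (ghat c) (ghat c')].
have gc' : range g (g c') by exists c'.
case: (gN) => _ gE _; move: gc'; rewrite gE.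
apply: (@nrep_wspan_ind _ _ _ _ gr _ Q).
- split; first by rewrite /Q /= mulr0 !linear0 bcomp0r.
  move=> a x y; rewrite /Q /= => hx hy.
  by rewrite mulrDr -scalerAr !linearP /= hx hy bcompPr.
- move=> b' Qb; rewrite /Q /=.
  apply: bop_inj => x; apply: hdot_inj => y.
  have [p hp] := normal_of_list [:: (x, y)].
  have {}hp T : normal_fun T p = hdot (T x) y by rewrite hp /lfun big_seq1.
  rewrite -!hp.
  have := @wfun_closure_eq _ C (fun d : C => normal_fun (ghat (c * d)) p)
    (fun d : C => normal_fun (bcomp (ghat c) (ghat d)) p) Q b'.
  apply=> //.
  + exact: (wfun_mull gr c (ghat_wnormal p)).
  + have [p' hp'] := normal_map_sandwich (ghat c) (bid E) p.
    have [z hz] := ghat_wnormal p'; exists z => d.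
    by rewrite -hz -hp' bcomp_idr.
  + by move=> d; rewrite /Q /= => ->.
move=> _ [m1 [_ [m2 [Nm1 [b _ <-] Nm2 ->]]]].
have [d gd ghd] := ghat_gen (exist _ _ Nm1) b (exist _ _ Nm2).
exists d => //; rewrite /Q /= ghd; apply: eq_nst => v u; rewrite core.
rewrite [RHS](_ : _ = bcomp (bcomp (nhat v) (bcomp (ghat c) (nst (exist _ _ Nm1))))
  (bcomp (f b) (bcomp (nhat (exist _ _ Nm2)) (nst u)))); last exact: bop_inj.
rewrite core core1 -!fM; congr (f _); apply: kc_eq.
by rewrite !f'M !kcE g1 gM gd; exact: bop_inj.
Qed.

Let kform' := kform f' kc.

(** A vector orthogonal to all [adj n y] is annihilated by [N], hence by the generators of the range
    of [g], hence by the identity, which lies in their w*-closed span. *)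
Let L_dense x (e : R) : 0 < e ->
  exists2 y, (exists l : seq (sN * K'), y = \sum_(t <- l) adj (op t.1) t.2) & rnorm (x - y) < e.
Proof.
move=> e0; pose W := [set y | exists l : seq (sN * K'), y = \sum_(t <- l) adj (op t.1) t.2].
have Ws : is_subspace W.
  split; first by exists [::]; rewrite big_nil.
  move=> a _ _ [l ->] [l' ->]; exists ([seq (t.1, a *: t.2) | t <- l] ++ l').
  rewrite big_cat big_map scaler_sumr; congr (_ + _); apply: eq_bigr => t _ /=.
  by rewrite bop_scal.
have [||w [[u Wu uw] hw]] := @riesz_subspace R L W (fun y => hdot y x) (rnorm x) Ws.
- by move=> a y z; rewrite hdotDl hdotZl.
- by move=> y _; rewrite mulrC; exact: hdot_CS.
have xw : x = w.
  apply/subr0_eq; set z := x - w.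
  have zW y : W y -> hdot y z = 0 by move=> Wy; rewrite /z hdotBr hw// subrr.
  have nz (n : bop L K') : N n -> n z = 0.
    move=> Nn; apply: hdot_inj => y; rewrite hdot0l adjP hdotC zW ?conjc0//.
    by exists [:: (exist _ _ Nn, y)]; rewrite big_seq1.
  have : range g (bid L) by exists 1.
  case: (gN) => _ -> _ hid.
  have /hdot_inj -> // : forall y, hdot z y = hdot 0 y.
  move=> y; have [p hp] := normal_of_list [:: (z, y)].
  have {}hp T : normal_fun T p = hdot (T z) y by rewrite hp /lfun big_seq1.
  rewrite hdot0l -[LHS]/(hdot (bid L z) y) -hp; apply: cabs_eq0.
  apply/eqP; rewrite eq_le cabs_ge0 andbT; apply/ler_addgt0Pr => d d0; rewrite add0r.
  have [T lT /(_ ord0)] := wstar_closure (fun _ : 'I_1 => p) hid d0.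
  suff -> : normal_fun T p = 0 by rewrite sub0r cabsN => /ltW.
  rewrite hp; suff -> : T z = 0 by rewrite hdot0l.
  have [n [a [S [hS ->]]]] := lT; rewrite bop_sumE big1// => i _.
  have [m1 [b [m2 [_ _ Nm2 ->]]]] := hS i.
  by rewrite bopZE /= nz// !linear0 ?scaler0.
have /rnorm_cvgP/(_ _ e0)[k /(_ k (leqnn _)) hk] := uw.
by exists (u k); [exact: Wu | rewrite xw rnormB].
Qed.

(** [kform_bound] is used in both directions: from [f'] to [f] it bounds [ghat] by [g], and with [f]
    and [f'] exchanged, [nhat] in place of [N] and [ghat] in place of [g], it gives the reverse.
    Both estimates are tested on sums of elementary tensors, dense in [E] and by [L_dense] in
    [L]. *)
Let ghat_ci : complete_isometry ghat.
Proof.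
move=> m c; apply/eqP; rewrite eq_le; apply/andP; split.
  pose D := [set x : E | exists l : indP, x = hinj l].
  have Dd (x : E) (e : R) : 0 < e -> exists2 y, D y & rnorm (x - y) < e.
    by move=> /(hinj_dense x)[l hl]; exists (hinj l) => //; exists l.
  apply: (mxnorm_dense _ Dd Dd); first by rewrite -gci mxnorm_bop_ge0.
  move=> v w Dv Dw.
  pose l i := sval (cid (Dv i)); have lE i : v i = hinj (l i) by rewrite /l; case: cid.
  pose l' i := sval (cid (Dw i)); have l'E i : w i = hinj (l' i) by rewrite /l'; case: cid.
  have -> : v = (fun i => hinj (l i)) by apply/funext => i.
  have -> : w = (fun i => hinj (l' i)) by apply/funext => i.
  apply: le_trans (kf_bound c l l'); rewrite le_eqVlt; apply/orP; left; apply/eqP.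
  congr cabs; apply: eq_bigr => i _; apply: eq_bigr => j _.
  by rewrite mxE ghat_dot.
rewrite -gci.
pose D := [set y : L | exists l : seq (sN * K'), y = \sum_(t <- l) adj (op t.1) t.2].
apply: (@mxnorm_dense _ _ _ _ _ _ D D); [exact: mxnorm_bop_ge0|exact: L_dense|exact: L_dense|].
move=> v w Dv Dw.
pose l i := sval (cid (Dv i)).
have lE i : v i = \sum_(t <- l i) adj (op t.1) t.2 by rewrite /l; case: cid.
pose l' i := sval (cid (Dw i)).
have l'E i : w i = \sum_(t <- l' i) adj (op t.1) t.2 by rewrite /l'; case: cid.
have kE d k k' : kform' d k k' =
    hdot (g d (\sum_(t <- k) adj (op t.1) t.2)) (\sum_(t <- k') adj (op t.1) t.2).
  rewrite (linear_sum (g d)) hdot_suml; apply: eq_bigr => t _.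
  rewrite hdot_sumr; apply: eq_bigr => t' _.
  by rewrite kcE /= -adjP.
have := @kform_bound _ _ _ _ f f' 1 fci f'ci f1 f'1 _ 1 sN s0 kc kc0l kc0r E
  nhat ghat ghat1 _ m c l l'.
have sq k : Re (kform' 1 k k) = rnorm (\sum_(t <- k) adj (op t.1) t.2) ^+ 2.
  by rewrite kE g1 rnorm_sqr.
rewrite -/kform' => h; apply: le_trans (le_trans (h _) _).
- rewrite le_eqVlt; apply/orP; left; apply/eqP; congr cabs.
  apply: eq_bigr => i _; apply: eq_bigr => j _.
  by rewrite kE mxE lE l'E.
- by move=> s d t; rewrite /nhat adjK core.
rewrite le_eqVlt; apply/orP; left; apply/eqP; congr (_ * _ * _);
  rewrite /l2norm; congr Num.sqrt; apply: eq_bigr => i _; rewrite sq.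
  by rewrite lE.
by rewrite l'E.
Qed.

Lemma ghat_nrep : nrep ghat.
Proof.
split; [exact: ghatM | exact: ghat_ci | exact: ghat_wnormal | exact: ghat1].
Qed.

(** Generation by [N] is a fact about [g]; [nrep_transport] moves it to [ghat], whose values on the
    generators are known. The converse inclusion needs the range of [ghat] to be w*-closed. *)
Lemma induced_corner : corner_equiv (range ghat) (range f) Nhat.
Proof.
case: (gN) => _ gE _; split; first exact: Nhat_TRO.
  apply/seteqP; split.
    move=> _ [c _ <-].
    apply: (nrep_transport gr ghat_wnormal (X := [set T | exists m1 a m2,
      [/\ N m1, range f' a, N m2 & T = bcomp (adj m1) (bcomp a m2)]])); last first.
      by rewrite -gE; exists c.
    move=> _ [m1 [_ [m2 [Nm1 [b _ <-] Nm2 ->]]]].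
    have [d gd ghd] := ghat_gen (exist _ _ Nm1) b (exist _ _ Nm2).
    exists d => //; exists (nhat (exist _ _ Nm1)), (f b), (nhat (exist _ _ Nm2)).
    split; [by exists (exist _ _ Nm1)|by exists b|by exists (exist _ _ Nm2)|].
    by rewrite ghd /nhat adjK.
  apply: wspan_min; [exact: range_subspace | exact: nrep_range_closed ghat_nrep |].
  move=> _ [_ [_ [_ [[s _ <-] [b _ <-] [t _ <-] ->]]]].
  by have [d _ ghd] := ghat_gen s b t; exists d => //; rewrite ghd /nhat adjK.
move=> _ _ _ [s _ <-] [c _ <-] [t _ <-].
by exists (kc s c t) => //; rewrite /nhat adjK core.
Qed.

End Induced.

Lemma induced_rep (R : realType) (B C : dualOpAlgType R) (K' K L : hilbertType R)
    (f' : {linear B -> bop K' K'}) (f : {linear B -> bop K K})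
    (g : {linear C -> bop L L}) (N : set (bop L K')) :
  nrep f' -> nrep f -> nrep g -> corner_equiv (range g) (range f') N ->
  exists (E : hilbertType R) (h : {linear C -> bop E E}) (N' : set (bop E K)),
    nrep h /\ corner_equiv (range h) (range f) N'.
Proof.
move=> f'r fr gr gN.
eexists; eexists; eexists.
by split; [exact: (ghat_nrep f'r fr gr gN) | exact: induced_corner].
Qed.

(** * The unit of a TRO *)

Section NormalSquares.
Context {R : realType}.
Implicit Types H K : hilbertType R.
Local Notation Re := (@complex.Re R).

(** The component of [x] is characterised by two orthogonality conditions that determine it
    uniquely. Linearity, idempotence and the action on [W] are read off from uniqueness. *)
Lemma subspace_proj H (W : set H) : is_subspace W -> exists r : bop H H,
  [/\ adj r = r, bcomp r r = r, forall y, W y -> r y = y &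
      forall x (e : R), 0 < e -> exists2 y, W y & rnorm (r x - y) < e].
Proof.
move=> Ws; pose orth z := forall y, W y -> hdot y z = 0.
pose dec x w := orth (x - w) /\ forall z, orth z -> hdot w z = 0.
have dec_ex x : exists w, dec x w /\
    forall e : R, 0 < e -> exists2 y, W y & rnorm (w - y) < e.
  have [||w [[u Wu uw] hw]] := @riesz_subspace R H W (fun y => hdot y x) (rnorm x) Ws.
  - by move=> a y z; rewrite hdotDl hdotZl.
  - by move=> y _; rewrite mulrC; exact: hdot_CS.
  have near (e : R) : 0 < e -> exists2 y, W y & rnorm (w - y) < e.
    move=> e0; have /rnorm_cvgP/(_ _ e0)[k /(_ k (leqnn _)) hk] := uw.
    by exists (u k) => //; rewrite rnormB.
  exists w; split=> //; split=> [y Wy|z oz]; first by rewrite hdotBr hw// subrr.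
  apply: cabs_eq0; apply/eqP; rewrite eq_le cabs_ge0 andbT.
  apply: (@real_le0_of_eps _ _ (rnorm z)) => e e0; have [y Wy hy] := near e e0.
  rewrite (_ : hdot w z = hdot (w - y) z); last by rewrite hdotBl (oz y Wy) subr0.
  by apply: le_trans (hdot_CS _ _) _; rewrite ler_wpM2r ?rnorm_ge0// ltW.
have dec_uniq x w w' : dec x w -> dec x w' -> w = w'.
  move=> [o1 h1] [o2 h2]; apply/subr0_eq.
  have od : orth (w - w').
    move=> y Wy; rewrite (_ : w - w' = (x - w') - (x - w)).
      by rewrite hdotBr o1// o2// subrr.
    by rewrite opprB [RHS]addrC addrA subrK.
  have : hdot (w - w') (w - w') = 0 by rewrite hdotBl h1// h2// subrr.
  by rewrite hdotxxE => -[] /eqP; rewrite sqrf_eq0 => /eqP/rnorm_eq0.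
pose r0 x := sval (cid (dec_ex x)).
have r0P x : dec x (r0 x) by rewrite /r0; case: cid => w [].
have r0_near x (e : R) : 0 < e -> exists2 y, W y & rnorm (r0 x - y) < e.
  by have [_ h] := svalP (cid (dec_ex x)); exact: h.
have r0l : linear r0.
  move=> a x y; apply: dec_uniq (r0P _) _; have [o1 h1] := r0P x; have [o2 h2] := r0P y.
  split=> [z Wz|z oz]; last by rewrite hdotDl hdotZl h1// h2// mulr0 addr0.
  rewrite (_ : _ - _ = a *: (x - r0 x) + (y - r0 y)).
    by rewrite hdotDr hdotZr o1// o2// mulr0 addr0.
  by rewrite scalerBr opprD !addrA; congr (_ - _); rewrite addrAC.
have [r rE] : exists r : bop H H, r = r0 :> (H -> H).
  apply: (@bopP _ _ _ _ 1) => // x; rewrite mul1r.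
  have [o h] := r0P x; set w := r0 x in o h *.
  have [w0|w0] := eqVneq (rnorm w) 0; first by rewrite w0 rnorm_ge0.
  rewrite -(@ler_pM2l _ (rnorm w)) ?lt0r ?w0 ?rnorm_ge0// -expr2 rnorm_sqr.
  rewrite (_ : hdot w w = hdot w x).
    exact: le_trans (Re_le_cabs _) (hdot_CS _ _).
  by apply/esym/subr0_eq; rewrite -hdotBr h.
exists r; split.
- apply: adj_unique => x y; rewrite rE.
  have [ox hx] := r0P x; have [oy hy] := r0P y.
  transitivity (hdot (r0 x) (r0 y)).
    by apply/subr0_eq; rewrite -hdotBr hx.
  by apply/esym/subr0_eq; rewrite -hdotBl hdotC hy// conjc0.
- apply: bop_inj => x /=; rewrite rE; apply: dec_uniq (r0P _) _; split.
    by move=> y _; rewrite subrr hdot0r.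
  by case: (r0P x).
- move=> y Wy; rewrite rE; apply: dec_uniq (r0P _) _; split=> [z _|z]; last exact.
  by rewrite subrr hdot0r.
- by rewrite rE.
Qed.

Lemma normal_fun_adj H K (x : sqsum H) (y : sqsum K) (T : bop H K) :
  normal_fun (adj T) (y, x) = ((normal_fun T (x, y))^*)%C.
Proof.
apply/subr0_eq/cabs_eq0/eqP; rewrite eq_le cabs_ge0 andbT.
apply/ler_addgt0Pr => e e0; rewrite add0r; have e2 : 0 < e / 2 by rewrite divr_gt0.
have [N1 h1] := normal_fun_lim (y, x) (adj T) e2.
have [N2 h2] := normal_fun_lim (x, y) T e2.
have := h2 (maxn N1 N2) (leq_maxr _ _); have := h1 (maxn N1 N2) (leq_maxl _ _).
set n := maxn _ _; have -> : nfun_part (y, x) n (adj T) = ((nfun_part (x, y) n T)^*)%C.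
  rewrite /nfun_part raddf_sum; apply: eq_bigr => k _ /=.
  by rewrite adjPl hdotC.
set a := normal_fun _ _; set b := normal_fun _ _; set c := nfun_part _ _ _ => ha hb.
rewrite (_ : _ - _ = (a - (c^*)%C) - ((b - c)^*)%C); last by rewrite rmorphB /=; ring.
by apply: le_trans (cabsD _ _) _; rewrite cabsN cabs_conj; lra.
Qed.

Lemma nfun_part_square H K (x : sqsum H) n (T : bop H K) :
  nfun_part (x, x) n (bcomp (adj T) T) = (\sum_(0 <= k < n) rnorm (T (x k)) ^+ 2)%:C%C.
Proof.
by rewrite rmorph_sum /=; apply: eq_bigr => k _; rewrite /= adjPl hdotxxE.
Qed.

Lemma normal_fun_square_le H K (x : sqsum H) (T : bop H K) n :
  \sum_(0 <= k < n) rnorm (T (x k)) ^+ 2 <=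
  Re (normal_fun (bcomp (adj T) T) (x, x)).
Proof.
apply/ler_addgt0Pr => e e0.
have [N hN] := normal_fun_lim (x, x) (bcomp (adj T) T) e0.
have := hN (maxn N n) (leq_maxl _ _); rewrite nfun_part_square cabsB.
move=> /(le_lt_trans (Re_le_cabs _)); rewrite ReB /= ltrBlDl => /ltW.
apply: le_trans; rewrite (big_cat_nat (leq0n n) (leq_maxr N n)) /= lerDl.
by apply: sumr_ge0 => k _; rewrite sqr_ge0.
Qed.

Lemma normal_fun_square_ge H K (x : sqsum H) (T : bop H K) (C : R) :
  (forall n, \sum_(0 <= k < n) rnorm (T (x k)) ^+ 2 <= C) ->
  Re (normal_fun (bcomp (adj T) T) (x, x)) <= C.
Proof.
move=> h; apply/ler_addgt0Pr => e e0.
have [N hN] := normal_fun_lim (x, x) (bcomp (adj T) T) e0.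
have := hN N (leqnn _); rewrite nfun_part_square.
move=> /(le_lt_trans (Re_le_cabs _)); rewrite ReB /=; have := h N; lra.
Qed.

Lemma normal_fun_square_ge0 H K (x : sqsum H) (T : bop H K) :
  0 <= normal_fun (bcomp (adj T) T) (x, x).
Proof.
set z := normal_fun _ _; have zC : z = (z^*)%C.
  by rewrite -normal_fun_adj adj_comp adjK.
have := normal_fun_square_le x T 0; rewrite big_geq// -/z => z0.
by move: zC z0; case: z => a b /= [/eqP]; rewrite -addr_eq0 -mulr2n mulrn_eq0 /= => /eqP ->; rewrite lecR.
Qed.

Lemma normal_fun_square_mul H K (L : hilbertType R) (x : sqsum H) (S : bop K L)
    (T : bop H K) (C : R) : 0 <= C -> (forall y, rnorm (S y) <= C * rnorm y) ->
  Re (normal_fun (bcomp (adj (bcomp S T)) (bcomp S T)) (x, x)) <=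
  C ^+ 2 * Re (normal_fun (bcomp (adj T) T) (x, x)).
Proof.
move=> C0 SC; apply: normal_fun_square_ge => n.
apply: (@le_trans _ _ (C ^+ 2 * \sum_(0 <= k < n) rnorm (T (x k)) ^+ 2)).
  rewrite mulr_sumr; apply: ler_sum => k _; rewrite -exprMn.
  rewrite ler_pXn2r ?nnegrE ?mulr_ge0 ?rnorm_ge0//; exact: SC.
by rewrite ler_wpM2l ?sqr_ge0// normal_fun_square_le.
Qed.

(** The mean inequality with weight [d] splits each term so that only the tail of [y] has to be
    small. Hence [N] does not depend on [T], although no bound on the operator norm of [T] is
    assumed. *)
Lemma normal_fun_square_tail H K (x : sqsum H) (y : sqsum K) (C e : R) :
  0 <= C -> 0 < e -> exists N, forall T : bop H K,
    (forall n, \sum_(0 <= k < n) rnorm (T (x k)) ^+ 2 <= C) ->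
    cabs (normal_fun T (x, y) - nfun_part (x, y) N T) <= e.
Proof.
move=> C0 e0; pose d := e / (C + 1); have C1 : 0 < C + 1 by lra.
have d0 : 0 < d by rewrite divr_gt0.
have [|N hN] := sqsum_tail y (e := d * e); first by rewrite mulr_gt0.
exists N => T TC; apply/ler_addgt0Pr => z z0.
have [M hM] := normal_fun_lim (x, y) T z0.
have {hM} := hM (maxn M N) (leq_maxl _ _); set n := maxn M N => hn.
have Nn : (N <= n)%N by rewrite leq_maxr.
rewrite (_ : _ - _ = \sum_(N <= k < n) hdot (T (x k)) (y k) +
    (normal_fun T (x, y) - nfun_part (x, y) n T)); last first.
  by rewrite /nfun_part (big_cat_nat (leq0n N) Nn)/=; ring.
apply: le_trans (cabsD _ _) _; apply: lerD; last exact: ltW.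
apply: le_trans (cabs_sum _ _ _) _.
apply: (@le_trans _ _ (\sum_(N <= k < n) (d / 2 * rnorm (T (x k)) ^+ 2 +
    (2 * d)^-1 * rnorm (y k) ^+ 2))).
  apply: ler_sum => k _; apply: le_trans (hdot_CS _ _) _.
  set a := rnorm _; set b := rnorm _.
  rewrite -subr_ge0 (_ : _ - _ = (2 * d)^-1 * (d * a - b) ^+ 2).
    by rewrite mulr_ge0 ?sqr_ge0// invr_ge0 mulr_ge0// ltW.
  by field; rewrite gt_eqF.
rewrite big_split /= -!mulr_sumr.
have h1 : \sum_(N <= k < n) rnorm (T (x k)) ^+ 2 <= C.
  apply: le_trans (TC n); rewrite (big_cat_nat (leq0n N) Nn)/= lerDr.
  by apply: sumr_ge0 => k _; rewrite sqr_ge0.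
have h2 := ltW (hN N n (leqnn _) Nn).
have -> : e = d / 2 * (C + 1) + (2 * d)^-1 * (d * e).
  by rewrite /d; field; rewrite !gt_eqF.
apply: lerD; last by rewrite ler_wpM2l// invr_ge0 mulr_ge0// ltW.
by rewrite ler_wpM2l ?divr_ge0 ?(ltW d0)//; lra.
Qed.

Section SquareForm.
Variables (H K : hilbertType R) (m : nat) (xi : 'I_m -> sqsum H).

Let dot (T S : bop H K) := \sum_i (normal_fun (bcomp (adj S) T) (xi i, xi i) : R[i]).

Let dotDl x y z : dot (x + y) z = dot x z + dot y z.
Proof.
rewrite -big_split; apply: eq_bigr => i _ /=.
by rewrite -normal_funD -[x + y]scale1r -[in RHS](scale1r (bcomp _ x)) scalerDr -bcompPr !scale1r.
Qed.

Let dotZl a x z : dot (a *: x) z = a * dot x z.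
Proof.
rewrite mulr_sumr; apply: eq_bigr => i _ /=.
by rewrite -normal_funZ -[a *: x]addr0 bcompPr bcomp0r addr0.
Qed.

Let dotC x y : dot x y = ((dot y x)^*)%C.
Proof.
rewrite rmorph_sum; apply: eq_bigr => i _ /=.
by rewrite -normal_fun_adj adj_comp adjK.
Qed.

Let dot_ge0 x : 0 <= dot x x.
Proof. by apply: sumr_ge0 => i _; exact: normal_fun_square_ge0. Qed.

Definition squares : preHilbert R :=
  @PreHilbert R (bop H K) 0 +%R *:%R dot dotDl dotZl dotC dot_ge0.

Lemma squares_le (T : bop H K) i n :
  \sum_(0 <= k < n) rnorm (T (xi i k)) ^+ 2 <= Re (pdot (T : squares) (T : squares)).
Proof.
apply: le_trans (normal_fun_square_le _ _ _) _.
rewrite /= /dot (bigD1 i)//= ReD lerDl Re_sum.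
by apply: sumr_ge0 => j _; rewrite ge0_Re// normal_fun_square_ge0.
Qed.

Lemma squares_mul (S : bop K K) (T : bop H K) (C : R) :
  0 <= C -> (forall y, rnorm (S y) <= C * rnorm y) ->
  pnorm (bcomp S T : squares) <= C * pnorm (T : squares).
Proof.
move=> C0 SC; rewrite -(@ler_pXn2r _ 2%N)// ?nnegrE ?mulr_ge0 ?pnorm_ge0//.
rewrite exprMn !pnorm_sqr /= /dot !Re_sum mulr_sumr; apply: ler_sum => i _.
exact: normal_fun_square_mul.
Qed.

End SquareForm.

Definition tends0 (a : nat -> R[i]) :=
  forall e : R, 0 < e -> exists N, forall j, (N <= j)%N -> cabs (a j) < e.

Lemma tends0_lin a b c : tends0 a -> tends0 b -> tends0 (fun j => c * a j + b j).
Proof.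
move=> a0 b0 e e0; have c1 : 0 < cabs c + 1 by have := cabs_ge0 c; lra.
have d0 : 0 < e / (2 * (cabs c + 1)) by rewrite divr_gt0// mulr_gt0.
have [N1 h1] := a0 _ d0; have [|N2 h2] := b0 (e / 2); first by rewrite divr_gt0.
exists (maxn N1 N2) => j; rewrite geq_max => /andP[/h1 ha /h2 hb].
apply: le_lt_trans (cabsD _ _) _; rewrite cabsM.
have : cabs c * cabs (a j) <= (cabs c + 1) * (e / (2 * (cabs c + 1))).
  by rewrite ler_pM ?cabs_ge0 ?(ltW ha)// lerDl.
have -> : (cabs c + 1) * (e / (2 * (cabs c + 1))) = e / 2.
  by field; rewrite gt_eqF.
lra.
Qed.

Lemma tends0_sum I (r : seq I) (F : I -> nat -> R[i]) :
  (forall i, tends0 (F i)) -> tends0 (fun j => \sum_(i <- r) F i j).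
Proof.
move=> F0; elim: r => [|i r IH].
  by move=> e e0; exists 0%N => j _; rewrite big_nil cabs0.
move=> e e0; have [N hN] := tends0_lin 1 (F0 i) IH e0.
by exists N => j /hN; rewrite mul1r big_cons.
Qed.

Lemma tends0_approx a : (forall e : R, 0 < e -> exists2 b, tends0 b &
    forall j, cabs (a j - b j) <= e) -> tends0 a.
Proof.
move=> h e e0; have e2 : 0 < e / 2 by rewrite divr_gt0.
have [b b0 ab] := h _ e2; have [N hN] := b0 _ e2; exists N => j /hN hb.
rewrite -[a j](subrK (b j)); apply: le_lt_trans (cabsD _ _) _.
have := ab j; lra.
Qed.

End NormalSquares.

Section TROUnit.
Context {R : realType} (E H : hilbertType R) (U : set (bop E H)).
Hypothesis U_TRO : is_TRO U.
Local Notation Re := (@complex.Re R).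

Let UU : set (bop H H) := [set T | exists u v, [/\ U u, U v & T = bcomp u (adj v)]].
Let UE : set H := lspan [set y | exists u x, U u /\ y = u x].

(* The form [squares xi] plays the role of the inner product of the vectors
   [(T (xi i k))_(i, k)]; the almost-projections S of r on lspan UU satisfy
   [u^* (r - S) (xi i k) -> 0], hence [(r - S) (xi i k) -> 0] weakly. *)
Lemma TRO_unit : exists r : bop H H,
  [/\ adj r = r, bcomp r r = r, forall u, U u -> bcomp r u = u & wspan UU r].
Proof.
have [r [r_adj r_idem r_id r_near]] := subspace_proj (lspan_subspace _ : is_subspace UE).
have rU u : U u -> bcomp r u = u.
  by move=> Uu; apply: bop_inj => x; apply: r_id; apply: sub_lspan; exists u, x.
exists r; split=> //; apply: wstar_closureP => n p e e0.
pose xi k := (p k).1; pose P := squares H xi.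
have rUU S : lspan UU S -> bcomp r S = S.
  apply: (@lspan_min _ _ _ [set S | bcomp r S = S]).
    split=> [|a S1 S2 /= h1 h2]; first by rewrite /= bcomp0r.
    by rewrite bcompPr h1 h2.
  by move=> _ [u [v [Uu _ ->]]] /=; rewrite bcompA rU.
have uS u S : U u -> lspan UU S -> lspan UU (bcomp (bcomp u (adj u)) S).
  move=> Uu; apply: (@lspan_min _ _ _ [set S | lspan UU (bcomp (bcomp u (adj u)) S)]).
    have [s0 sl] := lspan_subspace UU.
    split=> [|a S1 S2 /= h1 h2]; first by rewrite /= bcomp0r.
    by rewrite bcompPr; exact: sl.
  move=> _ [v [w [Uv Uw ->]]] /=; apply: sub_lspan.
  exists (bcomp u (bcomp (adj u) v)), w; split=> //; last by rewrite !bcompA.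
  exact: U_TRO.2.
have W0 : lspan UU !=set0 by exists 0; case: (lspan_subspace UU).
have step j : exists2 S, lspan UU S & forall X, lspan UU X ->
    cabs (pdot (X : P) (psub (r : P) S)) <= j.+1%:R^-1 * pnorm (X : P).
  have ej : 0 < (j.+1%:R : R)^-1 by rewrite invr_gt0 ltr0n.
  have [|||||S lS hS] := @riesz_approx R P (lspan UU) (fun X => pdot X (r : P))
      (pnorm (r : P)) _ W0 _ _ _ _ _ ej.
  - by move=> x y; exact: subspaceD (lspan_subspace _).
  - by move=> a x; exact: subspaceZ (lspan_subspace _).
  - by move=> x y _ _; rewrite pdotDl.
  - by move=> a x _; rewrite pdotZl.
  - by move=> x _; rewrite mulrC; exact: pdot_CS.
  by exists S => // X lX; rewrite pdotBr; exact: hS.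
pose S j := sval (cid2 (step j)).
have lS j : lspan UU (S j) by rewrite /S; case: cid2.
pose T j : bop H H := psub (r : P) (S j).
have TE j : T j = r + (-1) *: S j by [].
have hT j X : lspan UU X -> cabs (pdot (X : P) (T j : P)) <= j.+1%:R^-1 * pnorm (X : P).
  by rewrite /T /S; case: cid2 => Sj lSj h; exact: h.
pose C := 2 * pnorm (r : P) + 1; have r0 := pnorm_ge0 (r : P).
have C0 : 0 <= C by rewrite /C; lra.
have TC j : pnorm (T j : P) <= C.
  have : pnorm (S j : P) <= pnorm (r : P) + 1.
    apply: pnorm_le_of_dot; last by rewrite addr_ge0.
    rewrite (_ : pdot _ _ = pdot (S j : P) (r : P) - pdot (S j : P) (T j : P)).
      apply: le_trans (cabsD _ _) _; rewrite cabsN mulrDl; apply: lerD.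
        by rewrite mulrC pdot_CS.
      apply: le_trans (hT _ _ (lS j)) _; rewrite ler_wpM2r ?pnorm_ge0//.
      by rewrite invf_le1 ?ltr0n// ler1n.
    by rewrite pdotBr opprB addrC subrK.
  have := pnormD (r : P) (pscal (-1) (S j : P)); rewrite pnormZ cabsN cabs1 mul1r.
  by rewrite -/(psub _ _) -/(T j) /C; lra.
have TC2 j i m : \sum_(0 <= k < m) rnorm (T j (xi i k)) ^+ 2 <= C ^+ 2.
  apply: le_trans (squares_le _ _ _ _) _; rewrite -pnorm_sqr.
  by rewrite ler_pXn2r// nnegrE pnorm_ge0.
have sq_term (F : nat -> R) k (D : R) : (forall k, 0 <= F k) ->
    \sum_(0 <= k < k.+1) F k <= D -> F k <= D.
  by move=> F0; apply: le_trans; rewrite big_nat_recr//= lerDr sumr_ge0.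
have Tpt j i k : rnorm (T j (xi i k)) <= C.
  rewrite -(@ler_pXn2r _ 2%N)// ?nnegrE ?rnorm_ge0//.
  apply: (sq_term (fun k => rnorm (T j (xi i k)) ^+ 2)) => [l|]; first exact: sqr_ge0.
  exact: TC2.
have uT u : U u -> exists2 D : R, 0 <= D & forall j i k,
    rnorm (adj u (T j (xi i k))) ^+ 2 <= j.+1%:R^-1 * D.
  move=> Uu; have [M M0 hM] := bop_bound (bcomp u (adj u)).
  exists (M * C) => [|j i k]; first by rewrite mulr_ge0.
  (* [X] lies in [lspan UU] although [T j] need not, because [adj u] absorbs [r]. Testing the
     almost-orthogonality of [T j] against [X] produces exactly the squares of
     [adj u (T j (xi i k))]. *)
  pose X := bcomp (bcomp u (adj u)) (T j).
  have lX : lspan UU X.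
    rewrite /X TE addrC bcompPr; apply: (lspan_subspace UU).2; first exact: uS.
    have -> : bcomp (bcomp u (adj u)) r = bcomp u (adj u).
      by rewrite -bcompA -{1}r_adj -adj_comp rU.
    by apply: sub_lspan; exists u, u.
  apply: (sq_term (fun k => rnorm (bcomp (adj u) (T j) (xi i k)) ^+ 2)) => [l|].
    exact: sqr_ge0.
  apply: le_trans (squares_le _ _ _ _) _; apply: le_trans (Re_le_cabs _) _.
  rewrite (_ : pdot _ _ = pdot (X : P) (T j : P)).
    apply: le_trans (hT j _ lX) _; rewrite ler_wpM2l ?invr_ge0//.
    by apply: le_trans (squares_mul _ _ M0 hM) _; rewrite ler_wpM2l.
  apply: eq_bigr => l _; congr (normal_fun _ _).
  by rewrite adj_comp adjK /X !bcompA.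
(* Vectors [u y] are covered by [uT], their span by linearity, and the range of [r] by density and
   the uniform bound [Tpt]. Finally [x] may be replaced by [r x], since [T j] has its values in the
   range of [r]. *)
have weak i k x : tends0 (fun j => hdot (T j (xi i k)) x).
  have Wx : forall y, UE y -> tends0 (fun j => hdot (T j (xi i k)) y).
    apply: (@lspan_min _ _ _ [set y | tends0 (fun j => hdot (T j (xi i k)) y)]).
      split=> [|a y z /= h1 h2].
        by move=> d d0; exists 0%N => j _; rewrite hdot0r cabs0.
      move=> d d0; have [N hN] := tends0_lin (a^*)%C h1 h2 d0.
      by exists N => j /hN; rewrite hdotDr hdotZr.
    move=> _ [u [y [Uu ->]]] d d0; have [D D0 hD] := uT u Uu.
    have y0 : 0 < rnorm y + 1 by have := rnorm_ge0 y; lra.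
    have d'0 : 0 < d / (rnorm y + 1) by rewrite divr_gt0.
    have D1 : 0 < D + 1 by lra.
    have [|N hN] := @invSn_lt R ((d / (rnorm y + 1)) ^+ 2 / (D + 1)).
      by rewrite divr_gt0// exprn_gt0.
    exists N => j Nj; rewrite -adjPl; apply: le_lt_trans (hdot_CS _ _) _.
    apply: (@le_lt_trans _ _ (d / (rnorm y + 1) * rnorm y)); last first.
      by rewrite mulrAC ltr_pdivrMr// ltr_pM2l// ltrDl.
    rewrite ler_wpM2r ?rnorm_ge0// -(@ler_pXn2r _ 2%N)// ?nnegrE ?rnorm_ge0 ?(ltW d'0)//.
    apply: le_trans (hD j i k) _; have /ltW hj := hN j Nj.
    apply: (@le_trans _ _ ((d / (rnorm y + 1)) ^+ 2 / (D + 1) * (D + 1))).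
      by rewrite ler_pM ?invr_ge0// lerDl.
    by rewrite divfK// gt_eqF.
  apply: tends0_approx => d d0; have C1 : 0 < C + 1 by lra.
  have [|y Wy hy] := r_near x (d / (C + 1)); first by rewrite divr_gt0.
  exists (fun j => hdot (T j (xi i k)) y); first exact: Wx.
  move=> j; have -> : hdot (T j (xi i k)) x = hdot (T j (xi i k)) (r x).
    have -> : T j = bcomp r (T j) by rewrite TE addrC bcompPr r_idem rUU.
    transitivity (hdot (bcomp r (bcomp r (T j)) (xi i k)) x); first by rewrite bcompA r_idem.
    by rewrite /= adjP r_adj.
  rewrite -hdotBr; apply: le_trans (hdot_CS _ _) _.
  apply: (@le_trans _ _ (C * (d / (C + 1)))); first by rewrite ler_pM ?rnorm_ge0 ?(ltW hy).
  by rewrite mulrCA ger_pMr// ler_pdivrMr ?mul1r// lerDl.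
have nT i : tends0 (fun j => normal_fun (T j) (p i)).
  apply: tends0_approx => d d0.
  have [N hN] := @normal_fun_square_tail R H H (xi i) (p i).2 _ _ (sqr_ge0 C) d0.
  exists (fun j => nfun_part (p i) N (T j)); first by apply: tends0_sum => k; exact: weak.
  by move=> j; have := hN (T j) (TC2 j i); rewrite /xi -surjective_pairing.
pose N i := sval (cid (nT i e e0)).
have hN i j : (N i <= j)%N -> cabs (normal_fun (T j) (p i)) < e.
  by rewrite /N; case: cid => M; apply.
pose j := (\max_(i < n) N i)%N; exists (S j) => // i.
have := hN i j (leq_bigmax i); rewrite TE addrC normal_fun_linear mulN1r addrC cabsB.
by rewrite -cabsN opprB.
Qed.

End TROUnit.

(** * Composition of corner equivalences *)

Section Transitivity.
Context {R : realType} (E K H : hilbertType R).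
Variables (C : set (bop E E)) (B : set (bop K K)) (A : set (bop H H)).
Variables (N : set (bop E K)) (M : set (bop K H)).
Hypotheses (C1 : C (bid E)) (A_alg : unital_wclosed_algebra A).
Hypotheses (B_alg : unital_wclosed_algebra B).
Hypotheses (CB : corner_equiv C B N) (BA : corner_equiv B A M).

Let diag (b : bop K K) := B b /\ B (adj b).
(** The middle factor makes the span closed under triple products: there [n n'^*] and [m'^* m3]
    appear between the outer factors, and both belong to the diagonal of [B], the one because [C] is
    unital, the other because [A] is. *)
Let gen : set (bop E H) :=
  [set u | exists m d n, [/\ M m, diag d, N n & u = bcomp m (bcomp d n)]].
Let U := lspan gen.

Let BM b c : B b -> B c -> B (bcomp b c). Proof. by case: B_alg => _ h _ _; exact: h. Qed.
Let M_TRO : is_TRO M. Proof. by case: BA. Qed.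
Let N_TRO : is_TRO N. Proof. by case: CB. Qed.

Let B_gen m1 a m2 : M m1 -> A a -> M m2 -> B (bcomp (adj m1) (bcomp a m2)).
Proof. by case: BA => _ -> _ *; apply: sub_wspan; exists m1, a, m2. Qed.

Let C_gen n1 b n2 : N n1 -> B b -> N n2 -> C (bcomp (adj n1) (bcomp b n2)).
Proof. by case: CB => _ -> _ *; apply: sub_wspan; exists n1, b, n2. Qed.

Let diagM d d' : diag d -> diag d' -> diag (bcomp d d').
Proof. by move=> [d1 d2] [d1' d2']; split; rewrite ?adj_comp; exact: BM. Qed.

Let diag_adj d : diag d -> diag (adj d).
Proof. by move=> [d1 d2]; split; rewrite ?adjK. Qed.

Let diag1 : diag (bid K).
Proof. by case: B_alg => _ _ h _; split; rewrite ?adj_bid. Qed.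

Let diag_NN n n' : N n -> N n' -> diag (bcomp n (adj n')).
Proof.
move=> Nn Nn'; case: CB => _ _ h; split; rewrite ?adj_comp ?adjK.
  by have := h _ _ _ Nn C1 Nn'; rewrite bcomp_idl.
by have := h _ _ _ Nn' C1 Nn; rewrite bcomp_idl.
Qed.

Let diag_MM m m' : M m -> M m' -> diag (bcomp (adj m) m').
Proof.
case: A_alg => _ _ A1 _ Mm Mm'; split; rewrite ?adj_comp ?adjK.
  by have := B_gen Mm A1 Mm'; rewrite bcomp_idl.
by have := B_gen Mm' A1 Mm; rewrite bcomp_idl.
Qed.

Let U_sub : is_subspace U. Proof. exact: lspan_subspace. Qed.

Let gen_U m d n : M m -> diag d -> N n -> U (bcomp m (bcomp d n)).
Proof. by move=> *; apply: sub_lspan; exists m, d, n. Qed.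

Let lin_ind (P : bop E H -> Prop) : is_subspace P ->
  (forall m d n, M m -> diag d -> N n -> P (bcomp m (bcomp d n))) -> forall u, U u -> P u.
Proof.
by move=> Ps h; apply: (@lspan_min _ _ _ P) => // _ [m [d [n [Mm dd Nn ->]]]]; exact: h.
Qed.

(** With [pull_r] this feeds [lin_ind], which replaces one factor of a product by generators at a
    time; an identity operator stands for [X] or [Y] when the factor is at an end. A condition on
    [adj u] is conjugate linear in [u] and still defines a subspace. *)
Let pull_l (F G : hilbertType R) (V : set (bop F G)) (X : bop H G) (Y : bop F E) :
  is_subspace V -> is_subspace [set u : bop E H | V (bcomp X (bcomp u Y))].
Proof.
move=> [V0 Vl]; split=> [|a u v hu hv]; rewrite /mkset.
  by rewrite bcomp0l bcomp0r.
by rewrite bcompPl bcompPr; exact: Vl.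
Qed.

Let pull_r (F G : hilbertType R) (V : set (bop F G)) (X : bop E G) (Y : bop F H) :
  is_subspace V -> is_subspace [set u : bop E H | V (bcomp X (bcomp (adj u) Y))].
Proof.
move=> [V0 Vl]; split=> [|a u v hu hv]; rewrite /mkset.
  by rewrite adj0 bcomp0l bcomp0r.
by rewrite adjPlin bcompPl bcompPr; exact: Vl.
Qed.

Let U_TRO : is_TRO U.
Proof.
split=> // u1 u2 u3 U1 U2 U3.
have := pull_l (bid H) (bcomp (adj u2) u3) U_sub; rewrite /mkset => s1.
suff : U (bcomp (bid H) (bcomp u1 (bcomp (adj u2) u3))) by rewrite bcomp_idl.
move: u1 U1; apply: (lin_ind s1) => m d n Mm dd Nn; rewrite /mkset bcomp_idl.
move: u2 U2 {s1}; apply: (lin_ind (pull_r _ _ U_sub)) => m' d' n' Mm' dd' Nn'.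
rewrite /mkset bcompA -[u3]bcomp_idr.
move: u3 U3; apply: (lin_ind (pull_l _ _ U_sub)) => m3 d3 n3 Mm3 dd3 Nn3.
rewrite /mkset bcomp_idr !adj_comp.
rewrite (_ : bcomp _ _ = bcomp m (bcomp (bcomp d (bcomp (bcomp n (adj n'))
  (bcomp (adj d') (bcomp (bcomp (adj m') m3) d3)))) n3)); last by exact: bop_inj.
apply: gen_U => //; apply: diagM => //; apply: diagM; first exact: diag_NN.
by apply: diagM; [exact: diag_adj | apply: diagM => //; exact: diag_MM].
Qed.

(** Describing [C] through [N] and [B], and then [B] through [M] and [A], presents [C] by products
    with the identity of [K] as diagonal factor. In the other two inclusions general diagonal
    factors are absorbed into [B]. *)
Lemma corner_trans : exists U' : set (bop E H), corner_equiv C A U'.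
Proof.
exists U; split; first exact: U_TRO.
  case: (CB) => _ CE _; case: (BA) => _ BE _.
  have Ws := wspan_subspace [set T | exists m1 a m2, [/\ U m1, A a, U m2 &
                           T = bcomp (adj m1) (bcomp a m2)]].
  have Wc := @wspan_closed _ _ _ [set T | exists m1 a m2, [/\ U m1, A a, U m2 &
                           T = bcomp (adj m1) (bcomp a m2)]].
  apply/seteqP; split.
    rewrite {1}CE; apply: wspan_min => // _ [n1 [b [n2 [Nn1 Bb Nn2 ->]]]].
    move: Bb; rewrite BE.
    apply: (@normal_map_wspan _ _ _ _ _ (fun T => bcomp (adj n1) (bcomp T n2))) => //.
    - by move=> a x y; rewrite bcompPl bcompPr.
    - exact: normal_map_sandwich.
    move=> _ [m1 [a [m2 [Mm1 Aa Mm2 ->]]]]; apply: sub_wspan.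
    exists (bcomp m1 (bcomp (bid K) n1)), a, (bcomp m2 (bcomp (bid K) n2)).
    split=> //; try exact: gen_U.
    by rewrite !bcomp_idl adj_comp; exact: bop_inj.
  apply: wspan_min; [rewrite CE; exact: wspan_subspace|rewrite CE; exact: wspan_closed|].
  move=> _ [u1 [a [u2 [U1 Aa U2 ->]]]].
  have Cs : is_subspace C by rewrite CE; exact: wspan_subspace.
  rewrite -[u2]bcomp_idr bcompA; move: u2 U2; apply: (lin_ind (pull_l _ _ Cs)).
  move=> m2 d2 n2 Mm2 dd2 Nn2; rewrite /mkset bcomp_idr -bcompA -[bcomp (adj u1) _]bcomp_idl.
  move: u1 U1; apply: (lin_ind (pull_r _ _ Cs)) => m1 d1 n1 Mm1 dd1 Nn1.
  rewrite /mkset bcomp_idl !adj_comp.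
  rewrite (_ : bcomp _ _ = bcomp (adj n1) (bcomp (bcomp (adj d1)
     (bcomp (bcomp (adj m1) (bcomp a m2)) d2)) n2)); last by exact: bop_inj.
  by apply: C_gen => //; apply: BM; [case: dd1|apply: BM; [exact: B_gen|case: dd2]].
move=> u1 c u2 U1 Cc U2; have As : is_subspace A by case: A_alg.
rewrite -[bcomp _ _]bcomp_idl; move: u1 U1; apply: (lin_ind (pull_l _ _ As)).
move=> m1 d1 n1 Mm1 dd1 Nn1; rewrite /mkset bcomp_idl.
rewrite -[adj u2]bcomp_idr bcompA.
move: u2 U2; apply: (lin_ind (pull_r _ _ As)) => m2 d2 n2 Mm2 dd2 Nn2.
rewrite /mkset bcomp_idr !adj_comp.
rewrite (_ : bcomp _ _ = bcomp m1 (bcomp (bcomp d1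
  (bcomp (bcomp n1 (bcomp c (adj n2))) (adj d2))) (adj m2))); last by exact: bop_inj.
case: BA => _ _; apply=> //; apply: BM; first by case: dd1.
by apply: BM; [case: CB => _ _; exact | case: dd2].
Qed.

End Transitivity.

(** * Corners and their projections *)

Section Corner.
Context {R : realType} (H : hilbertType R) (p : projection H).
Local Notation pH := (prange p).

(** [V] is the inclusion of the range. All later computations in the corner use only these three
    identities and never the vectors of [prange p]. *)
Lemma prange_incl_ex : exists V : bop pH H,
  [/\ bcomp V (adj V) = p, bcomp (adj V) V = bid pH &
      forall T, compress p T = bcomp (adj V) (bcomp T V)].
Proof.
have [V VE] : exists V : bop pH H, V = prange_val (p := p) :> (pH -> H).
  have Vb : is_bop (prange_val (p := p) : pH -> H).
    by apply/asboolP; split=> //; exact: prange_val_continuous.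
  by exists (Bop Vb).
have pV x : p (V x) = V x by apply/eqP; rewrite -in_prangeE VE; exact: prange_subproof.
have hV (x y : pH) : hdot (V x) (V y) = hdot x y by rewrite VE.
have aV : bcomp (adj V) V = bid pH.
  apply: bop_inj => x; apply: hdot_injr => y.
  by rewrite -[LHS]/(hdot y (adj V (V x))) -adjP hV.
have Va : bcomp V (adj V) = p.
  apply: bop_inj => x; apply: hdot_injr => y.
  have [z zE] : exists z : pH, V z = p y.
    have yP : in_prange p (p y) by rewrite in_prangeE Defs.projK.
    by exists (PRange yP); rewrite VE.
  have pd a b : hdot (p a) b = hdot a (p b) by rewrite -{1}(proj_adj p) adjPl.
  rewrite -pd -zE adjP -hV zE pd.
  by rewrite -[LHS]/(hdot y (V (adj V x))) pV.
exists V; split=> // T; apply: bop_inj => x.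
have Vinj (a b : pH) : V a = V b -> a = b by rewrite VE; exact: val_inj.
apply: Vinj; rewrite /= -[RHS]/(bcomp V (adj V) (T (V x))) Va -[in RHS](pV x).
by rewrite VE.
Qed.

End Corner.

Section TROSub.
Context {R : realType} (K H : hilbertType R).
Variables (B : set (bop K K)) (A : set (bop H H)).
Hypotheses (A_alg : unital_wclosed_algebra A).

Let AM S T : A S -> A T -> A (bcomp S T). Proof. by case: A_alg => _ h _ _; exact: h. Qed.

(** Composing the given TRO with the inclusion [V] makes it act into [H]. Its products with [B] then
    have the form [p a p], and these lie in [A] because [p] does. *)
Lemma TRO_sub_corner : TRO_sub B A -> exists M, corner_equiv B A M.
Proof.
move=> [p [Ap [M0 [[[M00 M0l] M0_TRO] BE AE]]]].
have [V [VVa VaV cE]] := prange_incl_ex p.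
have VaVl (F : hilbertType R) (X : bop F (prange p)) : bcomp (adj V) (bcomp V X) = X.
  by rewrite bcompA VaV bcomp_idl.
exists [set bcomp V m | m in M0]; split.
- split; first split.
  + by exists 0 => //; rewrite bcomp0r.
  + by move=> a _ _ [x Mx <-] [y My <-]; exists (a *: x + y); rewrite ?bcompPr//; exact: M0l.
  move=> _ _ _ [x Mx <-] [y My <-] [z Mz <-].
  exists (bcomp x (bcomp (adj y) z)); first exact: M0_TRO.
  by rewrite adj_comp -!bcompA VaVl.
- rewrite BE; congr wspan; apply/seteqP; split.
    move=> _ [m1 [_ [m2 [Mm1 [a Aa <-] Mm2 ->]]]].
    exists (bcomp V m1), a, (bcomp V m2); split=> //; [by exists m1|by exists m2|].
    by rewrite cE adj_comp -!bcompA.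
  move=> _ [_ [a [_ [[m1 Mm1 <-] Aa [m2 Mm2 <-] ->]]]].
  exists m1, (compress p a), m2; split=> //.
  by rewrite cE adj_comp -!bcompA.
move=> _ b _ [m1 Mm1 <-] Bb [m2 Mm2 <-].
have [a Aa ae] : (compress p @` A) (bcomp m1 (bcomp b (adj m2))).
  by rewrite AE; apply: sub_wspan; exists m1, b, m2.
suff -> : bcomp (bcomp V m1) (bcomp b (adj (bcomp V m2))) = bcomp p (bcomp a p).
  by apply: AM => //; exact: AM.
rewrite adj_comp -bcompA [bcomp b _]bcompA [bcomp m1 _]bcompA -ae cE -VVa.
by rewrite -!bcompA.
Qed.

(** The projection is the left unit [r] of [M]. As [B] contains the identity, the products of
    elements of [M] with adjoints of others lie in [A], and so does [r]. The TRO into the corner is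
    [M] followed by the adjoint of the inclusion, which loses nothing since [r] fixes [M]. *)
Lemma corner_TRO_sub M : B (bid K) -> corner_equiv B A M -> TRO_sub B A.
Proof.
move=> B1 [M_TRO BE hA]; case: (A_alg) => [[A0 Al] _ A1 Ac].
have [r [r_adj r_idem rM rMM]] := TRO_unit M_TRO.
have Ar : A r.
  move: rMM; apply: wspan_min => // _ [u [v [Mu Mv ->]]].
  by have := hA u _ v Mu B1 Mv; rewrite bcomp_idl.
pose p := Projection r_idem r_adj; exists p; split=> //.
have [V [VVa VaV cE]] := prange_incl_ex p.
have VVar (F : hilbertType R) (X : bop F H) : bcomp V (bcomp (adj V) X) = bcomp r X.
  by rewrite bcompA VVa.
have Mr m : M m -> bcomp (adj m) r = adj m by move=> Mm; rewrite -{1}r_adj -adj_comp rM.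
have Mr' (F : hilbertType R) m (X : bop F H) : M m ->
    bcomp (adj m) (bcomp r X) = bcomp (adj m) X.
  by move=> Mm; rewrite bcompA Mr.
exists [set bcomp (adj V) m | m in M]; split.
- case: M_TRO => [[M0 Ml] MT]; split; first split.
  + by exists 0 => //; rewrite bcomp0r.
  + by move=> a _ _ [x Mx <-] [y My <-]; exists (a *: x + y); rewrite ?bcompPr//; exact: Ml.
  move=> _ _ _ [x Mx <-] [y My <-] [z Mz <-].
  exists (bcomp x (bcomp (adj y) z)); first exact: MT.
  by rewrite adj_comp adjK -!bcompA VVar Mr'.
- rewrite BE; congr wspan; apply/seteqP; split.
    move=> _ [m1 [a [m2 [Mm1 Aa Mm2 ->]]]].
    exists (bcomp (adj V) m1), (compress p a), (bcomp (adj V) m2).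
    split; [by exists m1|by exists a|by exists m2|].
    by rewrite cE adj_comp adjK -!bcompA !VVar Mr'// rM.
  move=> _ [_ [_ [_ [[m1 Mm1 <-] [a Aa <-] [m2 Mm2 <-] ->]]]].
  exists m1, a, m2; split=> //.
  by rewrite cE adj_comp adjK -!bcompA !VVar Mr'// rM.
set X := [set T | _]; apply/seteqP; split; last first.
  apply: wspan_min.
  - split; first by exists 0 => //; rewrite cE bcomp0l bcomp0r.
    move=> c _ _ [x Ax <-] [y Ay <-]; exists (c *: x + y); first exact: Al.
    by rewrite !cE bcompPl bcompPr.
  (* Closedness of the corner: the map sending [T] to [V T V^*] is w*-continuous and carries the
     corner into [A], which is closed; compressing the image gives [T] back. *)
  - move=> T cT; exists (bcomp V (bcomp T (adj V))); last first.
      by rewrite cE -!bcompA VaV bcomp_idr bcompA VaV bcomp_idl.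
    apply: (normal_map_closure (normal_map_sandwich V (adj V)) Ac) cT.
    move=> _ [a Aa <-]; rewrite cE -!bcompA VVa VVar.
    by apply: AM => //; exact: AM.
  move=> _ [_ [b [_ [[m1 Mm1 <-] Bb [m2 Mm2 <-] ->]]]].
  exists (bcomp m1 (bcomp b (adj m2))); first exact: hA.
  by rewrite cE adj_comp adjK -!bcompA.
move=> _ [a Aa <-]; rewrite cE.
have -> : bcomp (adj V) (bcomp a V) = bcomp (adj V) (bcomp (bcomp r (bcomp a r)) V).
  by rewrite -[r]/(p : bop H H) -VVa -!bcompA VaV bcomp_idr [bcomp (adj V) (bcomp V _)]bcompA VaV bcomp_idl.
have Xs := wspan_subspace X; have Xc : wclosed (wspan X) by exact: wspan_closed.
(* The right copy of [r] is frozen to a generator [u v^*] while the left one is expanded into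
   [u1 v1^*], with [v1^* a u] in [B] between them. The right copy is expanded afterwards: only one
   factor at a time can pass to a w*-limit. *)
have step u v : M u -> M v -> wspan X (bcomp (adj V) (bcomp r
    (bcomp a (bcomp u (bcomp (adj v) V))))).
  move=> Mu Mv; move: rMM; apply: (normal_map_wspan _ (normal_map_sandwich (adj V)
    (bcomp a (bcomp u (bcomp (adj v) V)))) Xs Xc).
    by move=> c x y; rewrite bcompPl bcompPr.
  move=> _ [u1 [v1 [Mu1 Mv1 ->]]]; apply: sub_wspan.
  exists (bcomp (adj V) u1), (bcomp (adj v1) (bcomp a u)), (bcomp (adj V) v).
  split; [by exists u1| |by exists v|].
    by rewrite BE; apply: sub_wspan; exists v1, a, u.
  by rewrite adj_comp adjK -!bcompA.
rewrite (_ : bcomp _ _ = bcomp (bcomp (adj V) (bcomp r a)) (bcomp r V)); last first.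
  by rewrite -!bcompA.
move: rMM; apply: (normal_map_wspan _ (normal_map_sandwich
    (bcomp (adj V) (bcomp r a)) V) Xs Xc).
  by move=> c x y; rewrite bcompPl bcompPr.
by move=> _ [u [v [Mu Mv ->]]]; rewrite -!bcompA; exact: step.
Qed.

End TROSub.

Theorem theorem2p10 (R : realType) (A B C : dualOpAlgType R) :
  Delta_sub C B -> Delta_sub B A -> Delta_sub C A.
Proof.
move=> [K' [L [f' [g [f'r gr]]]]] gf' [H [K [alpha [f [ar fr fa]]]]].
have [_ _ _ f'alg] := f'r; have [_ _ _ aalg] := ar; have [_ _ _ falg] := fr.
have [N gN] := TRO_sub_corner f'alg gf'.
have [M fM] := TRO_sub_corner aalg fa.
have [E [h [N' [hr hN]]]] := induced_rep (normal_rep_nrep f'r) (normal_rep_nrep fr)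
  (normal_rep_nrep gr) gN.
have h1 : range h (bid E) by exists 1 => //; case: hr.
have [U hU] := corner_trans h1 aalg falg hN fM.
exists H, E, alpha, h; split=> //; first exact: nrep_normal_rep.
exact: corner_TRO_sub hU.
Qed.
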